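(* Let $a>0$ and $g,\gamma\in L^2(\mathbb{R})$, and suppose that $\big(G(g,a,1/a),G(\gamma,a,1/a)\big)$ is a reproducing pair for $L^2(\mathbb{R})$. Then both $g\notin M^1_1$ and $\gamma\notin M^1_1$.
   Context: Inner products are linear in the first argument. Time-frequency shifts are given by $T_xM_\omega g(t)=e^{2\pi i\omega(t-x)}g(t-x)$, and for $\lambda=(x,\omega)\in\mathbb{R}^2$ we write $\pi(\lambda)=T_xM_\omega$. For $a,b>0$ the Gabor system with window $g$ is $G(g,a,b)=\{T_{an}M_{bm}g\}_{n,m\in\mathbb{Z}}$. Two families $\Psi=\{\psi_k\}_{k\in\mathcal{I}}$, $\Phi=\{\phi_k\}_{k\in\mathcal{I}}$ in a Hilbert space $\mathcal{H}$ form a reproducing pair $(\Psi,\Phi)$ for $\mathcal{H}$ if the operator $S_{\Psi,\Phi}:\mathcal{H}\to\mathcal{H}$, weakly given by $\langle S_{\Psi,\Phi}f,h\rangle:=\sum_{k\in\mathcal{I}}\langle f,\psi_k\rangle\langle\phi_k,h\rangle$ for $f,h\in\mathcal{H}$, is bounded and boundedly invertible. No order of summation over $\mathcal{I}$ is specified. Here $\mathcal{H}=L^2(\mathbb{R})$, $\mathcal{I}=\mathbb{Z}^2$, and the elements of the two Gabor systems with the same index $(n,m)$ are paired. The short-time Fourier transform is $V_hf(\lambda)=\langle f,\pi(\lambda)h\rangle$, $\lambda\in\mathbb{R}^2$. Let $v_s(x,\omega)=(1+|x|+|\omega|)^s$ and let $h$ be a nonzero Schwartz function. The modulation space is $M^p_s=\{f\in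 L^2(\mathbb{R}):\ V_hf\cdot v_s\in L^p(\mathbb{R}^2)\}$. In particular $M^1_1$ is the case $p=1$, $s=1$. *)

(* Defs.v *)
From HB Require Import structures.
From mathcomp Require Import all_boot all_order all_algebra finmap.
From mathcomp Require Import all_classical all_reals all_analysis.
From mathcomp Require Import complex.
From mathcomp.analysis.showcase Require summability.

Set Implicit Arguments.
Unset Strict Implicit.
Unset Printing Implicit Defensive.
Import Order.TTheory GRing.Theory Num.Theory.
Import numFieldNormedType.Exports.

Local Open Scope classical_set_scope.
Local Open Scope ring_scope.
Local Open Scope complex_scope.

(* The norm [`|z|] on [R[i]] takes its values in [R[i]]; this is the modulus
   as an element of [R]. *)
Definition cmod {R : realType} (z : R[i]) : R := ComplexField.Normc.normc z.

Definition cmeasurable {d : measure_display} {T : measurableType d}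
    {R : realType} (f : T -> R[i]) : Prop :=
  measurable_fun setT (fun x => complex.Re (f x)) /\
  measurable_fun setT (fun x => complex.Im (f x)).

Definition cintegral {d : measure_display} {T : measurableType d}
    {R : realType} (mu : {measure set T -> \bar R}) (f : T -> R[i]) : R[i] :=
  (\int[mu]_x complex.Re (f x)) +i* (\int[mu]_x complex.Im (f x)).

Definition cLnorm {d : measure_display} {T : measurableType d}
    {R : realType} (mu : {measure set T -> \bar R}) (p : \bar R)
    (f : T -> R[i]) : \bar R :=
  Lnorm mu p (fun x => (cmod (f x))%:E).

(* Elements of the complex L^p spaces are handled through representatives:
   equality in L^p is equality mu-almost everywhere. *)
Definition Lp {d : measure_display} {T : measurableType d}
    {R : realType} (mu : {measure set T -> \bar R}) (p : \bar R)
    (f : T -> R[i]) : Prop :=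
  cmeasurable f /\ (cLnorm mu p f < +oo)%E.

(* The measurable sets of [lebesgue_measure] are the Borel sets; every L^p
   class of Lebesgue measurable functions has a Borel representative. *)
Definition L2 {R : realType} (f : R -> R[i]) : Prop :=
  Lp (@lebesgue_measure R) 2%:E f.

Definition L2norm {R : realType} (f : R -> R[i]) : \bar R :=
  cLnorm (@lebesgue_measure R) 2%:E f.

Definition L2eq {R : realType} (f g : R -> R[i]) : Prop :=
  ae_eq (@lebesgue_measure R) setT f g.

Definition inner {R : realType} (f g : R -> R[i]) : R[i] :=
  cintegral (@lebesgue_measure R) (fun t => f t * (g t)^*).

(* Bounded linear operators on L^2(R), acting on representatives; the second
   clause says that the operator descends to almost-everywhere classes. *)
Definition bounded_operator {R : realType}
    (S : (R -> R[i]) -> (R -> R[i])) : Prop :=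
  [/\ forall f, L2 f -> L2 (S f),
      forall f g, L2 f -> L2 g -> L2eq f g -> L2eq (S f) (S g),
      forall (c : R[i]) f g, L2 f -> L2 g ->
        L2eq (S (fun t => c * f t + g t)) (fun t => c * S f t + S g t) &
      exists C : R, forall f, L2 f -> (L2norm (S f) <= C%:E * L2norm f)%E].

Definition boundedly_invertible {R : realType}
    (S : (R -> R[i]) -> (R -> R[i])) : Prop :=
  exists S' : (R -> R[i]) -> (R -> R[i]),
    [/\ bounded_operator S',
        forall f, L2 f -> L2eq (S (S' f)) f &
        forall f, L2 f -> L2eq (S' (S f)) f].

(* Unordered summation: convergence along the net of finite subsets of [I]. *)
Definition has_usum {R : realType} {I : choiceType} (x : I -> R[i])
    (s : R[i]) : Prop :=
  cmod (summability.partial_sum x A - s) @[A --> summability.totally]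
    --> (0 : R).

Definition weakly_given {R : realType} {I : choiceType}
    (Psi Phi : I -> R -> R[i]) (S : (R -> R[i]) -> (R -> R[i])) : Prop :=
  forall f h, L2 f -> L2 h ->
    has_usum (fun k => inner f (Psi k) * inner (Phi k) h) (inner (S f) h).

Definition reproducing_pair {R : realType} {I : choiceType}
    (Psi Phi : I -> R -> R[i]) : Prop :=
  [/\ forall k, L2 (Psi k),
      forall k, L2 (Phi k) &
      exists S : (R -> R[i]) -> (R -> R[i]),
        [/\ weakly_given Psi Phi S, bounded_operator S &
            boundedly_invertible S]].

Definition expi {R : realType} (t : R) : R[i] := cos t +i* sin t.

Definition translation {R : realType} (x : R) (g : R -> R[i]) : R -> R[i] :=
  fun t => g (t - x).

Definition modulation {R : realType} (w : R) (g : R -> R[i]) : R -> R[i] :=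
  fun t => expi (2 * pi * w * t) * g t.

Definition tfshift {R : realType} (l : R * R) (g : R -> R[i]) : R -> R[i] :=
  translation l.1 (modulation l.2 g).

Lemma tfshiftE {R : realType} (x w : R) (g : R -> R[i]) (t : R) :
  tfshift (x, w) g t = expi (2 * pi * w * (t - x)) * g (t - x).
Proof. by []. Qed.

Definition gabor {R : realType} (g : R -> R[i]) (a b : R) (k : int * int) :
    R -> R[i] :=
  tfshift (a * k.1%:~R, b * k.2%:~R) g.

Definition STFT {R : realType} (h f : R -> R[i]) (l : R * R) : R[i] :=
  inner f (tfshift l h).

Definition weight {R : realType} (s : R) (l : R * R) : R :=
  (1 + `|l.1| + `|l.2|) `^ s.

(* Derivatives of a complex-valued function of a real variable, taken on the
   real and imaginary parts. *)
Definition cderivn {R : realType} (n : nat) (h : R -> R[i]) (t : R) : R[i] :=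
  derive1n n (fun x => complex.Re (h x)) t
    +i* derive1n n (fun x => complex.Im (h x)) t.

Definition smooth {R : realType} (h : R -> R[i]) : Prop :=
  forall (n : nat) (t : R),
    derivable (derive1n n (fun x => complex.Re (h x))) t 1 /\
    derivable (derive1n n (fun x => complex.Im (h x))) t 1.

Definition schwartz {R : realType} (h : R -> R[i]) : Prop :=
  smooth h /\
  forall k n : nat, exists C : R, forall t : R,
    `|t| ^+ k * cmod (cderivn n h t) <= C.

Definition modulation_space {R : realType} (h : R -> R[i]) (p : \bar R)
    (s : R) (f : R -> R[i]) : Prop :=
  L2 f /\
  Lp (@lebesgue_measure R \x @lebesgue_measure R)%E p
    (fun l => STFT h f l * (weight s l)%:C).

(* Main.v *)
From HB Require Import structures.
Require Import Defs.
From mathcomp Require Import all_boot all_order all_algebra finmap.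
From mathcomp Require Import all_classical all_reals all_analysis.
From mathcomp Require Import measurable_realfun complex ring lra zify.
From mathcomp.analysis.showcase Require summability.

Set Implicit Arguments.
Unset Strict Implicit.
Unset Printing Implicit Defensive.
Import Order.TTheory GRing.Theory Num.Theory.
Import numFieldNormedType.Exports.

Local Open Scope classical_set_scope.
Local Open Scope ring_scope.
Local Open Scope complex_scope.
(** The two lattice constants have product 1, so the time-frequency shifts
    [G_k] by lattice vectors commute, and they are diagonalised by the Zak
    transform: at a point [p = (t, th)] they act by the character [k |-> chi k]
    of the lattice ([character]).  If the Zak transform of [g] were continuous,
    quasi-periodicity would force it to have a zero, and the pair could not be
    reproducing near this zero.  For [g] in the modulation space the Zak
    transform has to be recovered from coefficients first.

    Let [v] be a time-frequency shift of [h].  By Tonelli's theorem, almost all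
    shifts have coefficients [<g, G_k v>] that are summable together with their
    first moments ([good_window_dense]).  Then the symbol
    [B_v p = sum_k <g, G_k v> chi k] is a Lipschitz function of [p]; formally it
    is the product of the Zak transform of [g] and the conjugate of the Zak
    transform [Z_v] of [v].  So put [kappa p = B_v p / conj (Z_v p)], where [v]
    is any such window with [Z_v p <> 0] ([good_window_exists]).

    - [kappa] does not depend on [v].  By linearity it is enough that [Z_v p = 0]
      implies [B_v p = 0] ([zak_zero_transfer]).  As [g] is only known to be
      square integrable, this is tested on the Fejer means of the series
      [sum_k conj (chi k) G_k v]: because [Z_v p = 0] they are bounded in L2, and
      they tend to 0 against compactly supported functions.

    - [kappa] vanishes nowhere ([symbol_neq0]).  Suppose [B_v p = 0] and
      [Z_v p <> 0], and sum [conj (chi k) G_k v] over the [k] in an [N] by [N]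
      box.  The norm of the sum is at least [c N] ([box_sum_lower]).  Its
      coefficients with respect to [g] are sums over boxes of a family with sum
      0, so that in the reproducing form only displacements of the corresponding
      box sum of [gamma] by lattice vectors survive.  These are supported on the
      faces of the box, and by the mean ergodic theorems
      ([orbit_sum_freq_small], [orbit_sum_time_small]) their norms are [o(N)]
      ([reproducing_form_bound]).  For a reproducing pair the form is bounded
      below, a contradiction.

    - [kappa] is continuous, [2 pi]-periodic in [th] and satisfies
      [kappa (t + a) th = e^(- i th) kappa t th].  A continuous function without
      zeros cannot do so, because its winding number in [th] would have to
      drop by 1 from [t] to [t + a] ([no_quasi_periodic]).

    The form is bounded below in both orders of the pair
    ([reproducing_pair_below], [reproducing_pair_above]), so the argument applies
    to [g] and to [gamma]. *)

Local Notation cj := (@conjc _).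

(** * The modulus and the unimodular exponentials *)

Section Modulus.
Context {R : realType}.
Implicit Types (z w : R[i]) (x y t : R).

Lemma cmod_ge0 z : 0 <= cmod z.
Proof. by case: z => a b; exact: sqrtr_ge0. Qed.

Lemma cmodM z w : cmod (z * w) = cmod z * cmod w.
Proof. exact: ComplexField.Normc.normcM. Qed.

Lemma cmodD z w : cmod (z + w) <= cmod z + cmod w.
Proof. exact: le_normcD. Qed.

Lemma cmodN z : cmod (- z) = cmod z.
Proof. exact: normcN. Qed.

Lemma cmodB z w : cmod (z - w) <= cmod z + cmod w.
Proof. by rewrite -[cmod w]cmodN cmodD. Qed.

Lemma cmod_dist z w : cmod (z - w) = cmod (w - z).
Proof. by rewrite -cmodN opprB. Qed.

Lemma cmod0 : cmod (0 : R[i]) = 0.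
Proof. exact: ComplexField.Normc.normc0. Qed.

Lemma cmod1 : cmod (1 : R[i]) = 1.
Proof. exact: ComplexField.Normc.normc1. Qed.

Lemma cmodV z : cmod z^-1 = (cmod z)^-1.
Proof. exact: ComplexField.Normc.normcV. Qed.

Lemma cmod_eq0 z : (cmod z == 0) = (z == 0).
Proof.
apply/eqP/eqP => [/ComplexField.Normc.eq0_normc //|->]; exact: cmod0.
Qed.

Lemma cmod_gt0 z : (0 < cmod z) = (z != 0).
Proof. by rewrite lt_def cmod_eq0 cmod_ge0 andbT. Qed.

Lemma cmod_conj z : cmod (cj z) = cmod z.
Proof. by case: z => a b; rewrite /cmod /= sqrrN. Qed.

Lemma cmod_sqr z : cmod z ^+ 2 = complex.Re z ^+ 2 + complex.Im z ^+ 2.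
Proof. by case: z => a b; rewrite /cmod /= sqr_sqrtr ?addr_ge0 ?sqr_ge0. Qed.

Lemma mul_conj z : z * cj z = (cmod z ^+ 2)%:C.
Proof.
rewrite cmod_sqr; case: z => a b /=; apply/eqP; rewrite eq_complex /=.
by apply/andP; split; apply/eqP; ring.
Qed.

Lemma Re_le_cmod z : `|complex.Re z| <= cmod z.
Proof.
rewrite -(@ler_pXn2r _ 2) ?nnegrE ?cmod_ge0 // cmod_sqr real_normK ?num_real //.
by rewrite lerDl sqr_ge0.
Qed.

Lemma Im_le_cmod z : `|complex.Im z| <= cmod z.
Proof.
rewrite -(@ler_pXn2r _ 2) ?nnegrE ?cmod_ge0 // cmod_sqr real_normK ?num_real //.
by rewrite lerDr sqr_ge0.
Qed.

Lemma cmod_le_ReIm z : cmod z <= `|complex.Re z| + `|complex.Im z|.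
Proof.
rewrite -(@ler_pXn2r _ 2) ?nnegrE ?cmod_ge0 ?addr_ge0 // cmod_sqr sqrrD.
rewrite !real_normK ?num_real // lerD2r lerDl.
by rewrite mulrn_wge0 // mulr_ge0.
Qed.

Lemma cmod_real x : cmod x%:C = `|x|.
Proof. by rewrite /cmod /= expr0n addr0 sqrtr_sqr. Qed.

Lemma cmod_nat n : cmod (n%:R : R[i]) = n%:R.
Proof.
have -> : (n%:R : R[i]) = (n%:R : R)%:C by rewrite rmorph_nat.
by rewrite cmod_real ger0_norm.
Qed.

Lemma cmod_sum I (r : seq I) (P : pred I) (F : I -> R[i]) :
  cmod (\sum_(i <- r | P i) F i) <= \sum_(i <- r | P i) cmod (F i).
Proof.
elim/big_rec2: _ => [|i a z _ le_za]; first by rewrite cmod0.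
by rewrite (le_trans (cmodD _ _)) // lerD2l.
Qed.

Lemma complex_eq z w : complex.Re z = complex.Re w ->
  complex.Im z = complex.Im w -> z = w.
Proof. by case: z w => a b [c d] /= -> ->. Qed.

Lemma cReD z w : complex.Re (z + w) = complex.Re z + complex.Re w.
Proof. by case: z w => a b []. Qed.

Lemma cImD z w : complex.Im (z + w) = complex.Im z + complex.Im w.
Proof. by case: z w => a b []. Qed.

Lemma cReM z w : complex.Re (z * w) =
  complex.Re z * complex.Re w - complex.Im z * complex.Im w.
Proof. by case: z w => a b []. Qed.

Lemma cImM z w : complex.Im (z * w) =
  complex.Re z * complex.Im w + complex.Im z * complex.Re w.
Proof. by case: z w => a b []. Qed.

Lemma cReJ z : complex.Re (cj z) = complex.Re z.
Proof. by case: z. Qed.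

Lemma cImJ z : complex.Im (cj z) = - complex.Im z.
Proof. by case: z. Qed.

Lemma cReB z w : complex.Re (z - w) = complex.Re z - complex.Re w.
Proof. by case: z w => a b []. Qed.

Lemma cImB z w : complex.Im (z - w) = complex.Im z - complex.Im w.
Proof. by case: z w => a b []. Qed.

Lemma cjM z w : cj (z * w) = cj z * cj w. Proof. exact: rmorphM. Qed.
Lemma cjD z w : cj (z + w) = cj z + cj w. Proof. exact: rmorphD. Qed.
Lemma cjB z w : cj (z - w) = cj z - cj w. Proof. exact: rmorphB. Qed.
Lemma cjN z : cj (- z) = - cj z. Proof. exact: rmorphN. Qed.
Lemma cj_sum I (r : seq I) (P : pred I) (F : I -> R[i]) :
  cj (\sum_(i <- r | P i) F i) = \sum_(i <- r | P i) cj (F i).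
Proof. exact: rmorph_sum. Qed.

Lemma expiD x y : expi (x + y) = expi x * expi y.
Proof. by rewrite /expi cosD sinD; apply: complex_eq => //=; ring. Qed.

Lemma expi0 : expi 0 = 1 :> R[i].
Proof. by rewrite /expi cos0 sin0. Qed.

Lemma cmod_expi x : cmod (expi x) = 1.
Proof. by rewrite /cmod /= cos2Dsin2 sqrtr1. Qed.

Lemma conj_expi x : cj (expi x) = expi (- x).
Proof. by rewrite /expi cosN sinN. Qed.

Lemma expi_neq0 x : expi x != 0.
Proof. by rewrite -cmod_gt0 cmod_expi. Qed.

Lemma expiN x : expi (- x) = (expi x)^-1.
Proof.
by apply: (mulfI (expi_neq0 x)); rewrite mulfV ?expi_neq0 // -expiD subrr expi0.
Qed.

Lemma expi_conjK x : cj (expi x) * expi x = 1.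
Proof. by rewrite conj_expi -expiD addNr expi0. Qed.

Lemma expi_Kconj x : expi x * cj (expi x) = 1.
Proof. by rewrite mulrC expi_conjK. Qed.

Lemma expi2pi_int (n : int) : expi (2 * pi * n%:~R : R) = 1.
Proof.
have e1 : expi (2 * pi : R) = 1.
  have -> : 2 * pi = pi + pi :> R by ring.
  by rewrite /expi cosD sinD cospi sinpi; apply: complex_eq => /=; ring.
have en (m : nat) : expi (2 * pi * m%:R : R) = 1.
  elim: m => [|m IH]; first by rewrite mulr0 expi0.
  by rewrite -[m.+1%:R]natr1 mulrDr expiD IH mulr1 e1 mulr1.
case: n => m; first exact: en.
by rewrite NegzE mulrNz mulrN expiN en invr1.
Qed.

Lemma cos_eq1_small (x : R) : cos x = 1 -> `|x| < 2 * pi -> x = 0.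
Proof.
wlog x0 : x / 0 <= x => [hw|] cx xlt.
  case: (leP 0 x) => [/hw|x_lt0]; first exact.
  by apply/eqP; rewrite -oppr_eq0; apply/eqP/hw;
     rewrite ?oppr_ge0 ?cosN ?normrN // ltW.
move: xlt; rewrite ger0_norm // => xlt.
apply: contra_eq cx => xn0.
have xp : 0 < x / 2 by rewrite divr_gt0 // lt_def xn0.
have s0 : 0 < sin (x / 2).
  by apply: sin_gt0_pi; rewrite xp /= ltr_pdivrMr // mulrC.
have -> : x = x / 2 + x / 2 by lra.
rewrite cosD.
have := cos2Dsin2 (x / 2); rewrite !expr2 => h.
have : 0 < sin (x / 2) * sin (x / 2) by rewrite mulr_gt0.
by move=> h2; rewrite lt_eqF //; lra.
Qed.

Lemma expi_eq1_small (x : R) : expi x = 1 -> `|x| < 2 * pi -> x = 0.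
Proof. by case=> cx _; exact: cos_eq1_small. Qed.

End Modulus.

(** * Unordered sums *)

Section UnorderedSums.
Context {R : realType} {I : choiceType}.
Implicit Types (x y : I -> R[i]) (A : {fset I}).

Lemma has_usumP x s : has_usum x s <-> forall e : R, 0 < e ->
  exists A0 : {fset I}, forall A, fsubset A0 A ->
    cmod (\sum_(i <- A) x i - s) < e.
Proof.
have FF := @summability.totally_filter I.
rewrite /has_usum; split=> [/cvgrPdist_lt xs e e0|xs].
  have [A0 _ hA] := xs e e0; exists A0 => A A0A.
  have := hA A A0A; rewrite /= sub0r normrN ger0_norm ?cmod_ge0 //.
  by rewrite /summability.partial_sum big_seq_fsetE.
apply/cvgrPdist_lt => e e0; have [A0 hA] := xs e e0.
exists A0 => // A /hA /=.
by rewrite sub0r normrN ger0_norm ?cmod_ge0 // /summability.partial_sum big_seq_fsetE.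
Qed.

Lemma has_usum_unique x s t : has_usum x s -> has_usum x t -> s = t.
Proof.
move=> /has_usumP xs /has_usumP xt; apply/eqP; rewrite -subr_eq0 -cmod_eq0.
apply: contraT => st_neq0.
have e0 : 0 < cmod (s - t) / 2 by rewrite divr_gt0 // lt_def st_neq0 cmod_ge0.
have [A hA] := xs _ e0; have [B hB] := xt _ e0.
have := hA (A `|` B)%fset (fsubsetUl _ _).
have := hB (A `|` B)%fset (fsubsetUr _ _).
set S := \sum_(i <- _) _ => h1 h2; rewrite [cmod (S - s)]cmod_dist in h2.
exfalso; have : cmod (s - t) <= cmod (s - S) + cmod (S - t).
  by apply: le_trans (cmodD _ _); rewrite addrA subrK.
lra.
Qed.

Lemma eq_has_usum x y s : x =1 y -> has_usum x s -> has_usum y s.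
Proof. by move=> /funext ->. Qed.

Lemma has_usumD x y s t : has_usum x s -> has_usum y t ->
  has_usum (fun i => x i + y i) (s + t).
Proof.
move=> /has_usumP xs /has_usumP yt; apply/has_usumP => e e0.
have e2 : 0 < e / 2 by rewrite divr_gt0.
have [A hA] := xs _ e2; have [B hB] := yt _ e2.
exists (A `|` B)%fset => C; rewrite fsubUset => /andP[/hA hx /hB hy].
rewrite big_split /= opprD addrACA (le_lt_trans (cmodD _ _)) //.
by rewrite [e]splitr ltrD.
Qed.

Lemma has_usumZ (c : R[i]) x s : has_usum x s -> has_usum (fun i => c * x i) (c * s).
Proof.
move=> /has_usumP xs; apply/has_usumP => e e0.
have c0 : 0 < cmod c + 1 by rewrite ltr_wpDl // cmod_ge0.
have [A hA] := xs _ (divr_gt0 e0 c0).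
exists A => C /hA; rewrite -mulr_sumr -mulrBr cmodM ltr_pdivlMr //.
by rewrite mulrDr mulr1 mulrC; have := cmod_ge0 (\sum_(i <- C) x i - s); lra.
Qed.

Lemma has_usumB x y s t : has_usum x s -> has_usum y t ->
  has_usum (fun i => x i - y i) (s - t).
Proof.
move=> xs /(has_usumZ (-1)); rewrite mulN1r => yt.
by apply: eq_has_usum (has_usumD xs yt) => i; rewrite mulN1r.
Qed.

Lemma has_usum_conj x s : has_usum x s -> has_usum (fun i => cj (x i)) (cj s).
Proof.
move=> /has_usumP xs; apply/has_usumP => e e0.
have [A hA] := xs _ e0; exists A => C /hA.
by rewrite -rmorph_sum -rmorphB cmod_conj.
Qed.

Lemma has_usum0 : has_usum (fun _ : I => 0 : R[i]) 0.
Proof.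
by apply/has_usumP => e e0; exists fset0 => A _; rewrite big1 // subr0 cmod0.
Qed.

Lemma has_usum_sum J (r : seq J) (P : pred J) (x : J -> I -> R[i]) (s : J -> R[i]) :
  (forall j, P j -> has_usum (x j) (s j)) ->
  has_usum (fun i => \sum_(j <- r | P j) x j i) (\sum_(j <- r | P j) s j).
Proof.
move=> xs; elim: r => [|j r IH].
  by rewrite big_nil; apply: eq_has_usum has_usum0 => i; rewrite big_nil.
rewrite big_cons; case: ifPn => Pj.
  by apply: eq_has_usum (has_usumD (xs j Pj) IH) => i; rewrite big_cons Pj.
by apply: eq_has_usum IH => i; rewrite big_cons (negbTE Pj).
Qed.

Lemma has_usum_finite A x : (forall i, i \notin A -> x i = 0) ->
  has_usum x (\sum_(i <- A) x i).
Proof.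
move=> x0; apply/has_usumP => e e0; exists A => B AB.
rewrite -(big_fset_incl _ AB) ?subrr ?cmod0 // => i _; exact: x0.
Qed.

Lemma has_usum_delta (x : I -> R[i]) (j : I) :
  has_usum (fun i => (i == j)%:R * x i) (x j).
Proof.
have := @has_usum_finite [fset j]%fset (fun i => (i == j)%:R * x i).
rewrite big_seq_fset1 eqxx mul1r; apply => i; rewrite in_fset1 => /negbTE ->.
by rewrite mul0r.
Qed.
Lemma has_usum_le x (y : I -> R) s K : (forall i, cmod (x i) <= y i) ->
  (forall A, \sum_(i <- A) y i <= K) -> has_usum x s -> cmod s <= K.
Proof.
move=> xy yK /has_usumP xs; apply/ler_addgt0Pl => e /xs[A hA].
have := hA A (fsubset_refl _); rewrite cmod_dist => h.
have -> : s = (s - \sum_(i <- A) x i) + \sum_(i <- A) x i by rewrite subrK.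
rewrite (le_trans (cmodD _ _)) // lerD ?(ltW h) //.
rewrite (le_trans (cmod_sum _ _ _)) // (le_trans _ (yK A)) //.
exact: ler_sum.
Qed.

Lemma sum_fsubset_le (y : I -> R) A (B : {fset I}) : (forall i, 0 <= y i) ->
  fsubset A B -> \sum_(i <- A) y i <= \sum_(i <- B) y i.
Proof.
move=> y0 AB; rewrite (big_fsetID _ (mem A) B) /=.
have -> : [fset i in B | i \in A]%fset = A.
  apply/fsetP => i; rewrite !inE /= andbC.
  by case: (boolP (i \in A)) => //= iA; rewrite (fsubsetP AB).
by rewrite lerDl sumr_ge0.
Qed.

Lemma has_usum_nonneg (y : I -> R) K : (forall i, 0 <= y i) ->
  (forall A, \sum_(i <- A) y i <= K) -> exists s : R, has_usum (fun i => (y i)%:C) s%:C.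
Proof.
move=> y0 yK; pose S := [set \sum_(i <- A) y i | A in [set: {fset I}]].
have hS : has_sup S.
  split; first by exists (\sum_(i <- fset0) y i); exists fset0.
  by exists K => _ [A _ <-].
exists (sup S); apply/has_usumP => e e0.
have [_ [A0 _ <-] hA0] := sup_adherent e0 hS.
exists A0 => A A0A; rewrite -rmorph_sum -rmorphB cmod_real ltr_norml.
have h1 : \sum_(i <- A) y i <= sup S.
  by apply: sup_upper_bound => //; exists A.
have h2 := sum_fsubset_le y0 A0A.
by apply/andP; split; lra.
Qed.

Lemma has_usum_ex x (y : I -> R) K : (forall i, cmod (x i) <= y i) ->
  (forall A, \sum_(i <- A) y i <= K) -> exists s, has_usum x s.
Proof.
move=> xy yK.
(* a real family is the difference of its nonnegative parts *)
have real_ex (u : I -> R) : (forall i, `|u i| <= y i) ->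
    exists s : R, has_usum (fun i => (u i)%:C) s%:C.
  move=> uy; have y0 i : 0 <= y i := le_trans (normr_ge0 _) (uy i).
  have [|A|s1 h1] := @has_usum_nonneg (fun i => (`|u i| + u i) / 2) K.
  - by move=> i; rewrite divr_ge0 //; have := ler_norm (- u i); rewrite normrN; lra.
  - rewrite (le_trans _ (yK A)) // ler_sum // => i _.
    by have := uy i; have := ler_norm (u i); lra.
  have [|A|s2 h2] := @has_usum_nonneg (fun i => (`|u i| - u i) / 2) K.
  - by move=> i; rewrite divr_ge0 // subr_ge0 ler_norm.
  - rewrite (le_trans _ (yK A)) // ler_sum // => i _.
    by have := uy i; have := ler_norm (- u i); rewrite normrN; lra.
  exists (s1 - s2); rewrite rmorphB; apply: eq_has_usum (has_usumB h1 h2) => i.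
  by rewrite -rmorphB; congr (_%:C); field.
have [s1 h1] := real_ex (fun i => complex.Re (x i))
  (fun i => le_trans (Re_le_cmod _) (xy i)).
have [s2 h2] := real_ex (fun i => complex.Im (x i))
  (fun i => le_trans (Im_le_cmod _) (xy i)).
exists (s1%:C + 'i%C * s2%:C).
apply: eq_has_usum (has_usumD h1 (has_usumZ 'i%C h2)) => i.
by rewrite [RHS]complexE.
Qed.

Lemma sum_scale_le (y : I -> R) K (c : R) : 0 <= c ->
  (forall A, \sum_(i <- A) y i <= K) ->
  forall A, \sum_(i <- A) c * y i <= c * K.
Proof. by move=> c0 yK A; rewrite -mulr_sumr ler_wpM2l. Qed.

End UnorderedSums.

Lemma has_usum_reindex {R : realType} {I J : choiceType} (f : J -> I) (g : I -> J)
    (x : I -> R[i]) (s : R[i]) :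
  cancel f g -> cancel g f -> has_usum x s -> has_usum (fun j => x (f j)) s.
Proof.
move=> fK gK /has_usumP xs; apply/has_usumP => e e0.
have [A0 hA] := xs e e0; exists [fset g i | i in A0]%fset => A A0A.
have := hA [fset f j | j in A]%fset.
rewrite big_imfset /=; last by move=> i j _ _; exact: (can_inj fK).
apply; apply/fsubsetP => i iA0; apply/imfsetP; exists (g i); rewrite ?gK //=.
by apply: (fsubsetP A0A); apply/imfsetP; exists i.
Qed.

Section LatticeWeights.
Context {R : realType}.

Lemma sum_subseq_le (I : eqType) (y : I -> R) (s s' : seq I) :
  (forall i, 0 <= y i) -> uniq s -> {subset s <= s'} ->
  \sum_(i <- s) y i <= \sum_(i <- s') y i.
Proof.
move=> y0; elim: s s' => [|i s IH] s' /=.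
  by rewrite big_nil sumr_ge0.
move=> /andP[iNs us] ss'; have is' : i \in s' by rewrite ss' ?mem_head.
rewrite big_cons (perm_big _ (perm_to_rem is')) /= big_cons lerD2l IH // => j js.
have : j \in i :: rem i s'.
  by rewrite -(perm_mem (perm_to_rem is')) ss' // inE js orbT.
by rewrite inE => /predU1P[ji|//]; rewrite -ji js in iNs.
Qed.

Lemma sum_int_le (y : int -> R) (A : {fset int}) : (forall i, 0 <= y i) ->
  exists M : nat, \sum_(i <- A) y i <=
    \sum_(0 <= n < M) (y (Posz n) + y (Negz n)).
Proof.
move=> y0; pose M := (\max_(i <- A) `|i|%N).+1; exists M.
have -> : \sum_(0 <= n < M) (y (Posz n) + y (Negz n)) =
    \sum_(i <- map Posz (index_iota 0 M) ++ map Negz (index_iota 0 M)) y i.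
  by rewrite big_cat !big_map big_split.
apply: sum_subseq_le => // i iA.
have iM : (`|i| < M)%N by rewrite ltnS; exact: (leq_bigmax_seq (F := absz) i iA).
rewrite mem_cat; apply/orP; case: i iA iM => n nA nM.
  by left; apply: map_f; rewrite mem_index_iota.
by right; apply: map_f; rewrite mem_index_iota; lia.
Qed.

(** Comparison with [2 / ((n + 1) (n + 2))], which telescopes. *)
Lemma sum_inv_sq_le (A : {fset int}) :
  \sum_(i <- A) (1 + `|i%:~R : R|) ^- 2 <= 4.
Proof.
have y0 (i : int) : 0 <= (1 + `|i%:~R : R|) ^- 2.
  by rewrite invr_ge0 exprn_ge0 // addr_ge0.
have [M hM] := sum_int_le A y0; apply: le_trans hM _.
apply: (@le_trans _ _ (\sum_(0 <= n < M.+1) ((1 + `|(Posz n)%:~R : R|) ^- 2 +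
    (1 + `|(Negz n)%:~R : R|) ^- 2))).
  by rewrite [leRHS]big_nat_recr //= lerDl addr_ge0 // y0.
suff h : \sum_(0 <= n < M.+1) ((1 + `|(Posz n)%:~R : R|) ^- 2 +
    (1 + `|(Negz n)%:~R : R|) ^- 2) <= 4 - 2 / (M%:R + 1).
  by apply: (le_trans h); rewrite lerBlDr lerDl divr_ge0 // addr_ge0 ?ler0n.
have posE n : `|(Posz n)%:~R : R| = n%:R by rewrite normr_nat.
have negE n : `|(Negz n)%:~R : R| = n%:R + 1.
  by rewrite NegzE mulrNz normrN normr_nat -natr1.
elim: M => [|M IH].
  rewrite big_nat1 posE negE add0r addr0 expr1n invr1.
  have -> : (1 + 1 : R) ^- 2 = 4^-1 by field.
  lra.
rewrite big_nat_recr //= posE negE -[M.+1%:R]natr1.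
set m : R := M%:R in IH *; have m0 : 0 <= m by rewrite ler0n.
have -> : 4 - 2 / (m + 1 + 1) = (4 - 2 / (m + 1)) + 2 / ((m + 1) * (m + 2)).
  by field; apply/andP; split; apply: lt0r_neq0; lra.
apply: lerD => //.
have bound (x : R) : m + 2 <= x -> x ^- 2 <= ((m + 1) * (m + 2))^-1.
  move=> hx; rewrite lef_pV2 ?posrE ?mulr_gt0 ?exprn_gt0 ?expr2 //; try lra.
  by apply: ler_pM; lra.
have h1 := bound (1 + (m + 1)) ltac:(lra).
have h2 := bound (1 + (m + 1 + 1)) ltac:(lra).
by rewrite mulr_natl mulr2n; apply: lerD.
Qed.

End LatticeWeights.

(** * Integrals on the line and translations *)

Section RealIntegrals.
Context {R : realType}.
Implicit Types (f g : R -> R).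

Definition integ f : Prop :=
  (@lebesgue_measure R).-integrable setT (EFin \o f).
Definition rint f : R := (\int[@lebesgue_measure R]_t f t)%R.

Lemma integ_measurable f : integ f -> measurable_fun setT f.
Proof. by move=> /measurable_int /measurable_EFinP. Qed.

Lemma integD f g : integ f -> integ g -> integ (fun t => f t + g t).
Proof. by move=> hf hg; exact: (integrableD measurableT hf hg). Qed.

Lemma integZ c f : integ f -> integ (fun t => c * f t).
Proof. by move=> hf; exact: (integrableZl measurableT c hf). Qed.

Lemma integ_le f g : measurable_fun setT f -> (forall t, `|f t| <= g t) ->
  integ g -> integ f.
Proof.
move=> mf fg; apply: le_integrable => //; first exact/measurable_EFinP.
by move=> t _; rewrite lee_fin (le_trans (fg t)) // ler_norm.
Qed.

Lemma rintD f g : integ f -> integ g ->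
  rint (fun t => f t + g t) = rint f + rint g.
Proof. exact: RintegralD. Qed.

Lemma rintZ c f : integ f -> rint (fun t => c * f t) = c * rint f.
Proof. exact: RintegralZl. Qed.

Lemma rintB f g : integ f -> integ g ->
  rint (fun t => f t - g t) = rint f - rint g.
Proof. exact: RintegralB. Qed.

Lemma rint_le f g : integ f -> integ g -> (forall t, f t <= g t) ->
  rint f <= rint g.
Proof. by move=> hf hg fg; apply: le_Rintegral. Qed.

Lemma rint_ge0 f : (forall t, 0 <= f t) -> 0 <= rint f.
Proof. by move=> f0; apply: Rintegral_ge0. Qed.

Lemma rint_abs f : integ f -> `|rint f| <= rint (fun t => `|f t|).
Proof. exact: le_normr_Rintegral. Qed.

Lemma eq_rint f g : f =1 g -> rint f = rint g.
Proof. by move=> /funext ->. Qed.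

Lemma integ_EFin f : integ f -> (\int[@lebesgue_measure R]_t (f t)%:E)%E = (rint f)%:E.
Proof. by move=> hf; rewrite /rint /Rintegral fineK // integrable_fin_num. Qed.

Lemma integ0 : integ (fun=> 0).
Proof. exact: integrable0. Qed.

Lemma integ_sum I (r : seq I) (P : pred I) (F : I -> R -> R) :
  (forall i, P i -> integ (F i)) -> integ (fun t => \sum_(i <- r | P i) F i t).
Proof.
move=> hF; elim: r => [|i r IH].
  by apply: eq_integrable integ0 => // t _ /=; rewrite big_nil.
case: (boolP (P i)) => Pi.
  by apply: eq_integrable (integD (hF i Pi) IH) => // t _ /=; rewrite big_cons Pi.
by apply: eq_integrable IH => // t _ /=; rewrite big_cons (negbTE Pi).
Qed.

Lemma rint_sum I (r : seq I) (P : pred I) (F : I -> R -> R) :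
  (forall i, P i -> integ (F i)) ->
  rint (fun t => \sum_(i <- r | P i) F i t) = \sum_(i <- r | P i) rint (F i).
Proof.
move=> hF; elim: r => [|i r IH].
  rewrite big_nil -[RHS](mul0r (rint (fun=> 0))) -rintZ; last exact: integ0.
  by apply: eq_rint => t; rewrite big_nil mul0r.
rewrite big_cons; case: (boolP (P i)) => Pi.
  rewrite -IH -rintD //; last exact: integ_sum.
    by apply: eq_rint => t; rewrite big_cons Pi.
  exact: hF.
by rewrite -IH; apply: eq_rint => t; rewrite big_cons (negbTE Pi).
Qed.

Lemma measurable_shift (x : R) :
  measurable_fun setT ((fun t => t - x) : measurableTypeR R -> measurableTypeR R).
Proof. exact: measurable_funB. Qed.

Lemma lebesgue_measure_shift (x : R) (A : set R) : measurable A ->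
  pushforward (@lebesgue_measure R)
    ((fun t => t - x) : _ -> measurableTypeR R) A = @lebesgue_measure R A.
Proof.
move=> mA; apply/esym/lebesgue_measure_unique => //=.
  exact: measurable_shift.
move=> mshift _ [[u v]] _ <- /=; rewrite /pushforward.
have -> : (fun t => t - x) @^-1` `]u, v]%classic = `]u + x, v + x]%classic.
  by apply/seteqP; split => t /=; rewrite !in_itv /= ltrBrDr lerBlDr.
rewrite !lebesgue_measure_itv /= !lte_fin ltrD2r.
by case: ifP => // _; rewrite -!EFinB; congr EFin; ring.
Qed.

Lemma ge0_integral_shift (x : R) (f : R -> \bar R) : measurable_fun setT f ->
  (forall t, (0 <= f t)%E) ->
  (\int[@lebesgue_measure R]_t f ((t : R) - x)%R = \int[@lebesgue_measure R]_t f t)%E.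
Proof.
move=> mf f0.
have := @ge0_integral_pushforward _ _ _ _ R _ (measurable_shift x)
  (@lebesgue_measure R) setT f measurableT mf (fun t _ => f0 t).
rewrite preimage_setT => <-.
apply: eq_measure_integral => [|mshift A mA _]; first exact: measurable_shift.
exact: lebesgue_measure_shift.
Qed.

Lemma measurable_comp_shift (x : R) f : measurable_fun setT f ->
  measurable_fun setT (fun t : R => f (t - x)).
Proof. by move=> mf; exact: (measurableT_comp mf (measurable_shift x)). Qed.

Lemma integ_shift (x : R) f : integ f -> integ (fun t => f (t - x)).
Proof.
move=> /integrableP[/measurable_EFinP mf f_lty]; apply/integrableP; split.
  by apply/measurable_EFinP; exact: (measurable_comp_shift x mf).
by rewrite (ge0_integral_shift x (f := fun t => `|(f t)%:E|%E)) //;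
  exact/measurableT_comp/measurable_EFinP.
Qed.

Lemma rint_shift (x : R) f : integ f -> rint (fun t => f (t - x)) = rint f.
Proof.
move=> hf; rewrite /rint /Rintegral; congr fine.
have mf : measurable_fun setT (EFin \o f).
  by apply/measurable_EFinP; exact: integ_measurable.
have := @integral_pushforward _ _ _ _ R _ (measurable_shift x)
  (@lebesgue_measure R) setT (EFin \o f) mf.
rewrite preimage_setT => <- //; last exact: (integ_shift x hf).
apply: eq_measure_integral => [|mshift A mA _]; first exact: measurable_shift.
exact: lebesgue_measure_shift.
Qed.

End RealIntegrals.

(** * The Hilbert space of square integrable functions *)

Section MeasurableModulus.
Context {R : realType} {d : measure_display} {T : measurableType d}.
Implicit Types f : T -> R[i].

Lemma cmeas_sqr f : cmeasurable f -> measurable_fun setT (fun t => cmod (f t) ^+ 2).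
Proof.
move=> [mr mi].
rewrite (_ : (fun t => _) = (fun t => complex.Re (f t) ^+ 2 + complex.Im (f t) ^+ 2)).
  by apply: measurable_funD; exact: measurable_funX.
by apply/funext => t; rewrite cmod_sqr.
Qed.

Lemma cmeas_cmod f : cmeasurable f -> measurable_fun setT (fun t => cmod (f t)).
Proof.
move=> /cmeas_sqr mf.
rewrite (_ : (fun t => _) = Num.sqrt \o (fun t => cmod (f t) ^+ 2)).
  by apply: measurableT_comp mf; apply: continuous_measurable_fun; exact: sqrt_continuous.
by apply/funext => t /=; rewrite sqrtr_sqr ger0_norm // cmod_ge0.
Qed.

End MeasurableModulus.

Section SquareIntegrable.
Context {R : realType}.
Implicit Types (f g h : R -> R[i]).

(** The square of the L2 norm, and the L2 norm, as real numbers
    ([L2norm_n2]). *)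
Definition nsq f : R := rint (fun t => cmod (f t) ^+ 2).
Definition n2 f : R := Num.sqrt (nsq f).

Lemma cmeasD f g : cmeasurable f -> cmeasurable g -> cmeasurable (fun t => f t + g t).
Proof.
move=> [fr fi] [gr gi]; split.
  by under eq_fun do rewrite cReD; exact: measurable_funD.
by under eq_fun do rewrite cImD; exact: measurable_funD.
Qed.

Lemma cmeasM f g : cmeasurable f -> cmeasurable g -> cmeasurable (fun t => f t * g t).
Proof.
move=> [fr fi] [gr gi]; split.
  by under eq_fun do rewrite cReM; apply: measurable_funB; exact: measurable_funM.
by under eq_fun do rewrite cImM; apply: measurable_funD; exact: measurable_funM.
Qed.

Lemma cmeas_conj f : cmeasurable f -> cmeasurable (fun t => cj (f t)).
Proof.
move=> [fr fi]; split; first by under eq_fun do rewrite cReJ.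
by under eq_fun do rewrite cImJ; exact: measurable_funN.
Qed.

Lemma cmeas_cst (c : R[i]) : cmeasurable (fun _ : R => c).
Proof. by split; exact: measurable_cst. Qed.

Lemma cmeas_real (u : R -> R) : measurable_fun setT u -> cmeasurable (fun t => (u t)%:C).
Proof. by move=> mu; split => //; exact: measurable_cst. Qed.

Lemma Lnorm_sqr f :
  (L2norm f `^ 2 = \int[@lebesgue_measure R]_t (cmod (f t) ^+ 2)%:E)%E.
Proof.
rewrite /L2norm /cLnorm poweR_Lnorm ?pnatr_eq0 //; apply: eq_integral => t _.
by rewrite /= ger0_norm ?cmod_ge0 // powR_mulrn ?cmod_ge0.
Qed.

Lemma L2P f : L2 f <-> cmeasurable f /\ integ (fun t => cmod (f t) ^+ 2).
Proof.
have ffin : (L2norm f < +oo)%E <-> (L2norm f `^ 2 < +oo)%E.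
  have : (0 <= L2norm f)%E by exact: Lnorm_ge0.
  case: (L2norm f) => [r r0|_|//]; first by rewrite poweR_EFin !ltry.
  by rewrite poweRyr // pnatr_eq0.
have abs : (fun t => `|(cmod (f t) ^+ 2)%:E|%E) = (fun t => (cmod (f t) ^+ 2)%:E).
  by apply/funext => t; rewrite abse_EFin ger0_norm // exprn_ge0 // cmod_ge0.
split=> [[mf]|[mf /integrableP[_]]].
  move=> /ffin; rewrite Lnorm_sqr => fi; split => //; apply/integrableP.
  split; first by apply/measurable_EFinP; exact: cmeas_sqr.
  by rewrite /comp abs.
by rewrite /comp abs => fi; split => //; apply/ffin; rewrite Lnorm_sqr.
Qed.

Lemma nsq_ge0 f : 0 <= nsq f.
Proof. by apply: rint_ge0 => t; rewrite exprn_ge0 // cmod_ge0. Qed.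

Lemma n2_ge0 f : 0 <= n2 f.
Proof. exact: sqrtr_ge0. Qed.

Lemma n2_sqr f : n2 f ^+ 2 = nsq f.
Proof. by rewrite sqr_sqrtr // nsq_ge0. Qed.

Lemma L2norm_n2 f : L2 f -> L2norm f = (n2 f)%:E.
Proof.
move=> /L2P[_ fi].
have : (0 <= L2norm f)%E by exact: Lnorm_ge0.
have := Lnorm_sqr f; rewrite (integ_EFin fi).
case: (L2norm f) => [r|//|//]; last by rewrite poweRyr ?pnatr_eq0.
rewrite poweR_EFin lee_fin => -[e] r0; rewrite powR_mulrn // in e.
by rewrite /n2 /nsq -e sqrtr_sqr ger0_norm.
Qed.

Lemma L2_meas f : L2 f -> cmeasurable f. Proof. by case/L2P. Qed.
Lemma L2_integ f : L2 f -> integ (fun t => cmod (f t) ^+ 2).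
Proof. by case/L2P. Qed.

Lemma L2_le f g : cmeasurable f -> (forall t, cmod (f t) <= cmod (g t)) -> L2 g -> L2 f.
Proof.
move=> mf fg /L2_integ gi; apply/L2P; split => //.
apply: integ_le gi; first exact: cmeas_sqr.
move=> t; rewrite ger0_norm ?exprn_ge0 ?cmod_ge0 //.
by rewrite ler_pXn2r ?nnegrE ?cmod_ge0.
Qed.

Lemma n2_le f g : L2 f -> L2 g -> (forall t, cmod (f t) <= cmod (g t)) ->
  n2 f <= n2 g.
Proof.
move=> /L2_integ fi /L2_integ gi fg; rewrite ler_wsqrtr // rint_le // => t.
by rewrite ler_pXn2r ?nnegrE ?cmod_ge0.
Qed.

Lemma eq_n2 f g : (forall t, cmod (f t) = cmod (g t)) -> n2 f = n2 g.
Proof. by move=> fg; congr Num.sqrt; apply: eq_rint => t; rewrite fg. Qed.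

Lemma L2Z (c : R[i]) f : L2 f -> L2 (fun t => c * f t).
Proof.
move=> /L2P[mf fi]; apply/L2P; split; first exact: cmeasM (cmeas_cst c) mf.
have := integZ (cmod c ^+ 2) fi; apply: eq_integrable => // t _ /=.
by rewrite cmodM exprMn.
Qed.

Lemma n2Z (c : R[i]) f : L2 f -> n2 (fun t => c * f t) = cmod c * n2 f.
Proof.
move=> /L2_integ fi; rewrite /n2 /nsq.
rewrite (@eq_rint _ _ (fun t => cmod c ^+ 2 * cmod (f t) ^+ 2)).
  rewrite rintZ // sqrtrM ?exprn_ge0 ?cmod_ge0 // sqrtr_sqr ger0_norm //.
  exact: cmod_ge0.
by move=> t; rewrite cmodM exprMn.
Qed.

Lemma L2_mul_integ f g : L2 f -> L2 g -> integ (fun t => cmod (f t) * cmod (g t)).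
Proof.
move=> /L2P[mf fi] /L2P[mg gi].
apply: integ_le (integD fi gi); first by apply: measurable_funM; exact: cmeas_cmod.
move=> t; rewrite ger0_norm ?mulr_ge0 ?cmod_ge0 //.
by have := cmod_ge0 (f t); have := cmod_ge0 (g t); nra.
Qed.

Lemma L2D f g : L2 f -> L2 g -> L2 (fun t => f t + g t).
Proof.
move=> Lf Lg; have [mf fi] := (L2P f).1 Lf; have [mg gi] := (L2P g).1 Lg.
apply/L2P; split; first exact: cmeasD.
apply: integ_le (integZ 2 (integD fi gi)); first by apply: cmeas_sqr; exact: cmeasD.
move=> t; rewrite ger0_norm ?exprn_ge0 ?cmod_ge0 //.
have := cmodD (f t) (g t); have := cmod_ge0 (f t + g t).
have := cmod_ge0 (f t); have := cmod_ge0 (g t).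
set x := cmod (f t); set y := cmod (g t); set z := cmod _ => *.
have : z ^+ 2 <= (x + y) ^+ 2 by rewrite ler_pXn2r ?nnegrE //; lra.
by have := sqr_ge0 (x - y); rewrite !expr2 => *; lra.
Qed.

Lemma L20 : L2 (fun _ : R => 0 : R[i]).
Proof.
apply/L2P; split; first exact: cmeas_cst.
by apply: eq_integrable (@integ0 R) => // t _; rewrite /comp cmod0 expr0n.
Qed.

Lemma n20 : n2 (fun _ : R => 0) = 0.
Proof. by have := n2Z 0 L20; rewrite mul0r cmod0 mul0r. Qed.

Lemma L2N f : L2 f -> L2 (fun t => - f t).
Proof. by move=> /(L2Z (-1)); under eq_fun do rewrite mulN1r. Qed.

Lemma L2B f g : L2 f -> L2 g -> L2 (fun t => f t - g t).
Proof. by move=> Lf /L2N; exact: L2D. Qed.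

Lemma L2_sum I (r : seq I) (P : pred I) (F : I -> R -> R[i]) :
  (forall i, P i -> L2 (F i)) -> L2 (fun t => \sum_(i <- r | P i) F i t).
Proof.
move=> LF; elim: r => [|i r IH].
  suff -> : (fun t => \sum_(i <- [::] | P i) F i t) = (fun=> 0) by exact: L20.
  by apply/funext => t; rewrite big_nil.
have -> : (fun t => \sum_(j <- i :: r | P j) F j t) = (fun t =>
    if P i then F i t + \sum_(j <- r | P j) F j t else \sum_(j <- r | P j) F j t).
  by apply/funext => t; rewrite big_cons.
by case: (boolP (P i)) => // Pi; apply: L2D IH; exact: LF.
Qed.

(* The conjugation carried by [inner] is the one of the closed field [R[i]];
   it is convertible to the componentwise one. *)
Lemma innerE f g : inner f g =
  rint (fun t => complex.Re (f t * cj (g t))) +i*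
  rint (fun t => complex.Im (f t * cj (g t))).
Proof. by []. Qed.

Lemma inner_integ f g : L2 f -> L2 g ->
  integ (fun t => complex.Re (f t * cj (g t))) /\
  integ (fun t => complex.Im (f t * cj (g t))).
Proof.
move=> Lf Lg; have fgi := L2_mul_integ Lf Lg.
have [mr mi] := cmeasM (L2_meas Lf) (cmeas_conj (L2_meas Lg)).
by split; [apply: integ_le mr _ fgi|apply: integ_le mi _ fgi] => t;
  rewrite -(cmod_conj (g t)) -cmodM ?Re_le_cmod ?Im_le_cmod.
Qed.

Lemma innerDl f g h : L2 f -> L2 g -> L2 h ->
  inner (fun t => f t + g t) h = inner f h + inner g h.
Proof.
move=> Lf Lg Lh; have [fr fi] := inner_integ Lf Lh.
have [gr gi] := inner_integ Lg Lh.
by rewrite !innerE; apply: complex_eq => /=; rewrite -rintD //; apply: eq_rint => t;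
  rewrite mulrDl ?cReD ?cImD.
Qed.

Lemma innerZl c f h : L2 f -> L2 h -> inner (fun t => c * f t) h = c * inner f h.
Proof.
move=> Lf Lh; have [fr fi] := inner_integ Lf Lh.
rewrite !innerE; apply: complex_eq; [rewrite cReM|rewrite cImM]; rewrite /= -!rintZ //.
  rewrite -rintB; [|exact: integZ..].
  by apply: eq_rint => t; rewrite -mulrA cReM.
rewrite -rintD; [|exact: integZ..].
by apply: eq_rint => t; rewrite -mulrA cImM.
Qed.

Lemma inner_conj f g : L2 f -> L2 g -> inner g f = cj (inner f g).
Proof.
move=> Lf Lg; have [fr fi] := inner_integ Lf Lg.
have eqc t : g t * cj (f t) = cj (f t * cj (g t)) by rewrite rmorphM /= conjcK mulrC.
rewrite !innerE; apply: complex_eq => /=.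
  by apply: eq_rint => t; rewrite eqc cReJ.
by rewrite -mulN1r -rintZ //; apply: eq_rint => t; rewrite eqc cImJ mulN1r.
Qed.

Lemma inner_self f : L2 f -> inner f f = (nsq f)%:C.
Proof.
move=> Lf; rewrite innerE; apply: complex_eq => /=.
  by apply: eq_rint => t; rewrite mul_conj.
rewrite -[RHS](mul0r (rint (fun=> 0))) -rintZ; last exact: integ0.
by apply: eq_rint => t; rewrite mul_conj mul0r.
Qed.

Lemma inner0l h : L2 h -> inner (fun=> 0) h = 0.
Proof.
by move=> Lh; have := innerZl 0 L20 Lh; rewrite !mul0r.
Qed.

Lemma inner_suml I (r : seq I) (P : pred I) (F : I -> R -> R[i]) h :
  (forall i, P i -> L2 (F i)) -> L2 h ->
  inner (fun t => \sum_(i <- r | P i) F i t) h = \sum_(i <- r | P i) inner (F i) h.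
Proof.
move=> LF Lh; elim: r => [|i r IH].
  by rewrite big_nil -[RHS](inner0l Lh); congr inner; apply/funext => t; rewrite big_nil.
rewrite big_cons; case: ifPn => Pi; last first.
  by rewrite -IH; congr inner; apply/funext => t; rewrite big_cons (negbTE Pi).
rewrite -IH -innerDl //; [|exact: LF|exact: L2_sum].
by congr inner; apply/funext => t; rewrite big_cons Pi.
Qed.

Lemma innerBl f g h : L2 f -> L2 g -> L2 h ->
  inner (fun t => f t - g t) h = inner f h - inner g h.
Proof.
move=> Lf Lg Lh; rewrite -[in RHS]mulN1r -innerZl // -innerDl //; last exact: L2Z.
by congr inner; apply/funext => t; rewrite mulN1r.
Qed.

Lemma innerZr c f h : L2 f -> L2 h -> inner f (fun t => c * h t) = cj c * inner f h.
Proof.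
move=> Lf Lh; rewrite inner_conj ?innerZl //; last exact: L2Z.
by rewrite cjM -inner_conj.
Qed.

Lemma innerDr f g h : L2 f -> L2 g -> L2 h ->
  inner f (fun t => g t + h t) = inner f g + inner f h.
Proof.
move=> Lf Lg Lh; rewrite inner_conj ?innerDl //; last exact: L2D.
by rewrite cjD -!inner_conj.
Qed.

Lemma inner_sumr I (r : seq I) (P : pred I) (F : I -> R -> R[i]) f :
  (forall i, P i -> L2 (F i)) -> L2 f ->
  inner f (fun t => \sum_(i <- r | P i) F i t) = \sum_(i <- r | P i) inner f (F i).
Proof.
move=> LF Lf; rewrite inner_conj ?inner_suml //; last exact: L2_sum.
by rewrite cj_sum; apply: eq_bigr => i Pi; rewrite [RHS]inner_conj //; exact: LF.
Qed.

(** Cauchy-Schwarz: minimise the nonnegative quadratic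
    s |-> nsq (f - s <f,g> g) over real s. *)
Lemma cauchy_schwarz f g : L2 f -> L2 g -> cmod (inner f g) <= n2 f * n2 g.
Proof.
move=> Lf Lg; set z := inner f g.
rewrite -(@ler_pXn2r _ 2) ?nnegrE ?mulr_ge0 ?cmod_ge0 ?n2_ge0 // exprMn !n2_sqr.
set m := cmod z ^+ 2.
have zz : z * cj z = m%:C by rewrite mul_conj.
have m0 : 0 <= m by rewrite exprn_ge0 // cmod_ge0.
clearbody m.
have quad (s : R) : 0 <= nsq f - 2 * s * m + s ^+ 2 * m * nsq g.
  pose k := s%:C * z.
  have Lk : L2 (fun t => k * g t) by exact: L2Z.
  have Lfk : L2 (fun t => f t - k * g t) by exact: L2B.
  have : complex.Re (inner (fun t => f t - k * g t) (fun t => f t - k * g t)) =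
      nsq (fun t => f t - k * g t) by rewrite inner_self.
  suff -> : inner (fun t => f t - k * g t) (fun t => f t - k * g t) =
      (nsq f - 2 * s * m + s ^+ 2 * m * nsq g)%:C.
    move=> h; have -> : nsq f - 2 * s * m + s ^+ 2 * m * nsq g = _ := h.
    exact: nsq_ge0.
  have expand u : L2 u -> inner u (fun t => f t - k * g t) =
      inner u f - cj k * inner u g.
    move=> Lu; have -> : (fun t => f t - k * g t) = (fun t => f t + (- k) * g t).
      by apply/funext => t; rewrite mulNr.
    rewrite innerDr //; last exact: L2Z.
    by rewrite innerZr // cjN mulNr.
  rewrite innerBl // !expand // !innerZl // (inner_conj Lf Lg) -/z !inner_self //.
  have kE : cj k = s%:C * cj z by rewrite cjM conjc_real.
  rewrite kE /k.
  have realE (u v w x : R) : (u - 2 * v * w + v ^+ 2 * w * x)%:C =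
      u%:C - 2 * v%:C * w%:C + v%:C * v%:C * w%:C * x%:C.
    by apply: complex_eq => /=; ring.
  by rewrite realE -zz; ring.
have f0 := nsq_ge0 f; have g0 := nsq_ge0 g.
have [g_gt0|] := ltP 0 (nsq g).
  have := quad (nsq g)^-1.
  have -> : nsq f - 2 * (nsq g)^-1 * m + (nsq g)^-1 ^+ 2 * m * nsq g =
      nsq f - m / nsq g by field; apply: lt0r_neq0.
  by rewrite subr_ge0 ler_pdivrMr.
move=> g_le0; have -> : nsq g = 0 by apply/le_anti/andP.
rewrite mulr0; have [m_gt0|//] := ltP 0 m.
have := quad ((nsq f + 1) / m).
have -> : nsq g = 0 by apply/le_anti/andP.
rewrite mulr0 addr0 -mulrA -[_ / m * m]mulrA mulVf ?lt0r_neq0 // mulr1.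
lra.
Qed.

Lemma n2D f g : L2 f -> L2 g -> n2 (fun t => f t + g t) <= n2 f + n2 g.
Proof.
move=> Lf Lg; have Lfg := L2D Lf Lg.
rewrite -(@ler_pXn2r _ 2) ?nnegrE ?addr_ge0 ?n2_ge0 // n2_sqr sqrrD !n2_sqr.
have : complex.Re (inner (fun t => f t + g t) (fun t => f t + g t)) =
  nsq (fun t => f t + g t) by rewrite inner_self.
rewrite innerDl // !innerDr // (inner_conj Lf Lg) !inner_self // !cReD cReJ => <-.
have Rr (x : R) : complex.Re x%:C = x by [].
rewrite (Rr (nsq f)) (Rr (nsq g)).
have := le_trans (ler_norm _) (le_trans (Re_le_cmod _) (cauchy_schwarz Lf Lg)).
rewrite mulr2n; set r := complex.Re _; lra.
Qed.

Lemma n2N f : L2 f -> n2 (fun t => - f t) = n2 f.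
Proof. by move=> Lf; apply: eq_n2 => t; rewrite cmodN. Qed.

Lemma n2B f g : L2 f -> L2 g -> n2 (fun t => f t - g t) <= n2 f + n2 g.
Proof. by move=> Lf Lg; rewrite -(n2N Lg); apply: n2D => //; exact: L2N. Qed.

End SquareIntegrable.

(** * Commuting time-frequency shifts at critical density *)

Section TimeFrequencyShifts.
Context {R : realType} (a th tau : R).
Hypothesis a_neq0 : a != 0.
Implicit Types (f g v : R -> R[i]) (k l : int * int).

Definition character k : R[i] :=
  expi (th * k.1%:~R + 2 * pi * k.2%:~R * tau).

(** The Gabor shift by [k] divided by the character of [k]
    ([twistE]).  At critical density these operators form a representation of
    the lattice, and dividing by the character moves the point [(tau a, th)] of
    its joint spectrum to the trivial character. *)
Definition twist k f : R -> R[i] := fun t =>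
  expi (2 * pi * k.2%:~R * (t / a - tau) - th * k.1%:~R) * f (t - a * k.1%:~R).

Lemma cmod_character k : cmod (character k) = 1. Proof. exact: cmod_expi. Qed.

(** The product of the two lattice constants is 1, so translation and
    modulation by lattice vectors commute: the phase between them is
    [e^(2 pi i n m)]. *)
Lemma gaborE f k t : gabor f a a^-1 k t =
  expi (2 * pi * k.2%:~R * (t / a)) * f (t - a * k.1%:~R).
Proof.
rewrite /gabor tfshiftE; congr (_ * _).
have -> : 2 * pi * (a^-1 * k.2%:~R) * (t - a * k.1%:~R) =
    2 * pi * k.2%:~R * (t / a) + 2 * pi * (- (k.2 * k.1))%:~R.
  by rewrite intrN intrM; field.
by rewrite expiD expi2pi_int mulr1.
Qed.

Lemma twistE f k t : twist k f t = cj (character k) * gabor f a a^-1 k t.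
Proof.
rewrite gaborE /twist /character conj_expi mulrA -expiD; congr (expi _ * _).
ring.
Qed.

Lemma gabor_twist f k t : gabor f a a^-1 k t = character k * twist k f t.
Proof. by rewrite twistE mulrA expi_Kconj mul1r. Qed.

Lemma twistD k l f : twist (k + l) f = twist k (twist l f).
Proof.
apply/funext => t; rewrite /twist mulrA -expiD.
have -> : t - a * k.1%:~R - a * l.1%:~R = t - a * (k + l).1%:~R.
  by rewrite /= intrD; ring.
congr (_ * _).
have -> : 2 * pi * k.2%:~R * (t / a - tau) - th * k.1%:~R +
   (2 * pi * l.2%:~R * ((t - a * k.1%:~R) / a - tau) - th * l.1%:~R) =
   (2 * pi * (k + l).2%:~R * (t / a - tau) - th * (k + l).1%:~R)
   + 2 * pi * (- (l.2 * k.1))%:~R.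
  by rewrite /= !intrD intrN intrM; field.
by rewrite [in RHS]expiD expi2pi_int mulr1.
Qed.

Lemma twist0 f : twist 0 f = f.
Proof.
by apply/funext => t; rewrite /twist /= !mulr0 mul0r !subr0 expi0 mul1r.
Qed.

Lemma twist_add k f g : twist k (fun t => f t + g t) = (fun t => twist k f t + twist k g t).
Proof. by apply/funext => t; rewrite /twist mulrDr. Qed.

Lemma twist_sub k f g : twist k (fun t => f t - g t) = (fun t => twist k f t - twist k g t).
Proof. by apply/funext => t; rewrite /twist mulrBr. Qed.

Lemma twist_sum k I (r : seq I) (P : pred I) (F : I -> R -> R[i]) :
  twist k (fun t => \sum_(i <- r | P i) F i t) =
  (fun t => \sum_(i <- r | P i) twist k (F i) t).
Proof. by apply/funext => t; rewrite /twist mulr_sumr. Qed.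

Lemma measurable_expi_affine (c d : R) :
  cmeasurable (fun t : R => expi (c * t + d)).
Proof.
have maff : measurable_fun setT (fun t : R => c * t + d).
  by apply: measurable_funD => //; exact: measurable_funM.
by split; [apply: (measurableT_comp _ maff)|apply: (measurableT_comp _ maff)];
  apply: continuous_measurable_fun; [exact: continuous_cos|exact: continuous_sin].
Qed.

Lemma cmod_twist k f t : cmod (twist k f t) = cmod (f (t - a * k.1%:~R)).
Proof. by rewrite /twist cmodM cmod_expi mul1r. Qed.

Lemma L2_twist k f : L2 f -> L2 (twist k f).
Proof.
move=> /L2P[[mr mi] fi]; apply/L2P; split.
  apply: cmeasM; last by split; [exact: (measurable_comp_shift _ mr)|
                                 exact: (measurable_comp_shift _ mi)].
  have := measurable_expi_affine (2 * pi * k.2%:~R / a)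
    (- (2 * pi * k.2%:~R * tau) - th * k.1%:~R).
  congr cmeasurable; apply/funext => t; congr expi; ring.
by under [X in integ X]eq_fun do rewrite cmod_twist; exact: integ_shift fi.
Qed.

Lemma n2_twist k f : L2 f -> n2 (twist k f) = n2 f.
Proof.
move=> /L2_integ fi; rewrite /n2 /nsq; congr Num.sqrt.
under eq_rint do rewrite cmod_twist.
exact: (rint_shift _ fi).
Qed.

Lemma inner_twist k f g : L2 f -> L2 g -> inner (twist k f) (twist k g) = inner f g.
Proof.
move=> Lf Lg; have [hr hi] := inner_integ Lf Lg.
have pw t : twist k f t * cj (twist k g t) =
    f (t - a * k.1%:~R) * cj (g (t - a * k.1%:~R)).
  by rewrite /twist cjM mulrACA expi_Kconj mul1r.
rewrite !innerE; apply: complex_eq.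
  rewrite -[RHS](rint_shift (a * k.1%:~R) hr); apply: eq_rint => t.
  by rewrite pw.
rewrite -[RHS](rint_shift (a * k.1%:~R) hi); apply: eq_rint => t.
by rewrite pw.
Qed.

Lemma inner_twistr k f g : L2 f -> L2 g -> inner f (twist k g) = inner (twist (- k) f) g.
Proof.
move=> Lf Lg; rewrite -[RHS](inner_twist k) //; last exact: L2_twist.
by rewrite -twistD subrr twist0.
Qed.

Lemma twist_comm k l f : twist k (twist l f) = twist l (twist k f).
Proof. by rewrite -!twistD addrC. Qed.

(** Telescoping: the powers of a unitary move a vector by steps of equal
    length. *)
Lemma n2_twist_iter (u : int * int) (n : int) f : L2 f ->
  n2 (fun t => twist (u *~ n) f t - f t) <= `|n%:~R| * n2 (fun t => twist u f t - f t).
Proof.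
move=> Lf.
have Lt k : L2 (twist k f) by exact: L2_twist.
have nat_case (w : int * int) (m : nat) :
    n2 (fun t => twist (w *+ m) f t - f t) <= m%:R * n2 (fun t => twist w f t - f t).
  elim: m => [|m IH].
    rewrite mulr0n twist0 mul0r (_ : (fun t => _) = (fun=> 0)) ?n20 //.
    by apply/funext => t; rewrite subrr.
  rewrite mulrS twistD.
  have -> : (fun t => twist w (twist (w *+ m) f) t - f t) = (fun t =>
      twist w (fun s => twist (w *+ m) f s - f s) t + (twist w f t - f t)).
    by apply/funext => t; rewrite twist_sub addrA subrK.
  apply: le_trans (n2D _ _) _; [by apply: L2_twist; exact: L2B|exact: L2B|].
  rewrite n2_twist; last exact: L2B.
  by rewrite -natr1 mulrDl mul1r lerD2r.
case: n => m; first by rewrite normr_nat; exact: nat_case.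
rewrite NegzE !mulrNz normrN normr_nat.
apply: le_trans (_ : m.+1%:R * n2 (fun t => twist (- u) f t - f t) <= _).
  by rewrite -mulNrz; exact: nat_case.
rewrite ler_wpM2l ?ler0n // -(n2_twist (- u) (L2B (Lt u) Lf)) twist_sub -twistD addNr twist0.
rewrite -n2N; last by apply: L2B.
by under [X in n2 X <= _]eq_fun do rewrite opprB.
Qed.

End TimeFrequencyShifts.

(** * Sums of shifts over boxes and the reproducing form *)

Section OrbitSums.
Context {R : realType} (a th tau : R).
Hypothesis a_neq0 : a != 0.
Implicit Types (f g v x : R -> R[i]) (k u w : int * int).
Local Notation twist := (twist a th tau).
Local Notation character := (character th tau).

Definition orbit_sum u N x : R -> R[i] := fun t => \sum_(i < N) twist (u *+ i) x t.

Definition dir_time : int * int := (1, 0).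
Definition dir_freq : int * int := (0, 1).

Definition box_sum N x : R -> R[i] :=
  orbit_sum dir_time N (orbit_sum dir_freq N x).

Lemma L2_orbit_sum u N x : L2 x -> L2 (orbit_sum u N x).
Proof. by move=> Lx; apply: L2_sum => i _; exact: L2_twist. Qed.

Lemma L2_box_sum N x : L2 x -> L2 (box_sum N x).
Proof. by move=> Lx; do 2 apply: L2_orbit_sum. Qed.

Lemma orbit_sum_comm u N w M x :
  orbit_sum u N (orbit_sum w M x) = orbit_sum w M (orbit_sum u N x).
Proof.
apply/funext => t; rewrite /orbit_sum.
under eq_bigr do rewrite twist_sum.
under [RHS]eq_bigr do rewrite twist_sum.
rewrite exchange_big /=; apply: eq_bigr => i _; apply: eq_bigr => j _.
by rewrite (twist_comm _ _ a_neq0).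
Qed.

(** The displaced sum and the sum differ only by their end terms. *)
Lemma orbit_sum_displacement u N x : L2 x ->
  n2 (fun t => twist u (orbit_sum u N x) t - orbit_sum u N x t) <= 2 * n2 x.
Proof.
move=> Lx; have Lt k : L2 (twist k x) by exact: L2_twist.
suff -> : (fun t => twist u (orbit_sum u N x) t - orbit_sum u N x t) =
    (fun t => twist (u *+ N) x t - x t).
  by rewrite mulr_natl mulr2n -{1}(n2_twist a th tau (u *+ N) Lx); exact: n2B.
apply/funext => t; rewrite twist_sum /orbit_sum.
under eq_bigr do rewrite -(twistD _ _ a_neq0) -mulrS.
have := @telescope_sumr _ 0 N (fun i => twist (u *+ i) x t) (leq0n N).
by rewrite mulr0n twist0 => <-; rewrite big_mkord sumrB.
Qed.

Lemma orbit_sum_displacement_iter u (n : int) N x : L2 x ->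
  n2 (fun t => twist (u *~ n) (orbit_sum u N x) t - orbit_sum u N x t)
  <= `|n%:~R| * (2 * n2 x).
Proof.
move=> Lx; apply: le_trans (n2_twist_iter _ _ a_neq0 _ _ (L2_orbit_sum _ _ Lx)) _.
by rewrite ler_wpM2l // orbit_sum_displacement.
Qed.

Lemma natz_pair (u : int * int) (n : nat) : u *+ n = (u.1 *+ n, u.2 *+ n).
Proof. by elim: n => [|n IH]; rewrite ?mulr0n // !mulrS IH. Qed.
Lemma pair_dirE k : k = dir_time *~ k.1 + dir_freq *~ k.2.
Proof.
have intE (u : int * int) (n : int) : u *~ n = (u.1 *~ n, u.2 *~ n).
  by case: n => n; rewrite ?NegzE ?mulrNz -?pmulrn natz_pair.
by rewrite !intE /= !mul0rz; case: k => p q /=; congr pair; rewrite ?addr0 ?add0r intz.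
Qed.

(** Displacing a box by a unit step changes the sum only along two opposite
    faces, each of which carries an orbit sum in the other direction. *)
Lemma box_sum_displacement k N x : L2 x ->
  n2 (fun t => twist k (box_sum N x) t - box_sum N x t) <=
  `|k.1%:~R| * (2 * n2 (orbit_sum dir_freq N x)) +
  `|k.2%:~R| * (2 * n2 (orbit_sum dir_time N x)).
Proof.
move=> Lx; have LD := L2_box_sum N Lx.
have Lt l : L2 (twist l (box_sum N x)) by exact: L2_twist.
rewrite {1}(pair_dirE k) (twistD _ _ a_neq0).
set y1 := dir_time *~ _; set y2 := dir_freq *~ _.
have -> : (fun t => twist y1 (twist y2 (box_sum N x)) t - box_sum N x t) =
  (fun t => twist y1 (fun s => twist y2 (box_sum N x) s - box_sum N x s) t +
    (twist y1 (box_sum N x) t - box_sum N x t)).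
  by apply/funext => t; rewrite twist_sub addrA subrK.
apply: le_trans (n2D _ _) _; [by apply: L2_twist; exact: L2B|exact: L2B|].
rewrite addrC n2_twist; last exact: L2B.
apply: lerD; first exact/orbit_sum_displacement_iter/L2_orbit_sum.
rewrite /box_sum orbit_sum_comm.
exact/orbit_sum_displacement_iter/L2_orbit_sum.
Qed.

Definition box_index N (l : 'I_N * 'I_N) : int * int := ((l.1 : nat)%:Z, (l.2 : nat)%:Z).

Lemma box_sumE N x : box_sum N x = fun t => \sum_(l : 'I_N * 'I_N) twist (box_index l) x t.
Proof.
apply/funext => t; rewrite /box_sum /orbit_sum.
under eq_bigr do rewrite twist_sum.
rewrite pair_bigA /=; apply: eq_bigr => -[i j] _ /=.
rewrite -(twistD _ _ a_neq0); congr twist.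
by rewrite [RHS]pair_dirE /= -!pmulrn.
Qed.

Lemma inner_gabor_twist g k x : L2 g -> L2 x ->
  inner g (twist k x) = inner g (gabor x a a^-1 k) * character k.
Proof.
move=> Lg Lx.
have -> : twist k x = (fun t => cj (character k) * gabor x a a^-1 k t).
  by apply/funext => t; exact: twistE.
have LG : L2 (gabor x a a^-1 k).
  have -> : gabor x a a^-1 k = (fun t => character k * twist k x t).
    by apply/funext => t; exact: gabor_twist.
  exact/L2Z/L2_twist.
by rewrite innerZr // conjcK mulrC.
Qed.

(** The coefficients of [box_sum N v] against [g] are box sums of the
    coefficients [b] of [g] against [v].  As the latter sum to zero, the form
    only sees the displacements of [box_sum N gamma] by lattice points. *)
Lemma reproducing_form_bound g gamma v q (b : int * int -> R[i]) K N L :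
  L2 g -> L2 gamma -> L2 v -> L2 q ->
  (forall k, b k = inner g (twist k v)) ->
  (forall A : {fset int * int},
     \sum_(k <- A) cmod (b k) * (1 + `|k.1%:~R| + `|k.2%:~R|) <= K) ->
  has_usum b 0 ->
  has_usum (fun k => inner (box_sum N v) (twist k g) * inner (twist k gamma) q) L ->
  cmod L <= K * (2 * (n2 (orbit_sum dir_freq N gamma) + n2 (orbit_sum dir_time N gamma)) * n2 q).
Proof.
move=> Lg Lgam Lv Lq bE bK b0 hL.
pose s k := inner (twist k gamma) q.
have Lt k x : L2 x -> L2 (twist k x) by exact: L2_twist.
have wK (A : {fset int * int}) : \sum_(k <- A) cmod (b k) <= K.
  apply: le_trans (bK A); apply: ler_sum => k _.
  by rewrite ler_peMr ?cmod_ge0 // -addrA lerDl addr_ge0.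
have coeffE k : inner (box_sum N v) (twist k g) =
    \sum_(l : 'I_N * 'I_N) cj (b (box_index l - k)).
  rewrite box_sumE inner_suml; [|by move=> l _; exact: Lt|exact: Lt].
  apply: eq_bigr => l _.
  by rewrite (inner_twistr _ _ a_neq0 _ (Lt _ _ Lv) Lg) -(twistD _ _ a_neq0) addrC bE -inner_conj //; exact: Lt.
have sbound k : cmod (s k) <= n2 gamma * n2 q.
  by rewrite -(n2_twist a th tau k Lgam); exact/cauchy_schwarz/Lq/Lt.
have ex (l : 'I_N * 'I_N) : exists Ll, has_usum (fun j => cj (b j) * s (box_index l - j)) Ll.
  apply: (@has_usum_ex _ _ _ (fun j => (n2 gamma * n2 q) * cmod (b j)) ((n2 gamma * n2 q) * K)).
    by move=> j; rewrite cmodM cmod_conj mulrC ler_wpM2r // cmod_ge0.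
  by apply: sum_scale_le => //; rewrite mulr_ge0 // n2_ge0.
have [Ll hLl] := choice ex.
have LE : L = \sum_(l : 'I_N * 'I_N) Ll l.
  apply: has_usum_unique hL _.
  suff h (l : 'I_N * 'I_N) : has_usum (fun k => cj (b (box_index l - k)) * s k) (Ll l).
    have := @has_usum_sum _ _ _ (index_enum _) xpredT _ Ll (fun l _ => h l).
    by apply: eq_has_usum => k; rewrite coeffE mulr_suml.
  have inv : involutive (fun k : int * int => box_index l - k).
    by move=> k; rewrite subKr.
  have := has_usum_reindex inv inv (hLl l).
  by apply: eq_has_usum => k; rewrite subKr.
have hD : has_usum (fun j => cj (b j) * inner (fun t => twist (- j) (box_sum N gamma) t
    - box_sum N gamma t) q) L.
  have LD := L2_box_sum N Lgam.
  have h0 := has_usumZ (inner (box_sum N gamma) q) (has_usum_conj b0).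
  have hS := @has_usum_sum _ _ _ (index_enum _) xpredT _ Ll (fun l _ => hLl l).
  have := has_usumB hS h0; rewrite -LE conjc0 mulr0 subr0.
  apply: eq_has_usum => j; rewrite -mulr_sumr [X in _ - X]mulrC -mulrBr; congr (_ * _).
  rewrite innerBl //; last exact: Lt.
  congr (_ - _); rewrite {1}box_sumE twist_sum inner_suml //; last by move=> l _; exact: (Lt _ _ (Lt _ _ Lgam)).
  by apply: eq_bigr => l _; rewrite -(twistD _ _ a_neq0) addrC.
set M := 2 * _ * n2 q.
have M0 : 0 <= M by rewrite !mulr_ge0 ?addr_ge0 ?n2_ge0.
rewrite mulrC.
apply: (has_usum_le (y := fun j : int * int => M * (cmod (b j) * (1 + `|j.1%:~R| + `|j.2%:~R|)))) hD => [j|].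
  rewrite cmodM cmod_conj mulrCA ler_wpM2l ?cmod_ge0 //.
  have LD := L2_box_sum N Lgam.
  apply: le_trans (cauchy_schwarz _ Lq) _; first by apply: L2B => //; exact: Lt.
  rewrite /M mulrAC ler_wpM2r ?n2_ge0 //.
  apply: le_trans (box_sum_displacement _ _ Lgam) _ => /=.
  rewrite !mulrNz !normrN.
  have := n2_ge0 (orbit_sum dir_freq N gamma); have := n2_ge0 (orbit_sum dir_time N gamma).
  have := normr_ge0 (j.1%:~R : R); have := normr_ge0 (j.2%:~R : R).
  set x1 := `|_|; set x2 := `|_|; set y1 := n2 _; set y2 := n2 _ => *; nra.
by apply: sum_scale_le.
Qed.

End OrbitSums.

(** * Dominated convergence and truncation in L2 *)

Section DominatedL2.
Context {R : realType}.
Implicit Types (f g x : R -> R[i]).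

Lemma L2_mul_le1 (phi : R -> R) f : measurable_fun setT phi ->
  (forall t, `|phi t| <= 1) -> L2 f -> L2 (fun t => (phi t)%:C * f t).
Proof.
move=> mphi phi1 Lf.
apply: (L2_le _ _ Lf); first by apply: cmeasM (L2_meas Lf); exact: cmeas_real.
by move=> t; rewrite cmodM cmod_real ler_piMl // cmod_ge0.
Qed.

Lemma n2_dominated (phi : nat -> R -> R) f : L2 f ->
  (forall N, measurable_fun setT (phi N)) ->
  (forall N t, `|phi N t| <= 1) ->
  {ae @lebesgue_measure R, forall t, phi^~ t @ \oo --> (0 : R)} ->
  forall e : R, 0 < e -> exists N0, forall N, (N0 <= N)%N ->
    n2 (fun t => (phi N t)%:C * f t) < e.
Proof.
move=> Lf mphi phi1 phi0 e e0.
have [mf fi] := (L2P f).1 Lf.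
have Lp N := L2_mul_le1 (mphi N) (phi1 N) Lf.
have := @dominated_convergence _ _ _ (@lebesgue_measure R) setT measurableT
  (fun N t => (cmod ((phi N t)%:C * f t) ^+ 2)%:E) (fun=> 0%E)
  (fun t => (cmod (f t) ^+ 2)%:E).
case => //.
- by move=> N; apply/measurable_EFinP; exact: (cmeas_sqr (L2_meas (Lp N))).
- have FF := ae_filter_ringOfSetsType (@lebesgue_measure R).
  apply: filterS phi0 => t pt _.
  have -> : (fun N => (cmod ((phi N t)%:C * f t) ^+ 2)%:E) =
      EFin \o (fun N => phi N t ^+ 2 * cmod (f t) ^+ 2).
    by apply/funext => N /=; rewrite cmodM cmod_real exprMn real_normK ?num_real.
  apply/cvg_EFin; first exact: nearW.
  rewrite -[X in _ --> X](mul0r (cmod (f t) ^+ 2)); apply: cvgMr_tmp.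
  rewrite -[X in _ --> X](mul0r (0 : R)); under eq_cvg do rewrite expr2.
  exact: cvgM.
- apply: filterE => t N _; rewrite abse_EFin lee_fin ger0_norm ?exprn_ge0 ?cmod_ge0 //.
  rewrite ler_pXn2r ?nnegrE ?cmod_ge0 // cmodM cmod_real.
  by rewrite ler_piMl ?cmod_ge0.
move=> _ _; rewrite integral0 => cvg_int.
have intE N : (\int[@lebesgue_measure R]_t (cmod ((phi N t)%:C * f t) ^+ 2)%:E)%E =
    (nsq (fun t => (phi N t)%:C * f t))%:E by exact: (integ_EFin (L2_integ (Lp N))).
have cvg_nsq : EFin \o (fun N => nsq (fun t => (phi N t)%:C * f t)) @ \oo --> (0%:E : \bar R).
  rewrite (_ : EFin \o _ = (fun N =>
    \int[@lebesgue_measure R]_t (cmod ((phi N t)%:C * f t) ^+ 2)%:E)%E) //.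
  by apply/funext => N /=; rewrite intE.
have /fine_cvg /cvgrPdist_lt /(_ (e ^+ 2)) := cvg_nsq.
rewrite exprn_gt0 // => /(_ isT)[N0 _ hN].
exists N0 => N /hN /=; rewrite sub0r normrN ger0_norm ?nsq_ge0 // -n2_sqr.
by rewrite ltr_pXn2r ?nnegrE ?n2_ge0 // ltW.
Qed.

Definition tail (rho : R) f : R -> R[i] :=
  fun t => ((~~ (`|t| <= rho)%R)%:R : R)%:C * f t.
Definition trunc (rho : R) f : R -> R[i] :=
  fun t => ((`|t| <= rho)%R%:R : R)%:C * f t.

Lemma measurable_norm_le (rho : R) : measurable_fun setT (fun t : R => `|t| <= rho).
Proof. by apply: measurable_fun_ler => //; exact: measurableT_comp. Qed.

Lemma measurable_bool_real (P : R -> bool) : measurable_fun setT P ->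
  measurable_fun setT (fun t => (P t)%:R : R).
Proof.
move=> mP; have -> : (fun t => (P t)%:R : R) = (fun t => if P t then 1 else 0).
  by apply/funext => t; case: (P t).
exact: measurable_fun_ifT.
Qed.

Lemma L2_tail rho f : L2 f -> L2 (tail rho f).
Proof.
apply: L2_mul_le1 => [|t]; last by case: (~~ _); rewrite ?normr1 ?normr0.
by apply: measurable_bool_real; apply: measurable_neg; exact: measurable_norm_le.
Qed.

Lemma L2_trunc rho f : L2 f -> L2 (trunc rho f).
Proof.
apply: L2_mul_le1 => [|t]; last by case: (`|t| <= rho); rewrite ?normr1 ?normr0.
by apply: measurable_bool_real; exact: measurable_norm_le.
Qed.

Lemma trunc_tail rho f : f = (fun t => trunc rho f t + tail rho f t).
Proof.
apply/funext => t; rewrite /trunc /tail -mulrDl -rmorphD.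
by case: (`|t| <= rho); rewrite /= ?addr0 ?add0r mul1r.
Qed.

Lemma tail_small f (e : R) : L2 f -> 0 < e -> exists rho : R, 0 < rho /\ n2 (tail rho f) < e.
Proof.
move=> Lf e0.
have [|||N0 h] := @n2_dominated (fun N t => (~~ (`|t| <= N%:R)%R)%:R) f Lf _ _ _ e e0.
- move=> N; apply: measurable_bool_real; apply: measurable_neg; exact: measurable_norm_le.
- by move=> N t; case: (~~ _); rewrite ?normr1 ?normr0.
- have FF := ae_filter_ringOfSetsType (@lebesgue_measure R).
  apply: filterE => t; apply/cvgrPdist_lt => d d0.
  exists (Num.truncn `|t|).+1 => // N /= hN.
  suff -> : (`|t| <= N%:R)%R by rewrite /= subr0 normr0.
  by rewrite (le_trans (ltW (truncnS_gt _))) // ler_nat.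
exists N0.+1%:R; split; first by rewrite ltr0n.
exact: h.
Qed.

End DominatedL2.

(** * Mean ergodic theorems for translation and modulation *)

Section GeometricSums.
Context {R : realType}.

Definition geom_sum (N : nat) (x : R) : R[i] := \sum_(m < N) expi (2 * pi * m%:R * x).

Lemma geom_sum_le N x : cmod (geom_sum N x) <= N%:R.
Proof.
apply: le_trans (cmod_sum _ _ _) _.
by under eq_bigr do rewrite cmod_expi; rewrite sumr_const card_ord.
Qed.

Lemma geom_sum_mul N (x : R) :
  geom_sum N x * (1 - expi (2 * pi * x)) = 1 - expi (2 * pi * N%:R * x).
Proof.
elim: N => [|N IH].
  by rewrite /geom_sum big_ord0 mulr0 !mul0r expi0 subrr.
rewrite /geom_sum big_ord_recr /= -/(geom_sum N x) mulrDl IH.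
have -> : 2 * pi * N.+1%:R * x = 2 * pi * N%:R * x + 2 * pi * x.
  by rewrite -[N.+1%:R]natr1; ring.
by rewrite expiD; ring.
Qed.

Lemma geom_sum_mul_le N (x : R) : cmod (geom_sum N x) * cmod (1 - expi (2 * pi * x)) <= 2.
Proof.
rewrite -cmodM geom_sum_mul (le_trans (cmodB _ _)) // cmod1 cmod_expi.
lra.
Qed.

Lemma expi2pi_eq1 (x : R) : expi (2 * pi * x) = 1 -> exists n : int, x = n%:~R.
Proof.
move=> e1; exists (Num.floor x).
have /andP[x0 x1] := floor_itv x; rewrite intrD in x1.
set y := x - (Num.floor x)%:~R; have y0 : 0 <= y by rewrite subr_ge0.
have y1 : y < 1 by rewrite /y; lra.
have : expi (2 * pi * y) = 1.
  by rewrite /y mulrBr expiD e1 mul1r -mulrN -intrN expi2pi_int.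
have pi0 := @pi_gt0 R.
move/expi_eq1_small; rewrite ger0_norm ?mulr_ge0 ?(ltW pi0) //.
rewrite -[X in _ < X]mulr1 ltr_pM2l ?mulr_gt0 // => /(_ y1)/eqP.
by rewrite !mulf_eq0 pnatr_eq0 (gt_eqF pi0) /= /y subr_eq0 => /eqP.
Qed.

Lemma geom_sum_avg_cvg0 (x : R) : expi (2 * pi * x) != 1 ->
  (fun N => cmod (geom_sum N x) / N%:R) @ \oo --> (0 : R).
Proof.
move=> e1; set d := cmod (1 - expi (2 * pi * x)).
have d0 : 0 < d by rewrite cmod_gt0 subr_eq0 eq_sym.
apply/cvgrPdist_lt => e e0.
exists (Num.truncn (2 / (d * e))).+1 => // N /= hN.
have N0 : 0 < N%:R :> R by rewrite ltr0n (leq_trans _ hN).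
rewrite sub0r normrN ger0_norm ?divr_ge0 ?cmod_ge0 ?(ltW N0) //.
rewrite ltr_pdivrMr // -(ltr_pM2r d0).
apply: le_lt_trans (geom_sum_mul_le N x) _.
have : 2 / (d * e) < N%:R by rewrite (lt_le_trans (truncnS_gt _)) // ler_nat.
rewrite ltr_pdivrMr ?mulr_gt0 // => h; apply: lt_le_trans h _.
by rewrite le_eqVlt; apply/orP; left; apply/eqP; ring.
Qed.

End GeometricSums.

Section ErgodicDecay.
Context {R : realType} (a th tau : R).
Hypothesis a_gt0 : 0 < a.
Implicit Types (f g v x : R -> R[i]).
Local Notation twist := (twist a th tau).
Local Notation orbit_sum := (orbit_sum a th tau).

Let a_neq0 : a != 0. Proof. exact: lt0r_neq0. Qed.

Lemma twist_freq f (m : nat) t : twist (dir_freq *+ m) f t =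
  expi (2 * pi * m%:R * (t / a - tau)) * f t.
Proof.
by rewrite /twist natz_pair /= mul0rn !mulr0 !subr0 rmorphMn.
Qed.

Lemma twist_time f (n : nat) t : twist (dir_time *+ n) f t =
  expi (- (th * n%:R)) * f (t - a * n%:R).
Proof.
by rewrite /twist natz_pair /= mul0rn mulr0 mul0r sub0r rmorphMn.
Qed.

Lemma orbit_sum_freqE N f t :
  orbit_sum dir_freq N f t = geom_sum N (t / a - tau) * f t.
Proof. by rewrite /orbit_sum mulr_suml; apply: eq_bigr => m _; rewrite twist_freq. Qed.

Lemma orbit_sum_timeE N f t :
  orbit_sum dir_time N f t = \sum_(n < N) expi (- (th * n%:R)) * f (t - a * n%:R).
Proof. by apply: eq_bigr => m _; rewrite twist_time. Qed.

Lemma cmeas_sum I (r : seq I) (P : pred I) (F : I -> R -> R[i]) :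
  (forall i, P i -> cmeasurable (F i)) -> cmeasurable (fun t => \sum_(i <- r | P i) F i t).
Proof.
move=> mF; elim: r => [|i r IH].
  suff -> : (fun t => \sum_(i <- [::] | P i) F i t) = (fun=> 0) by exact: cmeas_cst.
  by apply/funext => t; rewrite big_nil.
have -> : (fun t => \sum_(j <- i :: r | P j) F j t) = (fun t =>
    if P i then F i t + \sum_(j <- r | P j) F j t else \sum_(j <- r | P j) F j t).
  by apply/funext => t; rewrite big_cons.
by case: (boolP (P i)) => // Pi; apply: cmeasD IH; exact: mF.
Qed.

Lemma cmeas_geom_sum N : cmeasurable (fun t : R => geom_sum N (t / a - tau)).
Proof.
apply: cmeas_sum => m _.
have := measurable_expi_affine (2 * pi * m%:R / a) (- (2 * pi * m%:R * tau)).
by congr cmeasurable; apply/funext => t; congr expi; ring.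
Qed.

(** The exceptional points form a countable set. *)
Lemma ae_not_resonant :
  {ae @lebesgue_measure R, forall t, expi (2 * pi * (t / a - tau)) != 1}.
Proof.
pose A := range (fun n : int => a * (n%:~R + tau)).
have cA : countable A by exact: (sub_countable (card_image_le _ _)).
exists A; split.
- exact: (countable_measurable (@measurable_set1 R) cA).
- exact: countable_lebesgue_measure0.
move=> t /= /negP; rewrite negbK => /eqP /expi2pi_eq1[n hn].
by exists n => //; rewrite -hn subrK; field.
Qed.

Definition avg_kernel N (t : R) : R := cmod (geom_sum N (t / a - tau)) / N%:R.

Lemma measurable_avg_kernel N : measurable_fun setT (avg_kernel N).
Proof.
by apply: measurable_funM => //; exact: (cmeas_cmod (cmeas_geom_sum N)).
Qed.

Lemma avg_kernel_ge0 N t : 0 <= avg_kernel N t.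
Proof. by rewrite divr_ge0 ?cmod_ge0. Qed.

Lemma avg_kernel_le1 N t : avg_kernel N t <= 1.
Proof.
case: N => [|N]; first by rewrite /avg_kernel invr0 mulr0.
by rewrite ler_pdivrMr ?ltr0n // mul1r geom_sum_le.
Qed.

Lemma avg_kernel_small f (e : R) : L2 f -> 0 < e ->
  exists N0, forall N, (N0 <= N)%N -> n2 (fun t => (avg_kernel N t)%:C * f t) < e.
Proof.
move=> Lf; apply: n2_dominated => //.
- exact: measurable_avg_kernel.
- by move=> N t; rewrite ger0_norm ?avg_kernel_ge0 ?avg_kernel_le1.
- have FF := ae_filter_ringOfSetsType (@lebesgue_measure R).
  by apply: filterS ae_not_resonant => t; exact: geom_sum_avg_cvg0.
Qed.

(** Mean ergodic theorem for the modulation: the averaged geometric sums are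
    bounded by 1 and tend to 0 almost everywhere. *)
Lemma orbit_sum_freq_small f (e : R) : L2 f -> 0 < e -> exists N0, forall N,
  (N0 <= N)%N -> n2 (orbit_sum dir_freq N f) <= e * N%:R.
Proof.
move=> Lf e0; have [N0 hN0] := avg_kernel_small Lf e0.
exists N0 => -[|N] /hN0.
  rewrite mulr0 (_ : orbit_sum _ _ _ = (fun=> 0)) ?n20 //.
  by apply/funext => t; rewrite /orbit_sum big_ord0.
move=> h; have La : L2 (fun t => (avg_kernel N.+1 t)%:C * f t).
  apply: L2_mul_le1 => //; first exact: measurable_avg_kernel.
  by move=> t; rewrite ger0_norm ?avg_kernel_ge0 ?avg_kernel_le1.
have -> : n2 (orbit_sum dir_freq N.+1 f) =
    n2 (fun t => (N.+1%:R : R[i]) * ((avg_kernel N.+1 t)%:C * f t)).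
  apply: eq_n2 => t; rewrite orbit_sum_freqE !cmodM cmod_nat cmod_real.
  rewrite ger0_norm ?avg_kernel_ge0 // mulrA; congr (_ * _).
  by rewrite /avg_kernel; field.
by rewrite n2Z // cmod_nat mulrC ler_wpM2r // ltW.
Qed.

Lemma inner_eq0 f g : (forall t, f t * cj (g t) = 0) -> inner f g = 0.
Proof.
move=> fg0; rewrite innerE; apply: complex_eq => /=;
  (rewrite -[RHS](mul0r (rint (fun=> 0))) -rintZ; last exact: integ0);
  by apply: eq_rint => t; rewrite fg0 mul0r.
Qed.

(** Up to a tail of small norm [f] has bounded support, and bounded supports
    are disjoint after a large translation. *)
Lemma correlation_small f (e : R) : L2 f -> 0 < e -> exists n0, forall n,
  (n0 <= n)%N -> cmod (inner (twist (dir_time *+ n) f) f) <= e.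
Proof.
move=> Lf e0; have f0 := n2_ge0 f.
have [|rho [rho0 hrho]] := tail_small Lf (_ : 0 < e / (2 * n2 f + 1)).
  by rewrite divr_gt0 //; lra.
exists (Num.truncn (2 * rho / a)).+1 => n hn.
have Lu := L2_trunc rho Lf; have Lw := L2_tail rho Lf.
set u := trunc rho f in Lu *; set w := tail rho f in hrho Lw *.
have Lt g : L2 g -> L2 (twist (dir_time *+ n) g) by exact: L2_twist.
have -> : inner (twist (dir_time *+ n) f) f =
    inner (twist (dir_time *+ n) u) w + inner (twist (dir_time *+ n) w) f.
  rewrite {1 2}(trunc_tail rho f) -/u -/w twist_add innerDl; [|exact: Lt|exact: Lt|exact: L2D].
  rewrite innerDr //; last exact: Lt.
  rewrite (_ : inner (twist _ u) u = 0) ?add0r; last first.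
    apply: inner_eq0 => t; rewrite twist_time /u /trunc.
    have [ht|ht] := boolP (`|t| <= rho)%R; last by rewrite mul0r conjc0 mulr0.
    suff /negbTE -> : ~~ (`|t - a * n%:R| <= rho)%R by rewrite mul0r mulr0 mul0r.
    rewrite -ltNge; have : 2 * rho < a * n%:R.
      have : 2 * rho / a < n%:R by rewrite (lt_le_trans (truncnS_gt _)) // ler_nat.
      by rewrite ltr_pdivrMr // [_ * a]mulrC.
    have := ler_norm (- (t - a * n%:R)); rewrite normrN; have := ler_norm t; lra.
  by congr (_ + inner _ _); rewrite [RHS](trunc_tail rho f).
have uf : n2 u <= n2 f.
  apply: n2_le => // t; rewrite cmodM cmod_real ler_piMl ?cmod_ge0 //.
  by case: (`|t| <= rho); rewrite ?normr1 ?normr0.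
have h1 := cauchy_schwarz (Lt _ Lu) Lw; have h2 := cauchy_schwarz (Lt _ Lw) Lf.
rewrite !n2_twist // in h1 h2.
move: hrho; rewrite ltr_pdivlMr; last lra.
have := cmodD (inner (twist (dir_time *+ n) u) w) (inner (twist (dir_time *+ n) w) f).
have := n2_ge0 w; have := n2_ge0 u.
move: h1 h2; set p := cmod _; set q := cmod _; set s := cmod _; nra.
Qed.

Lemma near_diagonal_count (N n0 i : nat) :
  (\sum_(j < N) ((i - j) + (j - i) < n0) <= 2 * n0)%N.
Proof.
rewrite -(big_mkord xpredT (fun j => ((i - j) + (j - i) < n0)%N : nat)).
rewrite -big_mkcond sum1_count -size_filter /index_iota subn0.
rewrite -[X in (_ <= X)%N](size_iota (i.+1 - n0)) uniq_leq_size //.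
  by rewrite filter_uniq // iota_uniq.
by move=> j; rewrite mem_filter !mem_iota; lia.
Qed.

Lemma correlationE f (i j : nat) : L2 f ->
  cmod (inner (twist (dir_time *+ i) f) (twist (dir_time *+ j) f)) =
  cmod (inner (twist (dir_time *+ ((i - j) + (j - i))) f) f).
Proof.
move=> Lf; wlog ji : i j / (j <= i)%N => [hw|].
  case/orP: (leq_total j i) => [/hw //|ij].
  rewrite inner_conj; [|exact: L2_twist|exact: L2_twist].
  by rewrite cmod_conj hw // [(i - j + _)%N]addnC.
have -> : (j - i = 0)%N by apply/eqP; rewrite subn_eq0.
rewrite addn0 -{1}(subnKC ji) mulrnDr (twistD _ _ a_neq0) inner_twist //.
exact: L2_twist.
Qed.

(** Mean ergodic theorem for the translation: expand the squared norm; its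
    correlations are small away from the diagonal. *)
Lemma orbit_sum_time_small f (e : R) : L2 f -> 0 < e -> exists N0, forall N,
  (N0 <= N)%N -> n2 (orbit_sum dir_time N f) <= e * N%:R.
Proof.
move=> Lf e0; have f0 := n2_ge0 f.
have e2 : 0 < e ^+ 2 / 2 by rewrite divr_gt0 // exprn_gt0.
have [n0 hn0] := correlation_small Lf e2.
pose C := n2 f * n2 f; have C0 : 0 <= C by rewrite mulr_ge0.
exists (Num.truncn (2 * C * (2 * n0)%:R / e ^+ 2)).+1 => N hN.
have Lt g k : L2 g -> L2 (twist k g) by move=> ?; exact: L2_twist.
rewrite -(@ler_pXn2r _ 2) ?nnegrE ?n2_ge0 ?mulr_ge0 ?(ltW e0) // n2_sqr.
have LA : L2 (orbit_sum dir_time N f) by exact: L2_orbit_sum.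
have -> : nsq (orbit_sum dir_time N f) =
    cmod (inner (orbit_sum dir_time N f) (orbit_sum dir_time N f)).
  by rewrite inner_self // cmod_real ger0_norm // nsq_ge0.
rewrite inner_suml //; last by move=> i _; exact: Lt.
under eq_bigr => i _ do (rewrite inner_sumr; [|by move=> j _; exact: Lt|exact: Lt]).
apply: le_trans (cmod_sum _ _ _) _.
apply: (@le_trans _ _ (\sum_(i < N) (e ^+ 2 / 2 * N%:R + C * (2 * n0)%:R))).
  apply: ler_sum => i _; apply: le_trans (cmod_sum _ _ _) _.
  apply: (@le_trans _ _ (\sum_(j < N) (e ^+ 2 / 2 +
      C * ((i - j) + (j - i) < n0)%N%:R))).
    apply: ler_sum => j _; rewrite correlationE //.
    case: ltnP => h; last by rewrite mulr0 addr0; exact: hn0.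
    rewrite mulr1 ler_wpDl ?(ltW e2) //.
    apply: le_trans (cauchy_schwarz (Lt _ _ Lf) Lf) _.
    by rewrite n2_twist.
  rewrite big_split /= sumr_const card_ord -[_ *+ N]mulr_natr lerD2l -mulr_sumr.
  by rewrite ler_wpM2l // -natr_sum ler_nat near_diagonal_count.
rewrite sumr_const card_ord -[_ *+ N]mulr_natr exprMn.
have N0 : 0 < N%:R :> R by rewrite ltr0n (leq_trans _ hN).
have : 2 * C * (2 * n0)%:R / e ^+ 2 < N%:R.
  by rewrite (lt_le_trans (truncnS_gt _)) // ler_nat.
rewrite ltr_pdivrMr ?exprn_gt0 // => h.
rewrite [N%:R ^+ 2]expr2 mulrA ler_wpM2r ?(ltW N0) //.
lra.
Qed.

End ErgodicDecay.

(** * Windows with decay and Lipschitz bounds *)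

Section Calculus.
Context {R : realType}.

Lemma mean_value (f df : R -> R) (x y : R) :
  (forall z : R, is_derive z (1 : R) f (df z)) ->
  exists c, `|c - x| <= `|x - y| /\ `|f x - f y| = `|df c| * `|x - y|.
Proof.
move=> fdf.
have cf u w : {within `[u, w], continuous f}.
  apply: derivable_within_continuous => z _; have h := fdf z; exact: ex_derive.
have [xy|yx] := leP x y.
  have [c] := MVT_segment xy (fun z _ => fdf z) (cf x y).
  rewrite in_itv /= => /andP[c1 c2] e; exists c.
  rewrite ger0_norm ?subr_ge0 // distrC ger0_norm ?subr_ge0 //.
  by split; [lra|rewrite distrC e normrM (ger0_norm (_ : 0 <= y - x)) ?subr_ge0].
have [c] := MVT_segment (ltW yx) (fun z _ => fdf z) (cf y x).
rewrite in_itv /= => /andP[c1 c2] e; exists c; split.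
  rewrite distrC ger0_norm ?subr_ge0 // ger0_norm ?subr_ge0 ?(ltW yx) //; lra.
by rewrite e normrM.
Qed.

Lemma expi_lipschitz (x y : R) : cmod (expi x - expi y) <= 2 * `|x - y|.
Proof.
apply: le_trans (cmod_le_ReIm _) _; rewrite /expi /=.
have [c [_ ->]] := mean_value x y (@is_derive_cos R).
have [d [_ ->]] := mean_value x y (@is_derive_sin R).
rewrite mulr_natl mulr2n lerD // ler_piMl //.
  by rewrite normrN ler_norml sin_geN1 sin_le1.
by rewrite ler_norml cos_geN1 cos_le1.
Qed.

Lemma integ_oneDsqr : integ (fun t : R => (1 + t ^+ 2)^-1).
Proof.
have pos (t : R) : 0 < 1 + t ^+ 2 by rewrite ltr_pwDl // sqr_ge0.
have mf : measurable_fun setT (fun t : R => (1 + t ^+ 2)^-1).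
  exact: (continuous_measurable_fun (@continuous_oneDsqrV R)).
have mF : measurable_fun setT (fun t : R => ((1 + t ^+ 2)^-1)%:E) by exact/measurable_EFinP.
apply/integrableP; split => //.
have -> : (fun t : R => `|(EFin \o (fun t : R => ((1 + t ^+ 2)^-1)%R)) t|%E) =
    (fun t : R => ((1 + t ^+ 2)^-1)%:E).
  by apply/funext => t; rewrite /= ger0_norm // invr_ge0 ltW.
have half : (\int[@lebesgue_measure R]_(t in `[0%R, +oo[) ((1 + t ^+ 2)^-1)%:E)%E = (pi / 2)%:E.
  exact: integral0y_oneDsqr.
have neg : (\int[@lebesgue_measure R]_(t in `]-oo, 0%R]) ((1 + t ^+ 2)^-1)%:E)%E = (pi / 2)%:E.
  rewrite -half (ge0_integration_by_substitution0 mF); last first.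
    by move=> t; rewrite lee_fin invr_ge0 ltW.
  by apply: eq_integral => t _; rewrite sqrrN.
have -> : [set: R] = `]-oo, 0%R]%classic `|` `]0%R, +oo[%classic.
  by apply/seteqP; split => t //= _; rewrite !in_itv /= andbT; case: (leP t 0); [left|right].
rewrite ge0_integral_setU //.
- rewrite neg; apply: lte_add_pinfty; first by rewrite ltry.
  apply: le_lt_trans (_ : (_ <= (pi / 2)%:E)%E) _; last by rewrite ltry.
  rewrite -half; apply: ge0_subset_integral => //.
  + exact: (measurable_funS _ _ mF).
  + by move=> t _; rewrite lee_fin invr_ge0 ltW.
  + by move=> t /=; rewrite !in_itv /= !andbT; exact: ltW.
- exact: (measurable_funS _ _ mF).
- by move=> t _; rewrite lee_fin invr_ge0 ltW.
- apply/disj_setPS => t [] /=; rewrite !in_itv /= andbT => t0 t1.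
  by have := lt_le_trans t1 t0; rewrite ltxx.
Qed.

End Calculus.

Section NiceFunctions.
Context {R : realType}.
Implicit Types (v w : R -> R[i]) (C : R).

(** Decay and Lipschitz bounds that make all lattice sums of a window
    absolutely convergent, together with one moment; unlike smoothness they are
    visibly stable under every operation applied to windows below. *)
Definition decay_with C v : Prop :=
  (forall t, cmod (v t) * (1 + `|t|) ^+ 4 <= C) /\
  (forall t t', `|t - t'| <= 1 ->
     cmod (v t - v t') * (1 + `|t|) ^+ 2 <= C * `|t - t'|).
Definition nice v : Prop := exists C, decay_with C v.

Lemma decay_with_ge0 C v : decay_with C v -> 0 <= C.
Proof.
move=> [/(_ 0) h _]; apply: le_trans h.
by rewrite mulr_ge0 ?cmod_ge0 // exprn_ge0 // addr_ge0.
Qed.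

Lemma nice_lin (c d : R[i]) v w : nice v -> nice w -> nice (fun t => c * v t + d * w t).
Proof.
move=> [C [v1 v2]] [D [w1 w2]]; exists (cmod c * C + cmod d * D); split=> [t|t t' tt].
  have p0 : 0 <= (1 + `|t|) ^+ 4 by rewrite exprn_ge0 // addr_ge0.
  apply: le_trans (_ : (cmod c * cmod (v t) + cmod d * cmod (w t)) * (1 + `|t|) ^+ 4 <= _).
    by rewrite ler_wpM2r // -!cmodM cmodD.
  by rewrite mulrDl -!mulrA lerD // ler_wpM2l ?cmod_ge0.
have p0 : 0 <= (1 + `|t|) ^+ 2 by rewrite exprn_ge0 // addr_ge0.
apply: le_trans (_ : (cmod c * cmod (v t - v t') + cmod d * cmod (w t - w t')) *
  (1 + `|t|) ^+ 2 <= _).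
  rewrite ler_wpM2r // -!cmodM.
  have -> : c * v t + d * w t - (c * v t' + d * w t') =
    c * (v t - v t') + d * (w t - w t') by ring.
  exact: cmodD.
by rewrite !mulrDl -!mulrA lerD // ler_wpM2l ?cmod_ge0 ?v2 ?w2.
Qed.

(** Moving the origin to [x] changes the weight by a factor of at most
    [1 + |x|]. *)
Lemma nice_shift x v : nice v -> nice (fun t => v (t - x)).
Proof.
move=> [C [v1 v2]]; exists ((1 + `|x|) ^+ 4 * C).
have x1 : 1 <= 1 + `|x| by rewrite lerDl.
have C0 := decay_with_ge0 (conj v1 v2).
have shift t : 1 + `|t| <= (1 + `|x|) * (1 + `|t - x|).
  have : `|t| <= `|t - x| + `|x| by rewrite -{1}(subrK x t) ler_normD.
  have := normr_ge0 x; have := normr_ge0 (t - x); nra.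
have pow n t : (1 + `|t|) ^+ n <= (1 + `|x|) ^+ n * (1 + `|t - x|) ^+ n.
  rewrite -exprMn; case: n => [|n]; first by rewrite !expr0.
  by rewrite ler_pXn2r ?nnegrE ?mulr_ge0 ?addr_ge0.
split=> [t|t t' tt].
  apply: le_trans (ler_wpM2l (cmod_ge0 _) (pow 4 t)) _.
  by rewrite mulrCA ler_wpM2l ?exprn_ge0 ?addr_ge0.
apply: le_trans (ler_wpM2l (cmod_ge0 _) (pow 2 t)) _.
have e : t - t' = (t - x) - (t' - x) by ring.
rewrite mulrCA -[in leRHS]mulrA; apply: ler_pM.
- by rewrite exprn_ge0 // addr_ge0.
- by rewrite mulr_ge0 ?cmod_ge0 // exprn_ge0 // addr_ge0.
- by rewrite ler_weXn2l.
- by rewrite e v2 // -e.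
Qed.

Lemma nice_modulation (c d : R) v : nice v -> nice (fun t => expi (c * t + d) * v t).
Proof.
move=> [C [v1 v2]]; exists (C + 2 * `|c| * C).
have C0 := decay_with_ge0 (conj v1 v2).
split=> [t|t t' tt].
  by rewrite cmodM cmod_expi mul1r; have := v1 t; have := normr_ge0 c; nra.
have -> : expi (c * t + d) * v t - expi (c * t' + d) * v t' =
   expi (c * t' + d) * (v t - v t') + (expi (c * t + d) - expi (c * t' + d)) * v t.
  by ring.
have p0 : 0 <= (1 + `|t|) ^+ 2 by rewrite exprn_ge0 // addr_ge0.
apply: le_trans (ler_wpM2r p0 (cmodD _ _)) _.
rewrite mulrDl [leRHS]mulrDl lerD //.
  by rewrite cmodM cmod_expi mul1r v2.
rewrite cmodM -mulrA.
have vt : cmod (v t) * (1 + `|t|) ^+ 2 <= C.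
  apply: le_trans (v1 t); rewrite ler_wpM2l ?cmod_ge0 // ler_weXn2l //.
  by rewrite lerDl.
have := expi_lipschitz (c * t + d) (c * t' + d).
have -> : c * t + d - (c * t' + d) = c * (t - t') by ring.
rewrite normrM => h.
have := ler_pM (cmod_ge0 _) (mulr_ge0 (cmod_ge0 (v t)) p0) h vt.
lra.
Qed.

Lemma nice_tfshift z v : nice v -> nice (tfshift z v).
Proof.
move=> /(nice_shift z.1)/(nice_modulation (2 * pi * z.2) (- (2 * pi * z.2 * z.1))).
congr nice; apply/funext => t; rewrite [RHS]tfshiftE; congr (expi _ * _).
ring.
Qed.

Lemma nice_continuous v : nice v ->
  continuous (fun t => complex.Re (v t)) /\ continuous (fun t => complex.Im (v t)).
Proof.
move=> [C [v1 v2]]; have C0 := decay_with_ge0 (conj v1 v2).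
have lip (t t' : R) : `|t - t'| <= 1 -> cmod (v t - v t') <= C * `|t - t'|.
  move=> tt; apply: le_trans (v2 t t' tt).
  by rewrite ler_peMr ?cmod_ge0 // exprn_ege1 // lerDl.
have gen (p : R[i] -> R) : (forall z z' : R[i], `|p z - p z'| <= cmod (z - z')) ->
    continuous (fun t => p (v t)).
  move=> pz t; apply/cvgrPdist_lt => e e0.
  have d0 : 0 < Num.min 1 (e / (C + 1)) by rewrite lt_min ltr01 divr_gt0 //; lra.
  exists (Num.min 1 (e / (C + 1))) => //= t' /=.
  rewrite lt_min => /andP[h1 h2].
  apply: le_lt_trans (pz _ _) _; apply: le_lt_trans (lip _ _ (ltW h1)) _.
  move: h2; rewrite ltr_pdivlMr; last lra.
  by have := normr_ge0 (t - t'); nra.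
by split; apply: gen => z w; rewrite -?cReB -?cImB ?Re_le_cmod ?Im_le_cmod.
Qed.

Lemma nice_L2 v : nice v -> L2 v.
Proof.
move=> nv; have [cr ci] := nice_continuous nv.
case: nv => C [v1 v2]; have C0 := decay_with_ge0 (conj v1 v2).
have mv : cmeasurable v by split; exact: continuous_measurable_fun.
apply/L2P; split => //.
apply: integ_le (integZ (C ^+ 2) integ_oneDsqr); first exact: cmeas_sqr.
move=> t; rewrite ger0_norm ?exprn_ge0 ?cmod_ge0 // ler_pdivlMr; last first.
  by rewrite ltr_pwDl // sqr_ge0.
have := v1 t; have := cmod_ge0 (v t); set y := cmod (v t) => y0 h.
have t1 : 1 <= 1 + `|t| by rewrite lerDl.
have h2 : y * (1 + `|t|) <= C.
  by apply: le_trans h; rewrite ler_wpM2l // -[leLHS]expr1 ler_weXn2l.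
have h3 : 1 + t ^+ 2 <= (1 + `|t|) ^+ 2.
  rewrite -(real_normK (num_real t)); have := normr_ge0 t; set s := `|t| => s0.
  by rewrite !expr2; nra.
apply: le_trans (_ : (y * (1 + `|t|)) ^+ 2 <= _).
  by rewrite exprMn ler_wpM2l ?exprn_ge0.
by rewrite ler_pXn2r ?nnegrE // mulr_ge0 // addr_ge0.
Qed.

(** The Lipschitz bound is the mean value theorem: within distance 1 the weight
    changes by a factor of at most 2 and the derivative decays. *)
Lemma schwartz_nice v : schwartz v -> nice v.
Proof.
move=> [sm dec].
have [C0 h0] := dec 0 0; have [C4 h4] := dec 4 0.
have [D0 k0] := dec 0 1; have [D2 k2] := dec 2 1.
have E0 t : cderivn 0 v t = v t by rewrite /cderivn /=; case: (v t).
have der t : is_derive t (1 : R) (fun x => complex.Re (v x)) (complex.Re (cderivn 1 v t)) /\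
    is_derive t (1 : R) (fun x => complex.Im (v x)) (complex.Im (cderivn 1 v t)).
  have [dr di] := sm 0 t; rewrite /cderivn /= !derive1E.
  by split; exact: derivableP.
have pow4 (s : R) : 0 <= s -> (1 + s) ^+ 4 <= 8 * (1 + s ^+ 4).
  move=> s0; have sq : (1 + s) ^+ 2 <= 2 * (1 + s ^+ 2) by have := sqr_ge0 (1 - s); rewrite !expr2; nra.
  have -> : (1 + s) ^+ 4 = ((1 + s) ^+ 2) ^+ 2 by rewrite -exprM.
  apply: le_trans (_ : (2 * (1 + s ^+ 2)) ^+ 2 <= _).
    by rewrite ler_pXn2r ?nnegrE ?sqr_ge0 // mulr_ge0 // addr_ge0 ?sqr_ge0.
  have -> : s ^+ 4 = (s ^+ 2) ^+ 2 by rewrite -exprM.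
  set r := s ^+ 2; have := sqr_ge0 (1 - r); rewrite !expr2; lra.
have D1 t : cmod (cderivn 1 v t) * (1 + `|t|) ^+ 2 <= 2 * (D0 + D2).
  have := k0 t; have := k2 t; rewrite expr0 mul1r.
  set y := cmod _; have y0 : 0 <= y by exact: cmod_ge0.
  have := normr_ge0 t; set s := `|t| => s0 a1 a2.
  have := sqr_ge0 (1 - s); move: a1 a2; rewrite !expr2 => a1 a2 a3.
  by have : 0 <= y * ((1 - s) * (1 - s)) by [rewrite mulr_ge0]; nra.
exists (8 * (C0 + C4) + 16 * (D0 + D2)); split=> [t|t t' tt].
  have D00 : 0 <= 16 * (D0 + D2).
    have := D1 t; have : 0 <= cmod (cderivn 1 v t) * (1 + `|t|) ^+ 2.
      by rewrite mulr_ge0 ?cmod_ge0 ?sqr_ge0.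
    lra.
  have := h0 t; have := h4 t; rewrite !E0 expr0 mul1r => a1 a2.
  apply: le_trans (ler_wpM2l (cmod_ge0 _) (pow4 _ (normr_ge0 t))) _; nra.
have C00 : 0 <= 8 * (C0 + C4).
  have := h0 t; have := h4 t; rewrite !E0 expr0 mul1r; have := cmod_ge0 (v t).
  have : 0 <= `|t| ^+ 4 * cmod (v t) by rewrite mulr_ge0 ?cmod_ge0 ?exprn_ge0.
  lra.
have bnd c (y : R) : `|c - t| <= `|t - t'| -> 0 <= y -> y <= cmod (cderivn 1 v c) ->
    y * (1 + `|t|) ^+ 2 <= 8 * (D0 + D2).
  move=> ct y0 yc; have := D1 c.
  have tc : 1 + `|t| <= 2 * (1 + `|c|).
    have : `|t| <= `|c - t| + `|c| by rewrite distrC -{1}(subrK c t) ler_normD.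
    have := normr_ge0 c; lra.
  have : (1 + `|t|) ^+ 2 <= 4 * (1 + `|c|) ^+ 2.
    have -> : 4 * (1 + `|c|) ^+ 2 = (2 * (1 + `|c|)) ^+ 2 by rewrite exprMn; ring.
    by rewrite ler_pXn2r ?nnegrE ?mulr_ge0 ?addr_ge0.
  move=> p1 p2; apply: le_trans (ler_wpM2l y0 p1) _.
  have : y * (1 + `|c|) ^+ 2 <= cmod (cderivn 1 v c) * (1 + `|c|) ^+ 2.
    by rewrite ler_wpM2r // sqr_ge0.
  lra.
have [c [c1 c2]] := mean_value t t' (fun z => (der z).1).
have [d [d1 d2]] := mean_value t t' (fun z => (der z).2).
apply: le_trans (ler_wpM2r (sqr_ge0 _) (cmod_le_ReIm _)) _.
rewrite cReB cImB c2 d2 mulrDl.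
have b1 := bnd c _ c1 (normr_ge0 _) (Re_le_cmod _).
have b2 := bnd d _ d1 (normr_ge0 _) (Im_le_cmod _).
rewrite mulrAC [X in _ + X <= _]mulrAC -mulrDl ler_wpM2r //.
lra.
Qed.

End NiceFunctions.

(** * The Zak transform of a window *)

Section Zak.
Context {R : realType} (a : R).
Hypothesis a_gt0 : 0 < a.
Implicit Types (v w : R -> R[i]) (t th : R).

(** Decay along the lattice, uniform in the base point [s] of a bounded set. *)
Lemma lattice_decay v (S : R) : nice v -> exists C : R, [/\ 0 <= C,
  forall s (i : int), `|s| <= S ->
    cmod (v (s + a * i%:~R)) * (1 + `|i%:~R|) ^+ 4 <= C &
  forall s s' (i : int), `|s| <= S -> `|s - s'| <= 1 ->
    cmod (v (s + a * i%:~R) - v (s' + a * i%:~R)) * (1 + `|i%:~R|) ^+ 2 <= C * `|s - s'| ].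
Proof.
move=> [C [v1 v2]]; have C0 := decay_with_ge0 (conj v1 v2).
pose k := 1 + (1 + `|S|) / a.
have k1 : 1 <= k by rewrite lerDl divr_ge0 ?addr_ge0 // ltW.
have k0 : 0 <= k := le_trans ler01 k1.
have grow s (i : int) : `|s| <= S -> 1 + `|i%:~R| <= k * (1 + `|s + a * i%:~R|).
  move=> sS; have S0 := le_trans (normr_ge0 s) sS.
  have e : `|i%:~R| = `|(s + a * i%:~R) - s| / a.
    by rewrite addrC addKr normrM (gtr0_norm a_gt0); field; exact: lt0r_neq0.
  rewrite /k (ger0_norm S0) e; have := ler_normB (s + a * i%:~R) s.
  set x := `|_|; set y := `|s + _| => xy.
  have y0 : 0 <= y by exact: normr_ge0.
  have -> : (1 + (1 + S) / a) * (1 + y) = 1 + y + ((1 + S) * (1 + y)) / a.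
    by field; exact: lt0r_neq0.
  rewrite -addrA lerD2l ler_wpDl // ler_pM2r ?invr_gt0 //.
  have Sy := mulr_ge0 S0 y0.
  have -> : (1 + S) * (1 + y) = 1 + y + S + S * y by ring.
  move: xy; set r := `|s|; rewrite -/r in sS; lra.
have growX n s (i : int) : `|s| <= S ->
    (1 + `|i%:~R|) ^+ n <= k ^+ n * (1 + `|s + a * i%:~R|) ^+ n.
  move=> sS; rewrite -exprMn; case: n => [|n]; first by rewrite !expr0.
  have p0 (x : R) : 0 <= 1 + `|x| by rewrite addr_ge0.
  by apply: lerXn2r; rewrite ?nnegrE ?mulr_ge0 ?p0 //; exact: grow.
exists (k ^+ 4 * C); split=> [|s i sS|s s' i sS ss'].
- by rewrite mulr_ge0 ?exprn_ge0.
- apply: le_trans (ler_wpM2l (cmod_ge0 _) (growX 4 s i sS)) _.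
  by rewrite mulrCA ler_wpM2l ?exprn_ge0.
- apply: le_trans (ler_wpM2l (cmod_ge0 _) (growX 2 s i sS)) _.
  have e : s - s' = s + a * i%:~R - (s' + a * i%:~R) by ring.
  rewrite mulrCA -[leRHS]mulrA; apply: ler_pM.
  + by rewrite exprn_ge0.
  + by rewrite mulr_ge0 ?cmod_ge0 // exprn_ge0 // addr_ge0.
  + by rewrite ler_weXn2l.
  + by rewrite e v2 // -e.
Qed.

Lemma sum_weight_le (y : int -> R) C : 0 <= C ->
  (forall i, y i * (1 + `|i%:~R|) ^+ 2 <= C) ->
  forall A : {fset int}, \sum_(i <- A) y i <= 4 * C.
Proof.
move=> C0 yC A.
apply: (@le_trans _ _ (\sum_(i <- A) C * (1 + `|i%:~R|) ^- 2)).
  by apply: ler_sum => i _; rewrite ler_pdivlMr ?yC // exprn_gt0 // ltr_pwDl.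
by rewrite -mulr_sumr mulrC ler_wpM2r // sum_inv_sq_le.
Qed.

Definition zak_term v t th (i : int) : R[i] :=
  v (t + a * i%:~R) * expi (th * i%:~R).
Definition zak v t th : R[i] := xget 0 [set z | has_usum (zak_term v t th) z].

Lemma cmod_zak_term v t th i : cmod (zak_term v t th i) = cmod (v (t + a * i%:~R)).
Proof. by rewrite cmodM cmod_expi mulr1. Qed.

Lemma weight_ge1 (i : int) : 1 <= 1 + `|i%:~R| :> R.
Proof. by rewrite lerDl. Qed.

Lemma zakP v t th : nice v -> has_usum (zak_term v t th) (zak v t th).
Proof.
move=> nv; have [C [C0 h _]] := lattice_decay `|t| nv.
have [z hz] : exists z, has_usum (zak_term v t th) z.
  apply: (has_usum_ex (y := fun i : int => cmod (v (t + a * i%:~R)))) => [i|].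
    by rewrite cmod_zak_term.
  apply: (sum_weight_le C0) => i; apply: le_trans (h t i (lexx _)).
  by rewrite ler_wpM2l ?cmod_ge0 // ler_weXn2l // weight_ge1.
exact: (xgetPex 0 (ex_intro _ z hz)).
Qed.

Lemma zak_unique v t th z : nice v -> has_usum (zak_term v t th) z -> zak v t th = z.
Proof. by move=> nv; apply: has_usum_unique; exact: zakP. Qed.

Lemma zak_lipschitz v (S : R) : nice v -> exists C : R, 0 <= C /\
  forall t t' th th', `|t| <= S -> `|t - t'| <= 1 ->
    cmod (zak v t th - zak v t' th') <= C * (`|t - t'| + `|th - th'|).
Proof.
move=> nv; have [C [C0 h1 h2]] := lattice_decay (S + 1) nv.
exists (8 * C); split=> [|t t' th th' tS tt]; first by rewrite mulr_ge0.
set d := `|t - t'| + 2 * `|th - th'|.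
have d0 : 0 <= d by rewrite addr_ge0 // mulr_ge0.
apply: (@le_trans _ _ (4 * (C * d))); last first.
  by rewrite /d; have := normr_ge0 (t - t'); have := normr_ge0 (th - th'); nra.
have t'S : `|t'| <= S + 1.
  by rewrite -(subrK t t') (le_trans (ler_normD _ _)) // addrC lerD // distrC.
have tS1 : `|t| <= S + 1 by lra.
apply: (has_usum_le (y := fun i : int => cmod (v (t + a * i%:~R) - v (t' + a * i%:~R)) +
   cmod (v (t' + a * i%:~R)) * (2 * (`|th - th'| * `|i%:~R|))) _ _
   (has_usumB (zakP t th nv) (zakP t' th' nv))) => [i|].
  rewrite /zak_term.
  have -> : v (t + a * i%:~R) * expi (th * i%:~R) - v (t' + a * i%:~R) * expi (th' * i%:~R)
    = (v (t + a * i%:~R) - v (t' + a * i%:~R)) * expi (th * i%:~R) +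
      v (t' + a * i%:~R) * (expi (th * i%:~R) - expi (th' * i%:~R)) by ring.
  apply: le_trans (cmodD _ _) _; rewrite !cmodM cmod_expi mulr1 lerD2l.
  rewrite ler_wpM2l ?cmod_ge0 //; apply: le_trans (expi_lipschitz _ _) _.
  by rewrite -mulrBl normrM.
apply: sum_weight_le => [|i]; first by rewrite mulr_ge0.
rewrite mulrDl /d mulrDr lerD ?h2 //.
have := h1 t' i t'S; set y := cmod _; have y0 : 0 <= y by exact: cmod_ge0.
have := weight_ge1 i; set k := 1 + _ => k1 hk.
have i0 := normr_ge0 (i%:~R : R).
have ik : `|i%:~R| <= k ^+ 2 by rewrite /k expr2; nra.
have th0 := normr_ge0 (th - th').
have yk : y * (`|i%:~R| * k ^+ 2) <= C.
  apply: le_trans hk; rewrite ler_wpM2l // (_ : 4%N = (2 + 2)%N) // exprD.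
  by rewrite ler_wpM2r ?sqr_ge0.
have := ler_wpM2l (mulr_ge0 (ler0n R 2) th0) yk.
lra.
Qed.

Lemma zak_shift v t th : nice v -> zak v (t + a) th = expi (- th) * zak v t th.
Proof.
move=> nv; apply: zak_unique => //.
have := has_usum_reindex (f := fun i : int => i + 1) (g := fun i : int => i - 1)
  (addrK 1) (subrK 1) (zakP t th nv).
move=> /(has_usumZ (expi (- th))); apply: eq_has_usum => i.
rewrite /zak_term mulrCA -expiD intrD; congr (v _ * expi _); ring.
Qed.

Lemma zak_period v t th : nice v -> zak v t (th + 2 * pi) = zak v t th.
Proof.
move=> nv; apply: zak_unique => //; apply: eq_has_usum (zakP t th nv) => i.
by rewrite /zak_term mulrDl expiD expi2pi_int mulr1.
Qed.

Lemma zak_lin (c d : R[i]) v w t th : nice v -> nice w ->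
  zak (fun s => c * v s + d * w s) t th = c * zak v t th + d * zak w t th.
Proof.
move=> nv nw; apply: zak_unique; first exact: nice_lin.
apply: eq_has_usum (has_usumD (has_usumZ c (zakP t th nv)) (has_usumZ d (zakP t th nw))) => i.
by rewrite /zak_term; ring.
Qed.

Lemma zak_tfshift v (x y : R) t th : nice v ->
  zak (tfshift (x, y) v) t th =
  expi (2 * pi * y * (t - x)) * zak v (t - x) (th + 2 * pi * y * a).
Proof.
move=> nv; apply: zak_unique; first exact: nice_tfshift.
apply: eq_has_usum (has_usumZ _ (zakP (t - x) (th + 2 * pi * y * a) nv)) => i.
rewrite /zak_term tfshiftE.
have -> : t + a * i%:~R - x = t - x + a * i%:~R by ring.
rewrite mulrCA -[RHS]mulrA [RHS]mulrCA -!expiD; congr (_ * expi _); ring.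
Qed.

(** Averaging the Zak transform over the [N]-th roots of unity isolates the
    samples at multiples of [N], which beyond 0 are negligible. *)
Lemma zak_nonzero v t : nice v -> v t != 0 -> exists th, zak v t th != 0.
Proof.
move=> nv; apply: contra_neqP => /forallNP allz.
have z0 th : zak v t th = 0 by apply/eqP; apply: contrapT => /negP/(allz th).
have [C [C0 h _]] := lattice_decay `|t| nv.
have bound (N : nat) : (0 < N)%N -> N%:R * cmod (v t) <= 4 * C.
  move=> N0; have N0' : N%:R != 0 :> R by rewrite pnatr_eq0 -lt0n.
  have hs : has_usum (fun i : int => v (t + a * i%:~R) * geom_sum N (i%:~R / N%:R)) 0.
    have := @has_usum_sum _ _ _ (index_enum _) xpredT
      (fun (r : 'I_N) => zak_term v t (2 * pi * r%:R / N%:R)) _ (fun r _ => zakP t _ nv).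
    rewrite big1 => [|r _]; last exact: z0.
    apply: eq_has_usum => i; rewrite -mulr_sumr; congr (_ * _).
    by apply: eq_bigr => r _; congr expi; ring.
  have hd := @has_usum_finite R _ [fset (0 : int)]%fset
    (fun i : int => if i == 0 then N%:R * v t else 0).
  rewrite big_seq_fset1 eqxx in hd.
  have {}hd := hd (fun i => ltac:(rewrite in_fset1 => /negbTE ->; reflexivity)).
  have := has_usumB hs hd; rewrite sub0r => hb.
  rewrite -[X in X * _](cmod_nat N) -cmodM -cmodN.
  apply: (has_usum_le (y := fun i : int => cmod (v (t + a * i%:~R)) * `|i%:~R|)) hb => [i|].
    case: eqVneq => [->|i0].
      rewrite mulr0 addr0 mul0r /geom_sum.
      under eq_bigr do rewrite mulr0 expi0.
      rewrite sumr_const card_ord mulr_natr mulr_natl subrr cmod0.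
      by rewrite mulr_ge0 ?cmod_ge0.
    rewrite subr0 cmodM ler_wpM2l ?cmod_ge0 //.
    have [|e1] := eqVneq (expi (2 * pi * (i%:~R / N%:R)) : R[i]) 1.
      move=> /expi2pi_eq1[n en].
      apply: le_trans (geom_sum_le _ _) _.
      have iE : i%:~R = (n%:~R * N%:R : R) by rewrite -en; field.
      rewrite iE normrM normr_nat ler_peMl // -intr_norm.
      have n0 : n != 0.
        apply: contra_neq i0 => n0; apply/eqP; rewrite -(intr_eq0 R) iE n0.
        by rewrite mulr0z mul0r.
      by rewrite -[1]/(1%:~R) ler_int; lia.
    have eN : 2 * pi * N%:R * (i%:~R / N%:R : R) = 2 * pi * i%:~R by field.
    have := geom_sum_mul N (i%:~R / N%:R : R); rewrite eN.
    rewrite expi2pi_int subrr => /eqP; rewrite mulf_eq0 subr_eq0.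
    by rewrite [1 == _]eq_sym (negbTE e1) orbF => /eqP ->; rewrite cmod0.
  apply: sum_weight_le => // i; apply: le_trans (h t i (lexx _)).
  rewrite -mulrA ler_wpM2l ?cmod_ge0 // (_ : 4%N = (2 + 2)%N) // exprD.
  rewrite ler_wpM2r ?sqr_ge0 //; have := normr_ge0 (i%:~R : R).
  by rewrite expr2; nra.
apply/eqP; rewrite -cmod_eq0 eq_le cmod_ge0 andbT leNgt; apply/negP => v0.
have := bound (Num.truncn (4 * C / cmod (v t))).+1 isT.
have := truncnS_gt (4 * C / cmod (v t)); rewrite ltr_pdivrMr //.
by move=> h1 h2; have := lt_le_trans h1 h2; rewrite ltxx.
Qed.

End Zak.

(** * Linear growth of the box sums of a window *)

Section LowerBound.
Context {R : realType} (a th t0 : R).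
Hypothesis a_gt0 : 0 < a.
Implicit Types (v : R -> R[i]).
Local Notation tau := (t0 / a).
Local Notation orbit_sum := (orbit_sum a th tau).
Local Notation box_sum := (box_sum a th tau).

Let a_neq0 : a != 0. Proof. exact: lt0r_neq0. Qed.

Lemma sum_eq_ord (N : nat) (d : int) :
  \sum_(n < N) ((d == (n : nat)%:Z)%:R : R) = (0 <= d < N%:Z)%R%:R.
Proof.
case: d => d; last first.
  by rewrite big1 // => n _; case: eqP.
have [dN|dN] := ltnP d N.
  rewrite (bigD1 (Ordinal dN)) //= eqxx big1 ?addr0; last first.
    move=> n; rewrite -val_eqE /= => nd; case: eqP => // -[e].
    by rewrite e eqxx in nd.
  by rewrite ltz_nat dN.
have /negbTE dN' : ~~ (d < N)%N by rewrite -leqNgt.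
rewrite ltz_nat dN' andbF big1 // => n _; case: eqP => // -[e].
by have := ltn_ord n; rewrite -e ltnNge dN.
Qed.

Lemma geom_sum_near0 (N : nat) (x : R) : 0 <= x -> 8 * pi * N%:R * x <= 1 ->
  N%:R / 2 <= cmod (geom_sum N x).
Proof.
move=> x0 Nx; have pi0 := @pi_gt0 R.
have : cmod (N%:R - geom_sum N x) <= N%:R / 2.
  have -> : N%:R - geom_sum N x = \sum_(m < N) (1 - expi (2 * pi * m%:R * x)).
    by rewrite sumrB sumr_const card_ord.
  apply: le_trans (cmod_sum _ _ _) _.
  apply: (@le_trans _ _ (\sum_(m < N) (2^-1 : R))); last first.
    by rewrite sumr_const card_ord -[_ *+ N]mulr_natl.
  apply: ler_sum => m _; rewrite -expi0.
  apply: le_trans (expi_lipschitz _ _) _.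
  have mx : 0 <= 2 * pi * m%:R * x by rewrite !mulr_ge0 // ltW.
  rewrite sub0r normrN ger0_norm //.
  have : 2 * pi * m%:R * x <= 2 * pi * N%:R * x.
    by rewrite ler_wpM2r // ler_wpM2l ?mulr_ge0 ?(ltW pi0) // ler_nat ltnW.
  lra.
have : cmod (N%:R : R[i]) <= cmod (N%:R - geom_sum N x) + cmod (geom_sum N x).
  by apply: le_trans (cmodD _ _); rewrite subrK.
rewrite cmod_nat; lra.
Qed.

Lemma geom_sum_period N (x : R) (j : int) : geom_sum N (x + j%:~R) = geom_sum N x.
Proof.
apply: eq_bigr => m _.
have -> : 2 * pi * m%:R * (x + j%:~R) = 2 * pi * m%:R * x + 2 * pi * ((m : nat)%:Z * j)%:~R.
  by rewrite intrM -pmulrn; ring.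
by rewrite expiD expi2pi_int mulr1.
Qed.

Lemma orbit_sum_time_zak N v (s : R) (j : int) :
  orbit_sum dir_time N v (s + a * j%:~R) =
  expi (- (th * j%:~R)) * \sum_(n < N) zak_term a v s th (j - (n : nat)%:Z).
Proof.
rewrite orbit_sum_timeE mulr_sumr; apply: eq_bigr => n _.
rewrite /zak_term mulrCA -expiD mulrC intrB -pmulrn; congr (v _ * expi _); ring.
Qed.

(** Away from the ends of the box, the truncated Zak series is close to the
    full one: it omits only indices of size at least [J]. *)
Lemma truncated_zak v (s C : R) (N J : nat) (j : int) : nice v -> (0 < J)%N ->
  (forall i : int, cmod (v (s + a * i%:~R)) * (1 + `|i%:~R|) ^+ 4 <= C) ->
  (J%:Z <= j)%R -> (j + J%:Z <= N%:Z)%R ->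
  cmod (zak a v s th - \sum_(n < N) zak_term a v s th (j - (n : nat)%:Z)) <= 4 * C / J%:R.
Proof.
move=> nv J0 hC Jj jN.
have C0 : 0 <= C.
  by apply: le_trans (hC 0); rewrite mulr_ge0 ?cmod_ge0 // exprn_ge0 // addr_ge0.
have Jp : 0 < J%:R :> R by rewrite ltr0n.
have hf : has_usum (fun i => \sum_(n < N) (i == j - (n : nat)%:Z)%:R * zak_term a v s th i)
    (\sum_(n < N) zak_term a v s th (j - (n : nat)%:Z)).
  by apply: has_usum_sum => n _; exact: has_usum_delta.
have := has_usumB (zakP a_gt0 s th nv) hf.
apply: (has_usum_le (y := fun i : int => J%:R^-1 * (cmod (v (s + a * i%:~R)) * `|i%:~R|))) => [i|].
  rewrite -mulr_suml.
  have -> : \sum_(n < N) (i == j - (n : nat)%:Z)%:R = ((0 <= j - i < N%:Z)%R%:R : R[i]).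
    have := sum_eq_ord N (j - i) => /(congr1 (real_complex R)).
    rewrite rmorph_sum !rmorph_nat => <-; apply: eq_bigr => n _; rewrite rmorph_nat.
    by congr (_%:R); rewrite subr_eq eq_sym subr_eq addrC eq_sym [_ + i]addrC.
  have [inr|outr] := boolP (0 <= j - i < N%:Z)%R.
    by rewrite mul1r subrr cmod0 !mulr_ge0 ?cmod_ge0 // invr_ge0 ltW.
  rewrite mul0r subr0 cmod_zak_term mulrCA ler_peMr ?cmod_ge0 //.
  rewrite mulrC ler_pdivlMr // mul1r -intr_norm -[J%:R]/((J%:Z)%:~R) ?pmulrn ler_int.
  by move: outr Jj jN; lia.
move=> A; apply: le_trans (_ : J%:R^-1 * (4 * C) <= _); last by rewrite mulrC.
apply: sum_scale_le A; first by rewrite invr_ge0 ltW.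
apply: sum_weight_le => // i; apply: le_trans (hC i).
rewrite -mulrA ler_wpM2l ?cmod_ge0 // (_ : 4%N = (2 + 2)%N) // exprD.
rewrite ler_wpM2r ?sqr_ge0 //; have := normr_ge0 (i%:~R : R).
by rewrite expr2; nra.
Qed.

Lemma inner_index (N J k : nat) : (k < N - 2 * J)%N ->
  ((J + k)%N%:Z + J%:Z <= N%:Z)%R.
Proof. by lia. Qed.

Lemma box_arith (N J : nat) : (0 < J)%N -> (4 * J <= N)%N ->
  (0 < N)%N /\ (N <= (N - 2 * J) * 2)%N.
Proof. by split; lia. Qed.

Lemma rint_indic (x y : R) : x <= y ->
  integ (\1_(`[x, y]%classic) : R -> R) /\ rint (\1_(`[x, y]%classic) : R -> R) = y - x.
Proof.
move=> xy; split; first exact: integrable_indic_itv.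
rewrite /rint /Rintegral integral_indic //= setIT lebesgue_measure_itv /= lte_fin.
case: ltP => [//|yx]; have -> : x = y by apply/le_anti/andP.
by rewrite subrr.
Qed.

(** At distance at most [eta / N] from a lattice translate [t0 + a j] well
    inside the box, the sum over translations is close to the Zak transform at
    [t0], and the sum over modulations is a geometric sum of [N] nearly equal
    phases.  So the box sum has size of order [N] on about [N] disjoint
    intervals of length of order [1 / N]. *)
Lemma box_sum_lower v : nice v -> zak a v t0 th != 0 ->
  exists c : R, 0 < c /\ exists N0, forall N, (N0 <= N)%N -> c * N%:R <= n2 (box_sum N v).
Proof.
move=> nv z0; set Z := cmod (zak a v t0 th).
have Z0 : 0 < Z by rewrite cmod_gt0.
have pi0 := @pi_gt0 R.
have [C [C0 hC _]] := lattice_decay a_gt0 (`|t0| + 1) nv.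
have [D [D0 hD]] := zak_lipschitz a_gt0 (`|t0| + 1) nv.
(* small enough for the phases of the geometric sum to stay near 1 *)
pose eta := a / (8 * pi + 1).
have p8 : 0 < 8 * pi + 1 :> R by rewrite addr_gt0 // mulr_gt0.
have eta0 : 0 < eta by rewrite divr_gt0.
have etaa : eta < a.
  by rewrite ltr_pdivrMr // ltr_pMr //; lra.
pose J := (Num.truncn (16 * C / Z)).+1.
have hJ : 4 * C / J%:R <= Z / 4.
  have : 16 * C / Z < J%:R by exact: truncnS_gt.
  rewrite ltr_pdivrMr // => h; rewrite ler_pdivrMr ?ltr0n //; lra.
pose N1 := (Num.truncn (4 * D * eta / Z + eta)).+1.
exists (Z * Num.sqrt (eta / 32)); split; first by rewrite mulr_gt0 // sqrtr_gt0 divr_gt0.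
exists (maxn (4 * J) N1) => N; rewrite geq_max => /andP[NJ NN1].
have [Npos Nhalf] := box_arith (isT : 0 < J)%N NJ.
have N0 : 0 < N%:R :> R by rewrite ltr0n.
have hN : 4 * D * eta / Z + eta < N%:R.
  by rewrite (lt_le_trans (truncnS_gt _)) // ler_nat.
have q0 : 0 <= 4 * D * eta / Z by apply: divr_ge0 (ltW Z0); apply: mulr_ge0 (ltW eta0); apply: mulr_ge0.
have etaN : eta / N%:R <= 1 by rewrite ler_pdivrMr //; lra.
have etaND : D * (eta / N%:R) <= Z / 4.
  have : 4 * D * eta / Z < N%:R by lra.
  rewrite ltr_pdivrMr // => h; rewrite mulrA ler_pdivrMr //; lra.
have LB := L2_box_sum a th tau N (nice_L2 nv).
pose M := (N - 2 * J)%N.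
pose lo (k : 'I_M) : R := t0 + a * (J + k)%:R.
pose Ik (k : 'I_M) := `[lo k, lo k + eta / N%:R]%classic.
have pw k t : t \in Ik k -> (N%:R * Z / 4) ^+ 2 <= cmod (box_sum N v t) ^+ 2.
  rewrite /Ik inE /= in_itv /= => /andP[t1 t2].
  have Nz : 0 <= N%:R * Z / 4 by rewrite divr_ge0 // mulr_ge0 // ltW.
  rewrite ler_pXn2r ?nnegrE ?cmod_ge0 //.
  pose s := t - a * (J + k)%:R.
  have s1 : t0 <= s by rewrite /s; move: t1; rewrite /lo; lra.
  have s2 : s <= t0 + eta / N%:R by rewrite /s; move: t2; rewrite /lo; lra.
  have tE : t = s + a * ((J + k)%N%:Z)%:~R by rewrite /s -pmulrn subrK.
  rewrite /box_sum (orbit_sum_comm th tau a_neq0) orbit_sum_freqE.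
  rewrite {2}tE orbit_sum_time_zak !cmodM cmod_expi mul1r.
  have -> : t / a - tau = (s - t0) / a + ((J + k)%N%:Z)%:~R by rewrite tE; field.
  rewrite geom_sum_period.
  have -> : N%:R * Z / 4 = (N%:R / 2) * (Z / 2) by field.
  apply: ler_pM.
  - by rewrite divr_ge0 // ltW.
  - by rewrite divr_ge0 // ltW.
  - apply: geom_sum_near0; first by rewrite divr_ge0 ?subr_ge0 // ltW.
    have : (s - t0) / a <= (8 * pi + 1)^-1 / N%:R.
      rewrite ler_pdivrMr //; have -> : (8 * pi + 1)^-1 / N%:R * a = eta / N%:R 
        by rewrite /eta mulrAC [_^-1 * a]mulrC.
      lra.
    move=> h; apply: le_trans (ler_wpM2l _ h) _; first by rewrite !mulr_ge0 // ltW.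
    have -> : 8 * pi * N%:R * ((8 * pi + 1)^-1 / N%:R) = 8 * pi / (8 * pi + 1) :> R.
      have cancel (p n q : R) : n != 0 -> p * n * (q / n) = p * q by move=> *; field.
      by rewrite cancel // lt0r_neq0.
    rewrite ler_pdivrMr //; lra.
  have st : `|t0 - s| <= eta / N%:R by rewrite distrC ger0_norm ?subr_ge0 //; lra.
  have sS : `|s| <= `|t0| + 1.
    rewrite -(subrK t0 s) (le_trans (ler_normD _ _)) // addrC lerD2l distrC; lra.
  have := @truncated_zak v s C N J (J + k)%N nv isT (fun i => hC s i sS) _ _.
  move=> /(_ _ (inner_index (ltn_ord k))); rewrite lez_nat leq_addr => /(_ isT).
  have tS : `|t0| <= `|t0| + 1 by rewrite lerDl.
  have := hD t0 s th th tS (le_trans st etaN); rewrite subrr normr0 addr0 => h1 h2.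
  have : D * `|t0 - s| <= D * (eta / N%:R) by rewrite ler_wpM2l.
  move: h1 h2; set z := zak a v s th; set y := \sum_(n < N) _ => h1 h2 h3.
  have : Z <= cmod (zak a v t0 th - z) + (cmod (z - y) + cmod y).
    rewrite /Z; apply: le_trans (lerD (lexx _) (cmodD _ _)).
    by apply: le_trans (cmodD _ _); rewrite !subrK.
  lra.
have ind k : lo k <= lo k + eta / N%:R by rewrite lerDl divr_ge0 // ltW.
have Nz : 0 <= N%:R * Z / 4 by rewrite divr_ge0 // mulr_ge0 // ltW.
have small : eta / N%:R < a.
  by apply: le_lt_trans etaa; rewrite ler_piMr ?(ltW eta0) // invf_le1 // ler1n.
have disj t : \sum_(k < M) (N%:R * Z / 4) ^+ 2 * \1_(Ik k) t <= cmod (box_sum N v t) ^+ 2.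
  have [/existsP[k tk]|/existsPn none] := boolP [exists k, t \in Ik k].
    rewrite (bigD1 k) //= big1 ?addr0 => [|l lk].
      by rewrite indicE tk mulr1; exact: pw tk.
    rewrite indicE; suff /negbTE -> : t \notin Ik l by rewrite mulr0.
    apply: contra lk => tl; move: tk tl.
    rewrite /Ik !inE /= !in_itv /= => /andP[k1 k2] /andP[l1 l2].
    apply/eqP/val_inj => /=.
    have aux (p q : 'I_M) : (p < q)%N -> lo p + eta / N%:R < lo q.
      move=> pq; have : (J + p)%:R + 1 <= (J + q)%:R :> R.
        by rewrite natr1 ler_nat ltn_add2l.
      rewrite /lo; nra.
    case: (ltngtP l k) => // lk; exfalso; [have := aux _ _ lk|have := aux _ _ lk]; lra.
  rewrite big1 => [|k _]; first by rewrite exprn_ge0 ?cmod_ge0.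
  by rewrite indicE (negbTE (none k)) mulr0.
have int1 k : integ (fun t => (N%:R * Z / 4) ^+ 2 * \1_(Ik k) t).
  exact/integZ/(rint_indic (ind k)).1.
have low : \sum_(k < M) (N%:R * Z / 4) ^+ 2 * (eta / N%:R) <= nsq (box_sum N v).
  have -> : \sum_(k < M) (N%:R * Z / 4) ^+ 2 * (eta / N%:R) =
      rint (fun t => \sum_(k < M) (N%:R * Z / 4) ^+ 2 * \1_(Ik k) t).
    rewrite rint_sum // ; apply: eq_bigr => k _.
    have [i1 i2] := rint_indic (ind k).
    by rewrite rintZ // i2 addrC addKr.
  apply: rint_le disj; [exact: integ_sum|exact: L2_integ].
rewrite -(@ler_pXn2r _ 2) ?nnegrE ?n2_ge0 //; last first.
  by rewrite !mulr_ge0 ?sqrtr_ge0 // ltW.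
rewrite n2_sqr; apply: le_trans low.
rewrite sumr_const card_ord -[_ *+ M]mulr_natl.
have M2 : N%:R / 2 <= M%:R :> R.
  by rewrite ler_pdivrMr // -natrM ler_nat.
rewrite !exprMn sqr_sqrtr; last exact: divr_ge0 (ltW eta0) (ler0n _ _).
have -> : Z ^+ 2 * (eta / 32) * N%:R ^+ 2 =
    (N%:R / 2) * (N%:R ^+ 2 * Z ^+ 2 * 4^-1 ^+ 2 * (eta / N%:R)).
  by field; rewrite lt0r_neq0.
apply: ler_wpM2r M2; apply: mulr_ge0; last by rewrite divr_ge0 // ltW.
by apply: mulr_ge0 (sqr_ge0 _); apply: mulr_ge0; exact: sqr_ge0.
Qed.

End LowerBound.

(** * Fejer kernels *)

Section Kernels.
Context {R : realType}.

(** [sin y = y cos c] with [|c| <= y], and [cos] stays above [1/2] near 0;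
    monotonicity carries the bound to the rest of the quarter period. *)
Lemma sin_ge_linear (y : R) : 0 <= y -> y <= pi / 2 -> y / 16 <= sin y.
Proof.
move=> y0 ypi; have pih := @pihalf_lt2 R; have pi2 := @pi_ge2 R.
have half (z : R) : 0 <= z -> z <= 1 / 4 -> z / 2 <= sin z.
  move=> z0 z1; have [->|zn0] := eqVneq z 0; first by rewrite mul0r sin0.
  have zp : 0 < z by rewrite lt_def zn0.
  have [|c] := @MVT_segment R sin cos 0 z z0 (fun x _ => is_derive_sin x).
    by apply: continuous_subspaceT; exact: continuous_sin.
  rewrite in_itv /= sin0 !subr0 => /andP[c0 cz] ->.
  have [d [_ hd]] := mean_value c 0 (@is_derive_cos R).
  have : `|cos c - cos 0| <= c.
    rewrite hd subr0 (ger0_norm c0) ler_piMl // normrN.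
    by rewrite ler_norml sin_geN1 sin_le1.
  rewrite cos0 ler_norml => /andP[h _].
  by rewrite mulrC ler_wpM2r //; lra.
have [y4|y4] := leP y (1 / 4); first by apply: le_trans (half y y0 y4); lra.
apply: le_trans (_ : sin (1 / 4) <= _).
  by apply: le_trans (half _ _ _); lra.
rewrite leNgt ltr_sin ?in_itv /= -?leNgt; [exact: ltW| |]; apply/andP; split; lra.
Qed.

Lemma one_sub_expi (y : R) : cmod (1 - expi (2 * y)) = 2 * `|sin y|.
Proof.
have -> : 1 - expi (2 * y) = (- (2 * sin y))%:C * ('i%C * expi y) :> R[i].
  have -> : 2 * y = y + y by ring.
  rewrite /expi cosD sinD; have := cos2Dsin2 y; rewrite !expr2 => h.
  by apply: complex_eq => /=; lra.
by rewrite !cmodM cmod_expi cmod_real normrN normrM /cmod /= expr0n expr1n add0r sqrtr1 !mulr1 normr_nat.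
Qed.

Lemma expi_gap (x : R) : `|x| <= 1 / 2 -> `|x| <= 8 * cmod (1 - expi (2 * pi * x)).
Proof.
have pi2 := @pi_ge2 R.
have nonneg (y : R) : 0 <= y -> y <= 1 / 2 -> y <= 8 * cmod (1 - expi (2 * pi * y)).
  move=> y0 y2; rewrite -mulrA one_sub_expi.
  have py : 0 <= pi * y by rewrite mulr_ge0 // pi_ge0.
  have := sin_ge_linear py; rewrite ler_pM2l ?pi_gt0 // -[2^-1]mul1r => /(_ y2) h.
  rewrite ger0_norm; last by apply: le_trans h; rewrite divr_ge0.
  have : y <= pi * y / 2 by nra.
  lra.
have [x0|x0] := leP 0 x; first by rewrite ger0_norm //; exact: nonneg.
rewrite ltr0_norm // => hx.
have := nonneg (- x) (ltW (_ : 0 < - x)); rewrite oppr_gt0 => /(_ x0 hx).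
rewrite mulrN -conj_expi -[X in X - cj _](@conjc1 R) -cjB cmod_conj.
exact.
Qed.

Lemma geom_sum_gap N (x : R) : `|x| <= 1 / 2 -> cmod (geom_sum N x) * `|x| <= 16.
Proof.
move=> x2; have := expi_gap x2; have := geom_sum_mul_le N x.
have := cmod_ge0 (geom_sum N x); have := cmod_ge0 (1 - expi (2 * pi * x)).
set p := cmod _; set q := cmod _; nra.
Qed.

Lemma is_derive_sin_scaled (c t0 t : R) : c != 0 ->
  is_derive t (1 : R) (fun t => c^-1 * sin (c * (t - t0))) (cos (c * (t - t0))).
Proof.
move=> c0.
have aff : is_derive t (1 : R) (fun t => c * (t - t0)) c.
  apply: (@is_derive_eq _ _ _ (c \*: (id - cst t0)) t 1 _ (c *: (1 - 0))).
  by rewrite subr0 /GRing.scale /= mulr1.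
have := is_derive1_comp (is_derive_sin _) aff.
move=> h; apply: (@is_derive_eq _ _ _ (c^-1 \*: (sin \o (fun t => c * (t - t0)))) t 1 _
  (c^-1 *: (cos (c * (t - t0)) * c))).
by rewrite /GRing.scale /= mulrCA mulVf // mulr1.
Qed.

Lemma rint_cos_period (c T t0 : R) : 0 < T -> c != 0 -> sin (c * T) = 0 ->
  integ (fun t => \1_(`[t0 - T, t0 + T]%classic) t * cos (c * (t - t0))) /\
  rint (fun t => \1_(`[t0 - T, t0 + T]%classic) t * cos (c * (t - t0))) = 0.
Proof.
move=> T0 c0 sT; set A := `[t0 - T, t0 + T]%classic.
pose F t := c^-1 * sin (c * (t - t0)).
have dF (t : R) : is_derive t (1 : R) F (cos (c * (t - t0))) by exact: is_derive_sin_scaled.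
have cF : continuous F.
  by move=> t; apply: differentiable_continuous; apply/derivable1_diffP; have h := dF t; exact: ex_derive.
have cosc : continuous (fun t : R => cos (c * (t - t0))).
  move=> t; apply: (@continuous_comp _ _ _ (fun t => c * (t - t0)) cos); last exact: continuous_cos.
  by apply: cvgM; [exact: cvg_cst|apply: cvgB; [exact: cvg_id|exact: cvg_cst]].
have le_ab : t0 - T < t0 + T by lra.
have IA : integ (\1_A : R -> R) by apply: (rint_indic _).1; lra.
have mA : measurable_fun setT (\1_A : R -> R) by exact: integ_measurable.
split.
  apply: integ_le IA.
    by apply: measurable_funM => //; exact: continuous_measurable_fun.
  move=> t; rewrite normrM ger0_norm ?ler_piMr //; rewrite ?indicE ?ler0n //.
  by rewrite ler_norml cos_geN1 cos_le1.
have E : (fun t => \1_A t * cos (c * (t - t0))) = (fun t => cos (c * (t - t0))) \_ A.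
  by apply/funext => t; rewrite patchE indicE; case: (t \in A); rewrite ?mul1r ?mul0r.
rewrite E /rint -Rintegral_mkcond /Rintegral.
have := @continuous_FTC2 R (fun t => cos (c * (t - t0))) F _ _ le_ab.
rewrite /A => ->.
- rewrite -EFinB /= /F.
  have -> : c * (t0 + T - t0) = c * T by ring.
  have -> : c * (t0 - T - t0) = - (c * T) by ring.
  by rewrite sinN sT oppr0 mulr0 subrr.
- by apply: continuous_subspaceT.
- split; first by move=> t _; have h := dF t; exact: ex_derive.
  + by apply: cvg_at_right_filter; exact: cF.
  + by apply: cvg_at_left_filter; exact: cF.
- by move=> t _; rewrite derive1E; have h := dF t; rewrite derive_val.
Qed.

End Kernels.

Section FejerWeights.
Context {R : realType}.

Definition fejer_weight (N : nat) (d : int) : R := (N - `|d|)%N%:R / N%:R.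

Lemma fejer_weight_ge0 N d : 0 <= fejer_weight N d.
Proof. by rewrite divr_ge0. Qed.

Lemma fejer_weight_le1 N d : fejer_weight N d <= 1.
Proof.
case: N => [|N]; first by rewrite /fejer_weight invr0 mulr0.
by rewrite ler_pdivrMr ?ltr0n // mul1r ler_nat leq_subr.
Qed.

Lemma fejer_weight_lipschitz N (d e : int) : (0 < N)%N ->
  `|fejer_weight N d - fejer_weight N e| <= `|(d - e)%:~R| / N%:R.
Proof.
move=> N0; rewrite -mulrBl normrM normfV normr_nat.
rewrite ler_pM2r ?invr_gt0 ?ltr0n // -intr_norm !pmulrn -intrB -intr_norm ler_int.
by lia.
Qed.

Lemma fejer_weight_gap N (d : int) : (0 < N)%N ->
  1 - fejer_weight N d <= `|d%:~R| / N%:R.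
Proof.
move=> N0; have := fejer_weight_lipschitz 0 d N0.
rewrite {1}/fejer_weight absz0 subn0 divff ?pnatr_eq0 -?lt0n // sub0r mulrNz normrN.
exact: le_trans (ler_norm _).
Qed.

(** The weight is nonzero only within distance [N] of the origin, and this
    forces [|d|] to be at least half of [|e|]. *)
Lemma fejer_weight_far N (d e : int) : (0 < N)%N ->
  (2 * N <= `|e|)%N -> fejer_weight N (e - d) <= 4 * (`|d%:~R| / `|e%:~R|) ^+ 2.
Proof.
move=> N0 Ne; have e0 : 0 < `|e%:~R| :> R.
  by rewrite -intr_norm ltr0z; lia.
have [far|near] := leqP N `|e - d|.
  rewrite /fejer_weight; have /eqP -> : (N - `|(e - d)%R| == 0)%N by rewrite subn_eq0.
  by rewrite mul0r mulr_ge0 // sqr_ge0.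
apply: le_trans (fejer_weight_le1 _ _) _.
have : `|e%:~R| <= 2 * `|d%:~R| :> R.
  rewrite -!intr_norm -[2]/((2 : int)%:~R) -intrM ler_int; lia.
move=> h; have : 1 / 2 <= `|d%:~R| / `|e%:~R| :> R by rewrite ler_pdivlMr //; lra.
set r := `|d%:~R| / _ => r2.
have : 1 / 2 * (1 / 2) <= r * r by apply: ler_pM; rewrite ?divr_ge0.
by rewrite expr2; lra.
Qed.

(** There are [N - |d|] pairs of indices with difference [d]. *)
Lemma fejer_count (N : nat) (d : int) :
  \sum_(i < N) \sum_(j < N) ((d == (i : nat)%:Z - (j : nat)%:Z)%:R : R) =
  N%:R * fejer_weight N d.
Proof.
have pos (m : nat) : \sum_(i < N) \sum_(j < N)
    ((m%:Z == (i : nat)%:Z - (j : nat)%:Z)%:R : R) = (N - m)%N%:R.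
  rewrite exchange_big /=.
  transitivity (\sum_(j < N) ((m + j < N)%N%:R : R)).
    apply: eq_bigr => j _; have := sum_eq_ord (R := R) N (m + j)%N.
    rewrite ltz_nat /= => <-; apply: eq_bigr => i _; congr (_%:R).
    by rewrite eq_sym subr_eq -PoszD eq_sym.
  rewrite -natr_sum; congr (_%:R).
  rewrite -(big_mkord xpredT (fun j => ((m + j < N)%N : nat))) -big_mkcond /=.
  rewrite sum1_count -size_filter.
  under eq_filter do rewrite -ltn_subRL.
  by rewrite /index_iota subn0 (@filter_iota_ltn 0 N (N - m)%N) ?size_iota ?leq_subr.
have -> : N%:R * fejer_weight N d = (N - `|d|)%N%:R.
  case: N {pos} => [|N]; first by rewrite mul0r sub0n.
  by rewrite /fejer_weight mulrC divfK // pnatr_eq0.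
case: d => m; first exact: pos.
rewrite exchange_big /= -(pos m.+1); apply: eq_bigr => i _; apply: eq_bigr => j _.
by congr (_%:R); rewrite NegzE -eqr_opp opprK opprB.
Qed.

End FejerWeights.

(** * Fejer means of a window *)

Section FejerSums.
Context {R : realType}.

Lemma fejer_countC (N : nat) (d : int) :
  \sum_(i < N) \sum_(j < N) ((d == (i : nat)%:Z - (j : nat)%:Z)%:R : R[i]) =
  (N%:R * fejer_weight N d : R)%:C.
Proof.
rewrite -fejer_count rmorph_sum; apply: eq_bigr => i _; rewrite rmorph_sum.
by apply: eq_bigr => j _; rewrite rmorph_nat.
Qed.

Lemma fejer_usum (x : int -> R[i]) (N : nat) : (0 < N)%N ->
  has_usum (fun d => (fejer_weight N d : R)%:C * x d)
    (N%:R^-1 * \sum_(i < N) \sum_(j < N) x ((i : nat)%:Z - (j : nat)%:Z)).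
Proof.
move=> N0; have N0' : N%:R != 0 :> R[i] by rewrite pnatr_eq0 -lt0n.
have h : has_usum (fun d => \sum_(i < N) \sum_(j < N)
    (d == (i : nat)%:Z - (j : nat)%:Z)%:R * x d)
  (\sum_(i < N) \sum_(j < N) x ((i : nat)%:Z - (j : nat)%:Z)).
  by do 2!(apply: has_usum_sum => ? _); exact: has_usum_delta.
apply: eq_has_usum (has_usumZ N%:R^-1 h) => d.
under eq_bigr do rewrite -mulr_suml; rewrite -mulr_suml fejer_countC rmorphM rmorph_nat.
by rewrite !mulrA mulVf // mul1r.
Qed.

Lemma fejer_usum2 (x : int * int -> R[i]) (N : nat) : (0 < N)%N ->
  has_usum (fun k => (fejer_weight N k.1 * fejer_weight N k.2 : R)%:C * x k)
    (N%:R^-2 * \sum_(i < N) \sum_(j < N) \sum_(m < N) \sum_(n < N)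
      x ((i : nat)%:Z - (j : nat)%:Z, (m : nat)%:Z - (n : nat)%:Z)).
Proof.
move=> N0; have N0' : N%:R != 0 :> R[i] by rewrite pnatr_eq0 -lt0n.
have h : has_usum (fun k : int * int => \sum_(i < N) \sum_(j < N) \sum_(m < N) \sum_(n < N)
    (k == ((i : nat)%:Z - (j : nat)%:Z, (m : nat)%:Z - (n : nat)%:Z))%:R * x k)
  (\sum_(i < N) \sum_(j < N) \sum_(m < N) \sum_(n < N)
      x ((i : nat)%:Z - (j : nat)%:Z, (m : nat)%:Z - (n : nat)%:Z)).
  by do 4!(apply: has_usum_sum => ? _); exact: has_usum_delta.
apply: (eq_has_usum _ (has_usumZ (N%:R^-2 : R[i]) h)) => -[d e] /=.
have -> : \sum_(i < N) \sum_(j < N) \sum_(m < N) \sum_(n < N)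
    ((d, e) == ((i : nat)%:Z - (j : nat)%:Z, (m : nat)%:Z - (n : nat)%:Z))%:R * x (d, e) =
    (N%:R * fejer_weight N d : R)%:C * ((N%:R * fejer_weight N e : R)%:C * x (d, e)).
  rewrite -!fejer_countC mulr_suml; apply: eq_bigr => i _.
  rewrite mulr_suml; apply: eq_bigr => j _.
  rewrite mulr_suml mulr_sumr; apply: eq_bigr => m _.
  rewrite mulr_suml mulr_sumr; apply: eq_bigr => n _.
  by rewrite xpair_eqE -mulnb natrM mulrA.
by rewrite !rmorphM !rmorph_nat; field.
Qed.

End FejerSums.

Section RealProducts.
Context {R : realType}.
Implicit Types (f g p q : R -> R[i]).

Lemma inner_le_rint f g : L2 f -> L2 g ->
  cmod (inner f g) <= 2 * rint (fun t => cmod (f t) * cmod (g t)).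
Proof.
move=> Lf Lg; have [hr hi] := inner_integ Lf Lg; have hm := L2_mul_integ Lf Lg.
apply: le_trans (cmod_le_ReIm _) _; rewrite innerE mulr_natl mulr2n.
have aux (u : R -> R) : integ u -> (forall t, `|u t| <= cmod (f t) * cmod (g t)) ->
    `|rint u| <= rint (fun t => cmod (f t) * cmod (g t)).
  move=> iu hu; apply: le_trans (rint_abs iu) _.
  by apply: rint_le => //; exact: (integrable_norm iu).
by apply: lerD; apply: aux => // t; rewrite -(cmod_conj (g t)) -cmodM ?Re_le_cmod ?Im_le_cmod.
Qed.

Lemma rint_mul_le p q : L2 p -> L2 q ->
  rint (fun t => cmod (p t) * cmod (q t)) <= n2 p * n2 q.
Proof.
move=> Lp Lq.
have abs (u : R -> R[i]) : L2 u -> L2 (fun t => (cmod (u t))%:C).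
  move=> Lu; apply: (L2_le _ _ Lu); first exact: (cmeas_real (cmeas_cmod (L2_meas Lu))).
  by move=> t; rewrite cmod_real ger0_norm ?cmod_ge0.
have n2abs (u : R -> R[i]) : n2 (fun t => (cmod (u t))%:C) = n2 u.
  by apply: eq_n2 => t; rewrite cmod_real ger0_norm ?cmod_ge0.
have := cauchy_schwarz (abs _ Lp) (abs _ Lq); rewrite !n2abs.
apply: le_trans; apply: le_trans (le_trans (ler_norm _) (Re_le_cmod _)).
have e t : cmod (p t) * cmod (q t) =
    complex.Re ((cmod (p t))%:C * cj (cmod (q t))%:C).
  by rewrite conjc_real cReM /= mulr0 subr0.
by rewrite (eq_rint e) innerE.
Qed.

(** A pointwise majorant moves a kernel from one factor to the other.  The
    constant 2 comes from treating real and imaginary parts separately. *)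
Lemma inner_majorant f g p q : L2 f -> L2 g -> L2 p -> L2 q ->
  (forall t, cmod (f t) * cmod (g t) <= cmod (p t) * cmod (q t)) ->
  cmod (inner f g) <= 2 * (n2 p * n2 q).
Proof.
move=> Lf Lg Lp Lq h; apply: le_trans (inner_le_rint Lf Lg) _.
rewrite ler_wpM2l //; apply: le_trans (rint_mul_le Lp Lq).
by apply: rint_le; [exact: L2_mul_integ|exact: L2_mul_integ|].
Qed.

End RealProducts.

Section FejerMeans.
Context {R : realType} (a th t0 : R).
Hypothesis a_gt0 : 0 < a.
Local Notation tau := (t0 / a).
Local Notation twist := (twist a th tau).
Local Notation avg_kernel := (avg_kernel a tau).
Variables (v : R -> R[i]).
Hypothesis nv : nice v.

Let a_neq0 : a != 0. Proof. exact: lt0r_neq0. Qed.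

Definition fejer_time N (t : R) : R[i] :=
  N%:R^-1 * \sum_(i < N) \sum_(j < N)
    (expi (- (th * ((i : nat)%:Z - (j : nat)%:Z)%:~R)) *
     v (t - a * ((i : nat)%:Z - (j : nat)%:Z)%:~R)).

(** The Fejer mean of the series of all [twist k v] ([fejer_meanE]), factored into the Fejer kernel of the modulations and the
    Fejer mean of the Zak series. *)
Definition fejer_mean N (t : R) : R[i] :=
  (cmod (geom_sum N (t / a - tau)) ^+ 2 / N%:R)%:C * fejer_time N t.

Lemma fejer_meanE N : (0 < N)%N -> fejer_mean N = fun t =>
  N%:R^-2 * \sum_(i < N) \sum_(j < N) \sum_(m < N) \sum_(n < N)
    twist ((i : nat)%:Z - (j : nat)%:Z, (m : nat)%:Z - (n : nat)%:Z) v t.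
Proof.
move=> N0; have N0' : N%:R != 0 :> R by rewrite pnatr_eq0 -lt0n.
have N0C : N%:R != 0 :> R[i] by rewrite pnatr_eq0 -lt0n.
apply/funext => t; set x := t / a - tau.
have -> : \sum_(i < N) \sum_(j < N) \sum_(m < N) \sum_(n < N)
    twist ((i : nat)%:Z - (j : nat)%:Z, (m : nat)%:Z - (n : nat)%:Z) v t =
  (geom_sum N x * cj (geom_sum N x)) * \sum_(i < N) \sum_(j < N)
    (expi (- (th * ((i : nat)%:Z - (j : nat)%:Z)%:~R)) *
     v (t - a * ((i : nat)%:Z - (j : nat)%:Z)%:~R)).
  rewrite mulr_sumr; apply: eq_bigr => i _; rewrite mulr_sumr; apply: eq_bigr => j _.
  rewrite /geom_sum cj_sum mulr_suml mulr_suml; apply: eq_bigr => m _.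
  rewrite mulr_sumr mulr_suml; apply: eq_bigr => n _.
  rewrite conj_expi -expiD mulrA -expiD /twist; congr (expi _ * _).
  by rewrite /x [fst _]/= [snd _]/= intrB -!pmulrn; ring.
rewrite mul_conj /fejer_mean /fejer_time -/x rmorphM fmorphV rmorph_nat; field.
exact: N0C.
Qed.

Lemma L2_fejer_mean N : (0 < N)%N -> L2 (fejer_mean N).
Proof.
move=> N0; rewrite fejer_meanE //; apply: L2Z.
by do 4!(apply: L2_sum => ? _); apply: L2_twist; exact: nice_L2.
Qed.

Lemma inner_fejer_mean N g (b : int * int -> R[i]) : L2 g -> (0 < N)%N ->
  (forall k, b k = inner g (twist k v)) ->
  has_usum (fun k => (fejer_weight N k.1 * fejer_weight N k.2 : R)%:C * b k)
    (inner g (fejer_mean N)).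
Proof.
move=> Lg N0 bE; have Lv := nice_L2 nv.
have Lt k : L2 (twist k v) by exact: L2_twist.
have := fejer_usum2 b N0; congr has_usum.
rewrite fejer_meanE // innerZr //; last by do 4!(apply: L2_sum => ? _).
congr (_ * _); first by rewrite conjc_inv rmorphXn /= conjc_nat.
do 4!(rewrite inner_sumr; [apply: eq_bigr => ? _|
  by move=> ? _; do ?(apply: L2_sum => ? _); exact: Lt|exact: Lg]).
by rewrite bE.
Qed.

(** The first moment of the coefficients bounds the Fejer error. *)
Lemma fejer_mean_close N g (b : int * int -> R[i]) (B : R[i]) (K : R) :
  L2 g -> (0 < N)%N -> (forall k, b k = inner g (twist k v)) ->
  (forall A : {fset int * int},
     \sum_(k <- A) cmod (b k) * (1 + `|k.1%:~R| + `|k.2%:~R|) <= K) ->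
  has_usum b B -> cmod (B - inner g (fejer_mean N)) <= K / N%:R.
Proof.
move=> Lg N0 bE bK bB; have Np : 0 < N%:R :> R by rewrite ltr0n.
rewrite [leRHS]mulrC; apply: (has_usum_le _ (sum_scale_le _ bK)
  (has_usumB bB (inner_fejer_mean Lg N0 bE))); last by rewrite invr_ge0 ltW.
move=> k; rewrite -{1}(mul1r (b k)) -mulrBl cmodM [leRHS]mulrCA [leLHS]mulrC ler_wpM2l ?cmod_ge0 //.
have w1 := fejer_weight_le1 (R := R) N k.1; have w2 := fejer_weight_le1 (R := R) N k.2.
have p1 := fejer_weight_ge0 (R := R) N k.1; have p2 := fejer_weight_ge0 (R := R) N k.2.
have g1 := fejer_weight_gap (R := R) k.1 N0; have g2 := fejer_weight_gap (R := R) k.2 N0.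
rewrite -[1]/((1 : R)%:C) -rmorphB cmod_real ger0_norm; last by nra.
rewrite [leRHS]mulrC !mulrDl mul1r.
have : 0 <= N%:R^-1 :> R by rewrite invr_ge0 ltW.
have : 0 <= (1 - fejer_weight N k.1) * (1 - fejer_weight N k.2) :> R.
  by rewrite mulr_ge0 // subr_ge0.
move: g1 g2; set u := fejer_weight N k.1; set w := fejer_weight N k.2.
lra.
Qed.

Lemma fejer_time_usum N (s : R) (j : int) : (0 < N)%N ->
  has_usum (fun i => (fejer_weight N (j - i) : R)%:C *
      (expi (- (th * j%:~R)) * zak_term a v s th i))
    (fejer_time N (s + a * j%:~R)).
Proof.
move=> N0.
have := fejer_usum (fun d => expi (- (th * d%:~R)) * v (s + a * j%:~R - a * d%:~R)) N0.
have inv : involutive (fun i : int => j - i) by move=> i; rewrite subKr.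
move=> /(has_usum_reindex inv inv); apply: eq_has_usum => i; congr (_ * _).
rewrite /zak_term mulrCA -expiD mulrC intrB; congr (v _ * expi _); ring.
Qed.

(** The weights are Lipschitz with constant [1 / N], so replacing all of them
    by their value at [j] costs a first moment of the window over [N]; what
    remains is the Zak series. *)
Lemma fejer_time_near N (s C : R) (j : int) : (0 < N)%N ->
  (forall i : int, cmod (v (s + a * i%:~R)) * (1 + `|i%:~R|) ^+ 4 <= C) ->
  cmod (fejer_time N (s + a * j%:~R)) <= 4 * C / N%:R + cmod (zak a v s th).
Proof.
move=> N0 hC; have Np : 0 < N%:R :> R by rewrite ltr0n.
have C0 : 0 <= C.
  by apply: le_trans (hC 0); rewrite mulr_ge0 ?cmod_ge0 // exprn_ge0 // addr_ge0.
set e := expi (- (th * j%:~R)); set w := (fejer_weight N j : R)%:C.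
have h1 := fejer_time_usum s j N0.
have h2 := has_usumZ (w * e) (zakP a_gt0 s th nv).
have -> : fejer_time N (s + a * j%:~R) =
  (fejer_time N (s + a * j%:~R) - w * e * zak a v s th) + w * e * zak a v s th.
  by rewrite subrK.
apply: le_trans (cmodD _ _) _; apply: lerD; last first.
  rewrite !cmodM cmod_expi mulr1 cmod_real ger0_norm ?fejer_weight_ge0 //.
  by rewrite ler_piMl ?cmod_ge0 ?fejer_weight_le1.
rewrite [leRHS]mulrC; apply: (has_usum_le (y := fun i : int => N%:R^-1 *
  (cmod (v (s + a * i%:~R)) * `|i%:~R|))) (has_usumB h1 h2) => [i|].
  rewrite -/e mulrA -mulrBl -mulrBl cmodM cmod_zak_term cmodM cmod_expi mulr1.
  rewrite -rmorphB cmod_real [leLHS]mulrC [leRHS]mulrCA ler_wpM2l ?cmod_ge0 // [leRHS]mulrC.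
  apply: le_trans (fejer_weight_lipschitz _ _ N0) _.
  by rewrite addrAC subrr add0r mulrNz normrN.
apply: sum_scale_le; first by rewrite invr_ge0 ltW.
apply: sum_weight_le => // i; apply: le_trans (hC i).
rewrite -mulrA ler_wpM2l ?cmod_ge0 // (_ : 4%N = (2 + 2)%N) // exprD.
rewrite ler_wpM2r ?sqr_ge0 //; have := normr_ge0 (i%:~R : R).
by rewrite expr2; nra.
Qed.

(** Far outside the box the weights only reach the tail of the window. *)
Lemma fejer_time_far N (s C : R) (j : int) : (0 < N)%N -> (2 * N <= `|j|)%N ->
  (forall i : int, cmod (v (s + a * i%:~R)) * (1 + `|i%:~R|) ^+ 4 <= C) ->
  cmod (fejer_time N (s + a * j%:~R)) <= 16 * C / `|j%:~R| ^+ 2.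
Proof.
move=> N0 Nj hC.
have C0 : 0 <= C.
  by apply: le_trans (hC 0); rewrite mulr_ge0 ?cmod_ge0 // exprn_ge0 // addr_ge0.
have -> : 16 * C / `|j%:~R| ^+ 2 = (4 / `|j%:~R| ^+ 2) * (4 * C) by ring.
apply: (has_usum_le (y := fun i : int => (4 / `|j%:~R| ^+ 2) *
  (cmod (v (s + a * i%:~R)) * `|i%:~R| ^+ 2))) (fejer_time_usum s j N0) => [i|].
  rewrite mulrA cmodM cmod_zak_term cmodM cmod_expi mulr1 cmod_real ger0_norm ?fejer_weight_ge0 //.
  rewrite [leLHS]mulrC [leRHS]mulrCA ler_wpM2l ?cmod_ge0 //.
  apply: le_trans (fejer_weight_far _ N0 Nj) _.
  by rewrite exprMn exprVn [X in 4 * X]mulrC mulrA.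
apply: sum_scale_le; first by rewrite divr_ge0 // sqr_ge0.
apply: sum_weight_le => // i; apply: le_trans (hC i).
rewrite -mulrA ler_wpM2l ?cmod_ge0 // (_ : 4%N = (2 + 2)%N) // exprD.
rewrite ler_wpM2r ?sqr_ge0 // ler_pXn2r ?nnegrE // ?addr_ge0 //.
by rewrite lerDr.
Qed.

End FejerMeans.

(** * Zeros of the Zak transform are zeros of the symbol *)

Section ZeroTransfer.
Context {R : realType} (a th t0 : R).
Hypothesis a_gt0 : 0 < a.
Local Notation tau := (t0 / a).
Local Notation twist := (twist a th tau).
Local Notation akern := (avg_kernel a tau).
Variables (v : R -> R[i]).
Hypothesis nv : nice v.
Hypothesis zak0 : zak a v t0 th = 0.
Local Notation fmean := (fejer_mean a th t0 v).

Let a_neq0 : a != 0. Proof. exact: lt0r_neq0. Qed.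

Lemma lattice_round (t : R) : exists j : int, exists x : R,
  [/\ `|x| <= 1 / 2, (t - t0) / a = x + j%:~R & t = (t0 + a * x) + a * j%:~R].
Proof.
exists (Num.floor ((t - t0) / a + 1 / 2)); set j := Num.floor _.
exists ((t - t0) / a - j%:~R).
have /andP[h1 h2] := floor_itv ((t - t0) / a + 1 / 2); rewrite -/j intrD in h1 h2.
split; first by rewrite ler_norml; apply/andP; split; lra.
  by rewrite subrK.
by field.
Qed.

(** The Zak transform vanishes to first order at [t0], which compensates the
    pole of the geometric sums there. *)
Lemma fejer_mean_bounds : exists E : R, [/\ 0 <= E,
  forall N t, (0 < N)%N -> cmod (fmean N t) <= E * akern N t &
  forall N t, (0 < N)%N -> 4 * a * N%:R <= `|t - t0| ->
    cmod (fmean N t) <= E / `|t - t0| ].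
Proof.
have [C [C0 hC _]] := lattice_decay a_gt0 (`|t0| + a) nv.
have [D [D0 hD]] := zak_lipschitz a_gt0 `|t0| nv.
have sS (x : R) : `|x| <= 1 / 2 -> `|t0 + a * x| <= `|t0| + a.
  move=> x2; apply: le_trans (ler_normD _ _) _; rewrite lerD2l normrM (gtr0_norm a_gt0).
  by rewrite ler_piMr ?(ltW a_gt0) //; lra.
have zb (x : R) : `|x| <= 1 / 2 -> cmod (zak a v (t0 + a * x) th) <= (D + 4 * C) * (a * `|x|).
  move=> x2; have ax : `|t0 - (t0 + a * x)| = a * `|x|.
    by rewrite opprD addrA subrr sub0r normrN normrM (gtr0_norm a_gt0).
  have ax0 : 0 <= a * `|x| by rewrite mulr_ge0 // ltW.
  have [near|far] := leP (a * `|x|) 1.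
    have := hD t0 (t0 + a * x) th th (lexx _); rewrite ax zak0 subrr normr0 addr0 sub0r cmodN.
    by move=> /(_ near) h; apply: le_trans h _; rewrite ler_wpM2r // lerDl mulr_ge0.
  apply: le_trans (_ : 4 * C <= _); last by nra.
  apply: (has_usum_le (y := fun i : int => cmod (v (t0 + a * x + a * i%:~R)))) (zakP a_gt0 _ th nv) => [i|].
    by rewrite cmod_zak_term.
  apply: sum_weight_le => // i; apply: le_trans (hC _ i (sS x x2)).
  by rewrite ler_wpM2l ?cmod_ge0 // ler_weXn2l // lerDl.
have C16 : 0 <= 16 * C * a by rewrite !mulr_ge0 // ltW.
have DC : 0 <= 16 * (D + 4 * C) * a by rewrite !mulr_ge0 ?addr_ge0 ?mulr_ge0 // ltW.
exists (4 * C + 16 * (D + 4 * C) * a + 16 * C * a); split.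
- lra.
- move=> N t N0; have Np : 0 < N%:R :> R by rewrite ltr0n.
  have [j [x [x2 tx tE]]] := lattice_round t.
  have gE : geom_sum N (t / a - tau) = geom_sum N x.
    by rewrite -mulrBl tx geom_sum_period.
  rewrite /fejer_mean cmodM cmod_real ger0_norm; last by rewrite divr_ge0 // sqr_ge0.
  rewrite /avg_kernel gE {1}tE.
  have W := fejer_time_near th a_gt0 nv j N0 (fun i => hC _ i (sS x x2)).
  have Z := zb x x2; have gap := geom_sum_gap N x2; have gN := geom_sum_le N x.
  have g0 := cmod_ge0 (geom_sum N x).
  set G := cmod (geom_sum N x) in gap gN g0 *; set W' := cmod (fejer_time _ _ _ _ _) in W *.
  have W1 : W' <= 4 * C / N%:R + (D + 4 * C) * (a * `|x|) by apply: le_trans W _; rewrite lerD2l.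
  have -> : G ^+ 2 / N%:R * W' = (G * W') * (G / N%:R) by ring.
  rewrite ler_wpM2r ?divr_ge0 //.
  apply: le_trans (ler_wpM2l g0 W1) _; rewrite mulrDr -!addrA lerD //.
    by rewrite mulrCA ler_piMr ?mulr_ge0 // ler_pdivrMr // mul1r.
  apply: le_trans (_ : (D + 4 * C) * a * 16 <= _); last first.
    by apply: le_trans (_ : 16 * (D + 4 * C) * a <= _); [rewrite le_eqVlt; apply/orP; left; apply/eqP; ring|lra].
  have -> : G * ((D + 4 * C) * (a * `|x|)) = (D + 4 * C) * a * (G * `|x|) by ring.
  by rewrite ler_wpM2l // mulr_ge0 ?addr_ge0 ?mulr_ge0 // ltW.
- move=> N t N0 far; have Np : 0 < N%:R :> R by rewrite ltr0n.
  have N1 : 1 <= N%:R :> R by rewrite ler1n.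
  have [j [x [x2 tx tE]]] := lattice_round t.
  rewrite /fejer_mean cmodM cmod_real ger0_norm; last by rewrite divr_ge0 // sqr_ge0.
  have xj : 4 * N%:R <= `|x + j%:~R|.
    rewrite -tx normrM normfV (gtr0_norm a_gt0) ler_pdivlMr //; lra.
  have xj' := ler_normD x (j%:~R : R).
  have jN : 2 * N%:R <= `|j%:~R| :> R by lra.
  have jN' : (2 * N <= `|j|)%N.
    by rewrite -(ler_nat R) natrM natr_absz intr_norm.
  have W := fejer_time_far th N0 jN' (fun i => hC _ i (sS x x2)).
  rewrite -tE in W.
  have gN := geom_sum_le N (t / a - tau).
  have jp : 0 < `|j%:~R| :> R by lra.
  have tp : 0 < `|t - t0|.
    by apply: lt_le_trans far; rewrite !mulr_gt0.
  have h1 : cmod (geom_sum N (t / a - tau)) ^+ 2 / N%:R <= N%:R.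
    by rewrite ler_pdivrMr // -expr2 ler_pXn2r ?nnegrE ?cmod_ge0 ?(ltW Np).
  apply: le_trans (ler_pM _ _ h1 W) _; rewrite ?cmod_ge0 ?divr_ge0 ?sqr_ge0 //.
  have tj : `|t - t0| <= 2 * a * `|j%:~R|.
    have -> : t - t0 = a * (x + j%:~R) by rewrite -tx; field.
    rewrite normrM (gtr0_norm a_gt0) [2 * a]mulrC -mulrA ler_wpM2l ?(ltW a_gt0) //; lra.
  rewrite ler_pdivlMr //.
  apply: le_trans (_ : N%:R * (16 * C / `|j%:~R| ^+ 2) * (2 * a * `|j%:~R|) <= _).
    by rewrite ler_wpM2l // mulr_ge0 ?divr_ge0 ?mulr_ge0 ?sqr_ge0 // ltW.
  have -> : N%:R * (16 * C / `|j%:~R| ^+ 2) * (2 * a * `|j%:~R|) =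
      (2 * N%:R / `|j%:~R|) * (16 * C * a) by field; exact: lt0r_neq0.
  apply: le_trans (_ : 1 * (16 * C * a) <= _); last by rewrite mul1r; lra.
  by rewrite ler_wpM2r // ler_pdivrMr // mul1r.
Qed.

(** Orthogonality of the exponentials over [2 M] full periods. *)
Lemma geom_sum_sqr_rint (N M : nat) : (0 < M)%N ->
  let A := `[t0 - a * M%:R, t0 + a * M%:R]%classic in
  integ (fun t => \1_A t * cmod (geom_sum N (t / a - tau)) ^+ 2) /\
  rint (fun t => \1_A t * cmod (geom_sum N (t / a - tau)) ^+ 2) = N%:R * (2 * a * M%:R).
Proof.
move=> M0 A; have T0 : 0 < a * M%:R by rewrite mulr_gt0 // ltr0n.
have [IA rA] : integ (\1_A : R -> R) /\ rint (\1_A : R -> R) = 2 * a * M%:R.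
  by have [|h1 ->] := @rint_indic R (t0 - a * M%:R) (t0 + a * M%:R); [lra|split => //; ring].
pose c (m n : 'I_N) : R := 2 * pi * ((m : nat)%:Z - (n : nat)%:Z)%:~R / a.
have sqE (t : R) : \1_A t * cmod (geom_sum N (t / a - tau)) ^+ 2 =
    \sum_(m < N) \sum_(n < N) \1_A t * cos (c m n * (t - t0)).
  have -> : cmod (geom_sum N (t / a - tau)) ^+ 2 =
      complex.Re (geom_sum N (t / a - tau) * cj (geom_sum N (t / a - tau))).
    by rewrite mul_conj.
  rewrite /geom_sum cj_sum mulr_suml; under eq_bigr do rewrite mulr_sumr.
  under [RHS]eq_bigr do rewrite -mulr_sumr; rewrite -mulr_sumr; congr (_ * _).
  have ReS (F : 'I_N -> R[i]) : complex.Re (\sum_(m < N) F m) = \sum_(m < N) complex.Re (F m).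
    by elim/big_rec2: _ => // m x y _ <-; rewrite cReD.
  rewrite ReS; apply: eq_bigr => m _; rewrite ReS; apply: eq_bigr => n _.
  rewrite conj_expi -expiD /=; congr cos.
  by rewrite /c intrB -!pmulrn; field.
have piece m n : integ (fun t => \1_A t * cos (c m n * (t - t0))) /\
    rint (fun t => \1_A t * cos (c m n * (t - t0))) = (m == n)%:R * (2 * a * M%:R).
  have [->|mn] := eqVneq m n.
    have E : (fun t => \1_A t * cos (c n n * (t - t0))) = (\1_A : R -> R).
      by apply/funext => t; rewrite /c subrr mulr0z mulr0 !mul0r cos0 mulr1.
    by rewrite E mul1r.
  have cn0 : c m n != 0.
    rewrite /c !mulf_neq0 ?invr_eq0 //; last by rewrite intr_eq0 subr_eq0 eqz_nat.
    exact: lt0r_neq0 (pi_gt0 R).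
  have := rint_cos_period t0 T0 cn0; rewrite mul0r; apply.
  have := expi2pi_int (R := R) (((m : nat)%:Z - (n : nat)%:Z) * M%:Z) => -[_].
  congr (sin _ = _); rewrite /c intrM -[M%:Z%:~R]pmulrn; field.
  exact: a_neq0.
rewrite (funext sqE).
split; first by do 2!(apply: integ_sum => ? _); exact: (piece _ _).1.
rewrite rint_sum => [|m _]; last by apply: integ_sum => n _; exact: (piece _ _).1.
transitivity (\sum_(m < N) (2 * a * M%:R)); last by rewrite sumr_const card_ord [RHS]mulr_natl.
apply: eq_bigr => m _; rewrite rint_sum => [|n _]; last exact: (piece _ _).1.
rewrite (bigD1 m) //= (piece m m).2 eqxx mul1r big1 ?addr0 // => n nm.
by rewrite (piece m n).2 eq_sym (negbTE nm) mul0r.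
Qed.

(** Within [4 N] periods of [t0] the bound by [avg_kernel] is square integrable
    by orthogonality; beyond, the bound by the inverse distance is. *)
Lemma fejer_mean_norm : exists C : R, 0 <= C /\
  forall N, (0 < N)%N -> n2 (fmean N) <= C.
Proof.
have [E [E0 h1 h2]] := fejer_mean_bounds.
pose P := rint (fun t : R => (1 + (t - t0) ^+ 2)^-1).
have IP : integ (fun t : R => (1 + (t - t0) ^+ 2)^-1) by exact: (integ_shift t0 (@integ_oneDsqr R)).
have pos (t : R) : 0 < 1 + (t - t0) ^+ 2 by rewrite ltr_pwDl // sqr_ge0.
have P0 : 0 <= P by apply: rint_ge0 => t; rewrite invr_ge0 ltW.
pose m := E ^+ 2 * (1 + (16 * a ^+ 2)^-1).
have a2 : 0 < 16 * a ^+ 2 by rewrite mulr_gt0 // exprn_gt0.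
have m0 : 0 <= m by rewrite mulr_ge0 ?sqr_ge0 // addr_ge0 // invr_ge0 ltW.
have big0 : 0 <= 8 * a * E ^+ 2 + m * P.
  apply: addr_ge0 (mulr_ge0 m0 P0); apply: mulr_ge0 (sqr_ge0 _).
  exact: mulr_ge0 (ler0n _ 8) (ltW a_gt0).
exists (Num.sqrt (8 * a * E ^+ 2 + m * P)); split; first exact: sqrtr_ge0.
move=> N N0; rewrite ler_wsqrtr //.
have Np : 0 < N%:R :> R by rewrite ltr0n.
have M0 : (0 < 4 * N)%N by rewrite muln_gt0.
have [IG rG] := geom_sum_sqr_rint N M0.
set A := `[_, _]%classic in IG rG.
have LY := L2_fejer_mean a th t0 nv N0.
have -> : 8 * a * E ^+ 2 + m * P = rint (fun t =>
   (E ^+ 2 / N%:R ^+ 2) * (\1_A t * cmod (geom_sum N (t / a - tau)) ^+ 2) +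
   m * (1 + (t - t0) ^+ 2)^-1).
  rewrite rintD; [|exact: integZ|exact: integZ]; rewrite !rintZ // rG -/P natrM; congr (_ + _).
  by field; exact: lt0r_neq0.
apply: rint_le => [||t]; [exact: L2_integ|by apply: integD; exact: integZ|].
have q0 : 0 <= (E ^+ 2 / N%:R ^+ 2) * (\1_A t * cmod (geom_sum N (t / a - tau)) ^+ 2).
  by rewrite mulr_ge0 ?divr_ge0 ?sqr_ge0 // mulr_ge0 ?sqr_ge0 // indicE.
have r0 : 0 <= m * (1 + (t - t0) ^+ 2)^-1 by rewrite mulr_ge0 // invr_ge0 ltW.
have [tA|tA] := boolP (t \in A).
  apply: le_trans (_ : (E ^+ 2 / N%:R ^+ 2) * (\1_A t * cmod (geom_sum N (t / a - tau)) ^+ 2) <= _); last by rewrite lerDl.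
  have -> : (E ^+ 2 / N%:R ^+ 2) * (\1_A t * cmod (geom_sum N (t / a - tau)) ^+ 2) =
      (E * akern N t) ^+ 2.
    by rewrite indicE tA mul1r /avg_kernel; field; exact: lt0r_neq0.
  rewrite ler_pXn2r ?nnegrE ?cmod_ge0 ?(mulr_ge0 E0 (avg_kernel_ge0 _ _ _ _)) //.
  exact: h1.
apply: le_trans (_ : m * (1 + (t - t0) ^+ 2)^-1 <= _); last by rewrite lerDr.
have far : 4 * a * N%:R <= `|t - t0|.
  rewrite leNgt; apply: contra tA; rewrite /A inE /= in_itv /= natrM ltr_norml => /andP[l1 l2].
  by apply/andP; split; lra.
have tp : 0 < `|t - t0| by apply: lt_le_trans far; rewrite !mulr_gt0.
apply: le_trans (_ : (E / `|t - t0|) ^+ 2 <= _).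
  by rewrite ler_pXn2r ?nnegrE ?cmod_ge0 ?divr_ge0 // h2.
have u2 : 16 * a ^+ 2 <= (t - t0) ^+ 2.
  rewrite -[leRHS]real_normK ?num_real //.
  have N1 : 1 <= N%:R :> R by rewrite ler1n.
  have -> : 16 * a ^+ 2 = (4 * a) ^+ 2 by rewrite exprMn; congr (_ * _); rewrite -natrX.
  have a4 : 0 <= 4 * a by rewrite mulr_ge0 // ltW.
  rewrite ler_pXn2r ?nnegrE //; apply: le_trans far; rewrite ler_peMr //.
rewrite exprMn exprVn real_normK ?num_real // /m -[leRHS]mulrA ler_wpM2l ?sqr_ge0 //.
set w := (t - t0) ^+ 2 in u2 *.
have w0 : 0 < w := lt_le_trans a2 u2.
rewrite ler_pdivlMr; last exact: pos.
have -> : w^-1 * (1 + w) = 1 + w^-1 by field; exact: lt0r_neq0.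
by rewrite lerD2l lef_pV2.
Qed.

(** Paired with [g], the Fejer means of the window are Fejer sums of [b], so
    they tend to [B].  They also tend to 0: they are bounded in L2, and on a
    bounded set they are dominated by [avg_kernel], which tends to 0 almost
    everywhere.  No pointwise value of the Zak transform of [g] enters. *)
Lemma zak_zero_transfer g (b : int * int -> R[i]) (B : R[i]) (K : R) : L2 g ->
  (forall k, b k = inner g (twist k v)) ->
  (forall A : {fset int * int},
     \sum_(k <- A) cmod (b k) * (1 + `|k.1%:~R| + `|k.2%:~R|) <= K) ->
  has_usum b B -> B = 0.
Proof.
move=> Lg bE bK bB; apply/eqP; rewrite -cmod_eq0 eq_le cmod_ge0 andbT.
have K0 : 0 <= K by have := bK fset0; rewrite big_seq_fset0.
apply/ler_addgt0Pl => e e0; rewrite addr0.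
have [E [E0 hE _]] := fejer_mean_bounds.
have [C [C0 hC]] := fejer_mean_norm.
have e4 : 0 < e / 4 by rewrite divr_gt0.
have C1 : 0 < C + 1 by lra.
have [rho [rho0 hrho]] := tail_small Lg (divr_gt0 e4 C1).
pose q (t : R) : R[i] := ((`|t| <= rho)%R%:R * E : R)%:C.
have Lq : L2 q.
  have [|I1 _] := @rint_indic R (- rho) rho; first lra.
  apply/L2P; split.
    apply: cmeas_real; apply: measurable_funM => //.
    by apply: measurable_bool_real; exact: measurable_norm_le.
  apply: eq_integrable (integZ (E ^+ 2) I1) => // t _.
  rewrite /comp cmod_real indicE real_normK ?num_real // exprMn mulrC; congr (_ * _)%:E.
  have -> : (t \in `[(- rho), rho]%classic) = (`|t| <= rho)%R by rewrite ler_norml; apply/idP/idP; rewrite inE /= in_itv.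
  by case: (_ <= _); rewrite ?expr1n ?expr0n.
have q1 : 0 < n2 q + 1 by rewrite ltr_wpDl // n2_ge0.
have [N0 hN0] := avg_kernel_small tau a_gt0 Lg (divr_gt0 e4 (mulr_gt0 (ltr0n R 2) q1)).
pose N := maxn N0 (Num.truncn (4 * K / e)).+1.
have Npos : (0 < N)%N by rewrite leq_max orbT.
have Np : 0 < N%:R :> R by rewrite ltr0n.
have KN : K / N%:R <= e / 4.
  have : 4 * K / e < N%:R.
    by rewrite (lt_le_trans (truncnS_gt _)) // ler_nat leq_maxr.
  rewrite ltr_pdivrMr // => h; rewrite ler_pdivrMr //; lra.
have LY := L2_fejer_mean a th t0 nv Npos.
have Ltr := L2_trunc rho Lg; have Lta := L2_tail rho Lg.
have close := fejer_mean_close nv Lg Npos bE bK bB.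
have LA : L2 (fun t => (akern N t)%:C * g t).
  apply: L2_mul_le1 => //; first exact: measurable_avg_kernel.
  by move=> t; rewrite ger0_norm ?avg_kernel_ge0 ?avg_kernel_le1.
have splitE : inner g (fmean N) = inner (trunc rho g) (fmean N) + inner (tail rho g) (fmean N).
  by rewrite {1}(trunc_tail rho g) innerDl.
have part1 : cmod (inner (trunc rho g) (fmean N)) <= e / 4.
  have : cmod (inner (trunc rho g) (fmean N)) <= 2 * (n2 (fun t => (akern N t)%:C * g t) * n2 q).
    apply: inner_majorant => // t.
    rewrite /trunc /q [X in X * _ <= _]cmodM [X in _ <= X * _]cmodM !cmod_real.
    rewrite (ger0_norm (avg_kernel_ge0 _ _ _ _)).
    have [ht|ht] := boolP (`|t| <= rho)%R; last by rewrite mul0r normr0 !mul0r mulr0.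
    rewrite normr1 !mul1r (ger0_norm E0).
    have := ler_wpM2l (cmod_ge0 (g t)) (hE N t Npos).
    by move=> h; apply: le_trans h _; rewrite le_eqVlt; apply/orP; left; apply/eqP; ring.
  have := hN0 N (leq_maxl _ _); rewrite ltr_pdivlMr ?mulr_gt0 //.
  have := n2_ge0 (fun t => (akern N t)%:C * g t); have := n2_ge0 q.
  set x := n2 (fun t => _); set y := n2 q => *; nra.
have part2 : cmod (inner (tail rho g) (fmean N)) <= e / 4.
  apply: le_trans (cauchy_schwarz Lta LY) _.
  have := hC N Npos; move: hrho; rewrite ltr_pdivlMr //.
  have := n2_ge0 (tail rho g); have := n2_ge0 (fmean N).
  set x := n2 (tail rho g); set y := n2 (fmean N) => *; nra.
have -> : B = (B - inner g (fmean N)) +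
    (inner (trunc rho g) (fmean N) + inner (tail rho g) (fmean N)).
  by rewrite -splitE subrK.
apply: le_trans (cmodD _ _) _.
have := cmodD (inner (trunc rho g) (fmean N)) (inner (tail rho g) (fmean N)).
move: close part1 part2 KN; lra.
Qed.

End ZeroTransfer.

(** * Nowhere vanishing quasi-periodic functions *)

Section Argument.
Context {R : realType}.
Implicit Types (z w : R[i]).

Definition carg z : R := atan (complex.Im z / complex.Re z).

Lemma carg_small z : `|carg z| < pi / 2.
Proof. by rewrite ltr_norml atan_gtNpi2 atan_ltpi2. Qed.

Lemma cargP z : 0 < complex.Re z -> exists r : R, 0 < r /\ z = r%:C * expi (carg z).
Proof.
move=> z0; have c0 : 0 < cos (carg z).
  by apply: cos_gt0_pihalf; rewrite atan_gtNpi2 atan_ltpi2.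
exists (complex.Re z / cos (carg z)); split; first exact: divr_gt0.
have : tan (carg z) = complex.Im z / complex.Re z by exact: atanK.
rewrite /tan => tE.
have sE : sin (carg z) = complex.Im z / complex.Re z * cos (carg z).
  by rewrite -tE divfK // lt0r_neq0.
apply: complex_eq; rewrite ?cReM ?cImM /expi /= mul0r ?subr0 ?addr0.
  by rewrite divfK // lt0r_neq0.
by rewrite sE; field; rewrite (lt0r_neq0 z0) (lt0r_neq0 c0).
Qed.

Lemma angle_unique (r s al be : R) : 0 < r -> 0 < s ->
  r%:C * expi al = s%:C * expi be -> `|al - be| < 2 * pi -> al = be.
Proof.
move=> r0 s0 e small.
have rs : r = s.
  have := congr1 cmod e; rewrite !cmodM !cmod_expi !mulr1 !cmod_real.
  by rewrite !gtr0_norm.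
have e1 : expi (al - be) = 1 :> R[i].
  rewrite expiD expiN; move: e; rewrite rs => /mulfI -> //.
    by rewrite divff // expi_neq0.
  by rewrite -cmod_eq0 cmod_real normr_eq0 lt0r_neq0.
by apply/eqP; rewrite -subr_eq0; apply/eqP; exact: expi_eq1_small.
Qed.

Lemma ratio_pos z w : cmod (w - z) < cmod z -> 0 < complex.Re (w / z).
Proof.
move=> h; have z0 : z != 0.
  by rewrite -cmod_gt0; apply: le_lt_trans h; exact: cmod_ge0.
have zp : 0 < cmod z by rewrite cmod_gt0.
have : cmod (w / z - 1) < 1.
  have -> : w / z - 1 = (w - z) / z by field.
  by rewrite cmodM cmodV ltr_pdivrMr // mul1r.
move=> h1; have := le_lt_trans (Re_le_cmod _) h1.
by rewrite cReB ltr_norml => /andP[h2 _]; move: h2 => /=; lra.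
Qed.

End Argument.

Section QuasiPeriodic.
Context {R : realType} (a : R).
Hypothesis a_gt0 : 0 < a.
Variable F : R -> R -> R[i].
Hypothesis F_neq0 : forall t th, F t th != 0.
Hypothesis F_cont : forall t th (e : R), 0 < e -> exists d : R, 0 < d /\
  forall t' th', `|t - t'| < d -> `|th - th'| < d -> cmod (F t th - F t' th') < e.
Hypothesis F_quasi : forall t th, F (t + a) th = expi (- th) * F t th.
Hypothesis F_period : forall t th, F t (th + 2 * pi) = F t th.

(** On a mesh this fine, neighbouring values have a ratio of positive real part,
    so that their angle is given by [carg].  The mesh exists by compactness of
    the fundamental rectangle. *)
Lemma quasi_periodic_mesh (L : R) : exists M : nat, (1 < M)%N /\ forall t th t' th' : R,
  0 <= t <= a -> 0 <= th <= 2 * pi ->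
  `|t - t'| <= L / M%:R -> `|th - th'| <= L / M%:R ->
  cmod (F t' th' - F t th) < cmod (F t th).
Proof.
pose K : set (R * R) := `[0, a]%classic `*` `[0, 2 * pi]%classic.
have cK : compact K by apply: compact_setX; exact: segment_compact.
pose P (M : nat) (p : R * R) := forall t' th' : R,
  `|p.1 - t'| <= L / M%:R -> `|p.2 - th'| <= L / M%:R ->
  cmod (F t' th' - F p.1 p.2) < cmod (F p.1 p.2).
have /compact_near_coveringP/(_ nat \oo P _) := cK.
case=> [[t th] _|N _ hN].
  have Fp : 0 < cmod (F t th) by rewrite cmod_gt0.
  have e0 : 0 < cmod (F t th) / 4 by rewrite divr_gt0.
  have [d [d0 hd]] := F_cont t th e0.
  have d2 : 0 < d / 2 by rewrite divr_gt0.
  have hdd : d / 2 < d by lra.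
  exists (ball (t, th) (d / 2), [set M : nat | L / M%:R < d / 2]); first split.
  - exact: nbhsx_ballx.
  - exists (Num.truncn (`|L| / (d / 2))).+1 => // M /= hM.
    have M0 : 0 < M%:R :> R by rewrite ltr0n (leq_trans _ hM).
    have : `|L| / (d / 2) < M%:R by rewrite (lt_le_trans (truncnS_gt _)) // ler_nat.
    rewrite ltr_pdivrMr // ltr_pdivrMr // mulrC => h.
    exact: le_lt_trans (ler_norm _) h.
  move=> [[u phi] M] /= [[ut uth] LM] t' th' /= h1 h2.
  have {}ut : `|t - u| < d / 2 := ut.
  have {}uth : `|th - phi| < d / 2 := uth.
  have near1 := hd u phi (lt_trans ut hdd) (lt_trans uth hdd).
  have t1 : `|t - t'| < d.
    rewrite -(subrK u t) -addrA; apply: le_lt_trans (ler_normD _ _) _.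
    by rewrite [ltRHS]splitr; apply: ltr_leD => //; apply: le_trans h1 (ltW LM).
  have th1 : `|th - th'| < d.
    rewrite -(subrK phi th) -addrA; apply: le_lt_trans (ler_normD _ _) _.
    by rewrite [ltRHS]splitr; apply: ltr_leD => //; apply: le_trans h2 (ltW LM).
  have near2 := hd t' th' t1 th1.
  have : cmod (F t' th' - F u phi) <= cmod (F t th - F t' th') + cmod (F t th - F u phi).
    rewrite [cmod (F t th - F t' th')]cmod_dist; apply: le_trans (cmodD _ _).
    by rewrite addrA subrK.
  have : cmod (F t th) <= cmod (F t th - F u phi) + cmod (F u phi).
    by apply: le_trans (cmodD _ _); rewrite subrK.
  lra.
exists (maxn N 2); split; first by rewrite leq_max orbT.
move=> t th t' th' t0 th0; apply: (hN _ (leq_maxl _ _) (t, th)).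
by split; rewrite /= in_itv.
Qed.

(** Sum the increments of the argument of [F] up the columns of a fine grid on
    the fundamental rectangle.  Neighbouring columns have equal sums, since the
    increments around a cell add up to 0 and the two rows bounding the
    rectangle agree; but the last column is the first one turned once around. *)
Lemma no_quasi_periodic : False.
Proof.
have pi0 := @pi_gt0 R; have pi2 := @pi_ge2 R.
have [M [M1 hM]] := quasi_periodic_mesh (a + 2 * pi).
have Mp : 0 < M%:R :> R by rewrite ltr0n; apply: ltn_trans M1.
have M2 : 2 <= M%:R :> R by rewrite ler_nat.
pose t (i : nat) : R := a * i%:R / M%:R.
pose s (j : nat) : R := 2 * pi * j%:R / M%:R.
pose G i j := F (t i) (s j).
have tr i : (i <= M)%N -> 0 <= t i <= a.
  move=> iM; rewrite divr_ge0 ?mulr_ge0 ?(ltW a_gt0) //= ler_pdivrMr //.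
  by rewrite ler_wpM2l ?(ltW a_gt0) // ler_nat.
have sr j : (j <= M)%N -> 0 <= s j <= 2 * pi.
  move=> jM; rewrite divr_ge0 ?mulr_ge0 ?(ltW pi0) //= ler_pdivrMr //.
  by rewrite ler_wpM2l ?mulr_ge0 ?(ltW pi0) // ler_nat.
have tS i : `|t i - t i.+1| <= (a + 2 * pi) / M%:R.
  have -> : t i - t i.+1 = - (a / M%:R) by rewrite /t -[i.+1%:R]natr1; ring.
  rewrite normrN ger0_norm ?divr_ge0 ?(ltW a_gt0) ?(ltW Mp) //.
  by rewrite ler_pM2r ?invr_gt0 // lerDl mulr_ge0 // ltW.
have sS j : `|s j - s j.+1| <= (a + 2 * pi) / M%:R.
  have -> : s j - s j.+1 = - (2 * pi / M%:R) by rewrite /s -[j.+1%:R]natr1; ring.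
  rewrite normrN ger0_norm ?divr_ge0 ?mulr_ge0 ?(ltW pi0) ?(ltW Mp) //.
  by rewrite ler_pM2r ?invr_gt0 // lerDr ltW.
have z0 (x : R) : `|x - x| <= (a + 2 * pi) / M%:R.
  by rewrite subrr normr0 divr_ge0 // addr_ge0 ?mulr_ge0 // ltW.
pose v i j := carg (G i j.+1 / G i j).
pose h i j := carg (G i.+1 j / G i j).
have vP i j : (i <= M)%N -> (j < M)%N -> exists r : R, 0 < r /\
    G i j.+1 / G i j = r%:C * expi (v i j).
  move=> iM jM; apply: cargP; apply: ratio_pos.
  by apply: hM; [exact: tr|exact/sr/ltnW|exact: z0|exact: sS].
have hP i j : (i < M)%N -> (j <= M)%N -> exists r : R, 0 < r /\
    G i.+1 j / G i j = r%:C * expi (h i j).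
  move=> iM jM; apply: cargP; apply: ratio_pos.
  by apply: hM; [exact/tr/ltnW|exact: sr|exact: tS|exact: z0].
have vs i j : `|v i j| < pi / 2 by exact: carg_small.
have hs i j : `|h i j| < pi / 2 by exact: carg_small.
have cell i j : (i < M)%N -> (j < M)%N -> h i j + v i.+1 j = v i j + h i j.+1.
  move=> iM jM.
  have [r1 [r10 e1]] := hP i j iM (ltnW jM); have [r2 [r20 e2]] := vP i.+1 j iM jM.
  have [r3 [r30 e3]] := vP i j (ltnW iM) jM; have [r4 [r40 e4]] := hP i j.+1 iM jM.
  apply: (angle_unique (mulr_gt0 r10 r20) (mulr_gt0 r30 r40)).
    rewrite !rmorphM !expiD mulrACA -e1 -e2 [RHS]mulrACA -e3 -e4.
    have g0 k l : G k l != 0 by exact: F_neq0.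
    by field; rewrite !g0.
  have := vs i.+1 j; have := vs i j; have := hs i j; have := hs i j.+1.
  rewrite !ltr_norml => /andP[? ?] /andP[? ?] /andP[? ?] /andP[? ?].
  by apply/andP; split; lra.
have topbot i : G i M = G i 0.
  rewrite /G; have -> : s M = s 0 + 2 * pi by rewrite /s mulr0 mul0r add0r mulfK ?lt0r_neq0.
  exact: F_period.
pose W i := \sum_(j < M) v i j.
have step i : (i < M)%N -> W i.+1 = W i.
  move=> iM; apply/eqP; rewrite -subr_eq0 -sumrB; apply/eqP.
  transitivity (\sum_(j < M) (h i j.+1 - h i j)).
    by apply: eq_bigr => j _; have := cell i j iM (ltn_ord j); lra.
  rewrite -(big_mkord xpredT (fun j => h i j.+1 - h i j)) telescope_sumr //.
  by rewrite /h !topbot subrr.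
have const i : (i <= M)%N -> W i = W 0.
  by elim: i => // i IH iM; rewrite step // IH // ltnW.
have last_col j : (j < M)%N -> v M j = v 0 j - 2 * pi / M%:R.
  move=> jM; have [r1 [r10 e1]] := vP M j (leqnn M) jM.
  have [r2 [r20 e2]] := vP 0 j (leq0n M) jM.
  apply: (angle_unique r10 r20).
    rewrite expiD mulrA -e1 -e2.
    have GE k : G M k = expi (- s k) * G 0 k.
      rewrite /G; have -> : t M = t 0 + a by rewrite /t mulr0 mul0r add0r mulfK ?lt0r_neq0.
      exact: F_quasi.
    have sE : - (2 * pi / M%:R) = - s j.+1 + s j.
      by rewrite /s -[j.+1%:R]natr1; ring.
    rewrite sE expiD !GE expiN [expi (- s j)]expiN; field.
    by rewrite !expi_neq0 /= F_neq0.
  have q1 : 0 <= 2 * pi / M%:R :> R by rewrite divr_ge0 ?mulr_ge0 ?(ltW pi0).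
  have q2 : 2 * pi / M%:R <= pi :> R by rewrite ler_pdivrMr // mulrC ler_wpM2l // ltW.
  have := vs M j; have := vs 0 j; rewrite !ltr_norml => /andP[? ?] /andP[? ?].
  by apply/andP; split; lra.
have : W M = W 0 - 2 * pi.
  rewrite /W; transitivity (\sum_(j < M) (v 0 j - 2 * pi / M%:R)).
    by apply: eq_bigr => j _; exact: last_col.
  rewrite sumrB sumr_const card_ord -[_ *+ M]mulr_natr divfK //.
  exact: lt0r_neq0.
rewrite const //; lra.
Qed.

End QuasiPeriodic.

(** * Periodization of integrable functions on the plane *)

Section PlaneTranslates.
Context {R : realType}.
Local Notation leb := (@lebesgue_measure R).
Local Notation plane := (measurableTypeR R * measurableTypeR R)%type.

Lemma measurable_plane_shift (u : R * R) :
  measurable_fun setT ((fun z => (z.1 - u.1, z.2 - u.2)) : plane -> plane).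
Proof.
apply/measurable_fun_pairP; split => /=.
  exact: (measurableT_comp (measurable_shift u.1) measurable_fst).
exact: (measurableT_comp (measurable_shift u.2) measurable_snd).
Qed.

Lemma ge0_integral_plane_shift (u : R * R) (f : plane -> \bar R) :
  measurable_fun setT f -> (forall z, (0 <= f z)%E) ->
  (\int[leb \x leb]_z f (z.1 - u.1, z.2 - u.2)%R = \int[leb \x leb]_z f z)%E.
Proof.
move=> mf f0; rewrite !fubini_tonelli1 //; last first.
  exact: (measurableT_comp mf (measurable_plane_shift u)).
rewrite /fubini_F /=; transitivity
    (\int[leb]_x (fun s : R => \int[leb]_y f (s, y)) ((x : R) - u.1)%R)%E.
  apply: eq_integral => s _ /=.
  by apply: (@ge0_integral_shift _ u.2 (fun y => f (s - u.1, y)%R)) => //;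
    exact: measurableT_comp mf (pair1_measurable _).
apply: ge0_integral_shift.
  exact: (measurable_fun_fubini_tonelli_F _ mf f0).
by move=> s; exact: integral_ge0.
Qed.

End PlaneTranslates.

Section Periodization.
Context {R : realType} {I : countType}.
Local Notation leb := (@lebesgue_measure R).
Local Notation plane := (measurableTypeR R * measurableTypeR R)%type.
Variables (u : I -> R * R) (Q : set plane) (F : plane -> R).
Hypothesis mQ : measurable Q.
Hypothesis u_sep : forall i j z,
  Q (z.1 - (u i).1, z.2 - (u i).2) -> Q (z.1 - (u j).1, z.2 - (u j).2) -> i = j.
Hypotheses (mF : measurable_fun setT F) (F0 : forall z, 0 <= F z).

Let back i (z : plane) : plane := (z.1 - (u i).1, z.2 - (u i).2).
Let forth i (z : plane) : plane := (z.1 - - (u i).1, z.2 - - (u i).2).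

Lemma periodization_integral (i : I) :
  (\int[leb \x leb]_z (\1_Q z * F (forth i z))%:E =
   \int[leb \x leb]_z (\1_Q (back i z) * F z)%:E)%E.
Proof.
have mb : measurable_fun setT (back i) := measurable_plane_shift (u i).
rewrite -(ge0_integral_plane_shift (- (u i).1, - (u i).2)
  (f := fun z => (\1_Q (back i z) * F z)%:E)) /=.
- apply: eq_integral => z _; congr (_ * _)%:E; congr (\1_Q _).
  by rewrite /back /= !opprK !addrK; case: z.
- apply/measurable_EFinP; apply: measurable_funM => //.
  by apply: measurableT_comp mb; exact: measurable_indic.
- by move=> z; rewrite lee_fin mulr_ge0.
Qed.

(** Since the translates of [Q] are disjoint, the integral over [Q] of the sum
    of all translates of [F] is at most the integral of [F]. *)
Lemma periodization_finite : (\int[leb \x leb]_z (F z)%:E < +oo)%E ->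
  (0 < (leb \x leb) Q)%E ->
  exists2 z, Q z & exists K : R, forall A : {fset I},
    \sum_(i <- A) F (z.1 + (u i).1, z.2 + (u i).2) <= K.
Proof.
move=> iF Q0.
pose S (n : nat) (z : plane) : R :=
  if pickle_inv n is Some i then \1_Q z * F (forth i z) else 0.
pose T (n : nat) (z : plane) : R :=
  if pickle_inv n is Some i then \1_Q (back i z) * F z else 0.
have mS n : measurable_fun setT (S n).
  rewrite /S; case: pickle_inv => [i|]; last exact: measurable_cst.
  apply: measurable_funM; first exact: measurable_indic.
  exact: (measurableT_comp mF (measurable_plane_shift (- (u i).1, - (u i).2))).
have mT n : measurable_fun setT (T n).
  rewrite /T; case: pickle_inv => [i|]; last exact: measurable_cst.
  apply: measurable_funM => //.
  apply: measurableT_comp (measurable_plane_shift (u i)); exact: measurable_indic.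
have S0 n z : 0 <= S n z by rewrite /S; case: pickle_inv => // i; rewrite mulr_ge0.
have T0 n z : 0 <= T n z by rewrite /T; case: pickle_inv => // i; rewrite mulr_ge0.
have ST n : (\int[leb \x leb]_z (S n z)%:E = \int[leb \x leb]_z (T n z)%:E)%E.
  by rewrite /S /T; case: pickle_inv => // i; exact: periodization_integral.
have TF N z : \sum_(n < N) T n z <= F z.
  have T_le n : T n z <= F z.
    rewrite /T; case: pickle_inv => // i; rewrite indicE ler_piMl //.
    by case: (_ \in _).
  case: (pickP (fun n : 'I_N => T n z != 0)) => [n0 Tn0|T_0]; last first.
    by rewrite big1 // => n _; apply/eqP/negbFE/T_0.
  have supp n : T n z != 0 -> exists i : I, choice.pickle i = n /\ Q (back i z).
    rewrite /T; have := @pickle_invK I n; case: pickle_inv => [i /= ni|]; last by rewrite eqxx.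
    rewrite indicE; case: (boolP (back i z \in Q)) => [/set_mem Qi _|_]; first by exists i.
    by rewrite ?mul0r ?eqxx.
  rewrite (bigD1 n0) //= big1 ?addr0 // => n nn0; apply: contra_neq_eq nn0.
  move=> /supp[i [ni Qi]]; have [j [nj Qj]] := supp n0 Tn0.
  by apply/val_inj; rewrite /= -ni -nj (u_sep Qi Qj).
have mSE n : measurable_fun setT (fun z => (S n z)%:E) by exact/measurable_EFinP.
have mTE n : measurable_fun setT (fun z => (T n z)%:E) by exact/measurable_EFinP.
have total : (\int[leb \x leb]_z (\sum_(0 <= n <oo) (S n z)%:E) <=
              \int[leb \x leb]_z (F z)%:E)%E.
  rewrite integral_nneseries //; last by move=> n z _; rewrite lee_fin.
  apply: lime_le.
    by apply: is_cvg_nneseries => n _ _; apply: integral_ge0 => z _; rewrite lee_fin.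
  apply: nearW => N; rewrite (eq_bigr _ (fun n _ => ST n)) -ge0_integral_sum //.
    apply: ge0_le_integral => //.
    - by move=> z _; apply: sume_ge0 => n _; rewrite lee_fin.
    - exact: emeasurable_sum.
    - exact/measurable_EFinP.
    - by move=> z _; rewrite sumEFin lee_fin big_mkord TF.
  by move=> n z _; rewrite lee_fin.
have [z Qz [K zK]] : exists2 z, Q z &
    exists K : R, (\sum_(0 <= n <oo) (S n z)%:E)%E = K%:E.
  apply: contrapT => noz.
  have : (+oo * (leb \x leb) Q <= \int[leb \x leb]_z (F z)%:E)%E.
    apply: le_trans total; rewrite -integral_cst //.
    rewrite integral_mkcond; apply: ge0_le_integral => //.
    + by move=> z _; rewrite patchE; case: ifP => _; rewrite ?leey ?lexx.
    + by apply/(measurable_restrictT _ mQ); exact: measurable_cst.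
    + by apply: ge0_emeasurable_sum => // n z _ _; rewrite lee_fin.
    move=> z _; have sz : (0 <= \sum_(0 <= n <oo) (S n z)%:E)%E.
      by apply: nneseries_ge0 => n _ _; rewrite lee_fin.
    rewrite patchE; case: (boolP (z \in Q)) => // /set_mem Qz.
    case E : (\sum_(0 <= n <oo) (S n z)%:E)%E sz => [K| |] //= _.
    by case: noz; exists z => //; exists K.
  by rewrite gt0_mulye // leNgt iF.
exists z => //; exists K => A.
have inj : uniq [seq choice.pickle i | i <- A] by rewrite map_inj_uniq ?fset_uniq //; exact: pcan_inj (@choice.pickleK I).
pose N := (\max_(i <- A) choice.pickle i).+1.
have sub : {subset [seq choice.pickle i | i <- A] <= index_iota 0 N}.
  move=> n /mapP[i iA ->]; rewrite mem_index_iota ltnS /=.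
  by rewrite (big_rem i) //= leq_maxl.
have := sum_subseq_le (fun n => S0 n z) inj sub.
rewrite big_map => h; rewrite -lee_fin -zK.
apply: le_trans (nneseries_lim_ge N _); last by move=> n _ _; rewrite lee_fin.
rewrite sumEFin lee_fin; apply: le_trans h; rewrite le_eqVlt; apply/orP; left; apply/eqP.
apply: eq_bigr => i _; rewrite /S pickleK_inv indicE mem_set // mul1r /forth.
by rewrite !opprK.
Qed.

End Periodization.

(** * Windows with summable coefficients *)

Section GoodWindows.
Context {R : realType} (a : R) (g : R -> R[i]).
Hypothesis a_gt0 : 0 < a.
Hypothesis Lg : L2 g.
Local Notation leb := (@lebesgue_measure R).
Local Notation plane := (measurableTypeR R * measurableTypeR R)%type.

Let a_neq0 : a != 0. Proof. exact: lt0r_neq0. Qed.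

(** The first moment makes the symbol of the window Lipschitz. *)
Definition good_window v : Prop := nice v /\ exists K : R, forall A : {fset int * int},
  \sum_(k <- A) cmod (inner g (gabor v a a^-1 k)) * (1 + `|k.1%:~R| + `|k.2%:~R|) <= K.

(** Composition of two time-frequency shifts, up to a phase. *)
Lemma cmod_inner_gabor_tfshift h (z : R * R) k : nice h ->
  cmod (inner g (gabor (tfshift z h) a a^-1 k)) =
  cmod (STFT h g (z.1 + a * k.1%:~R, z.2 + a^-1 * k.2%:~R)).
Proof.
case: z => x w nh; rewrite /STFT.
pose c : R := 2 * pi * (a^-1 * k.2%:~R) * (x + a * k.1%:~R).
have -> : gabor (tfshift (x, w) h) a a^-1 k =
    (fun t => expi c * tfshift (x + a * k.1%:~R, w + a^-1 * k.2%:~R) h t).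
  apply/funext => t; rewrite gaborE // !tfshiftE !mulrA -!expiD.
  have -> : t - a * k.1%:~R - x = t - (x + a * k.1%:~R) by ring.
  by congr (expi _ * _); rewrite /c; field.
rewrite innerZr //; last exact/nice_L2/nice_tfshift.
by rewrite cmodM cmod_conj cmod_expi mul1r.
Qed.

(** The coefficients against the window shifted by [z] sample the short-time
    Fourier transform on a translate of the lattice by [z]; almost all such
    samples of an integrable function are summable. *)
Lemma good_window_dense h (x y d : R) : nice h -> modulation_space h 1%E 1 g -> 0 < d ->
  exists z : R * R, [/\ x <= z.1 < x + d, y <= z.2 < y + d & good_window (tfshift z h)].
Proof.
move=> nh [_ [mF iF]] d0.
pose F (z : plane) : R := cmod (STFT h g z * (weight 1 z)%:C).
have FE z : F z = cmod (STFT h g z) * (1 + `|z.1| + `|z.2|).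
  have p0 : 0 <= 1 + `|z.1| + `|z.2| by rewrite !addr_ge0.
  by rewrite /F cmodM cmod_real /weight powRr1 // ger0_norm.
pose e := Num.min d (Num.min a a^-1).
have e0 : 0 < e by rewrite !lt_min d0 a_gt0 invr_gt0.
have [ed ea ei] : [/\ e <= d, e <= a & e <= a^-1] by rewrite !ge_min !lexx !orbT.
pose X : set (measurableTypeR R) := `[x, (x + e)[%classic.
pose Y : set (measurableTypeR R) := `[y, (y + e)[%classic.
pose u (k : int * int) : R * R := (a * k.1%:~R, a^-1 * k.2%:~R).
have int_close (c x0 t : R) (i j : int) : 0 < c -> e <= c ->
    x0 <= t - c * i%:~R < x0 + e -> x0 <= t - c * j%:~R < x0 + e -> i = j.
  move=> c0 ec /andP[h1 h2] /andP[h3 h4].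
  have : `|c * (i - j)%:~R| < c by rewrite intrB ltr_norml; apply/andP; split; lra.
  rewrite normrM gtr0_norm // gtr_pMr // -intr_norm.
  rewrite -[1]/(1%:~R) ltr_int => ij.
  by clear -ij; lia.
have sep i j (z : plane) : (X `*` Y) (z.1 - (u i).1, z.2 - (u i).2) ->
    (X `*` Y) (z.1 - (u j).1, z.2 - (u j).2) -> i = j.
  move=> [/= Xi Yi] [/= Xj Yj]; move: Xi Yi Xj Yj; rewrite /X /Y /= !in_itv /=.
  move=> Xi Yi Xj Yj.
  rewrite (surjective_pairing i) (surjective_pairing j).
  rewrite (int_close a x z.1 i.1 j.1) // (int_close a^-1 y z.2 i.2 j.2) //.
  by rewrite invr_gt0.
have mQ : measurable (X `*` Y) by apply: measurableX; exact: measurable_itv.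
have F0 z : 0 <= F z by exact: cmod_ge0.
have [] := periodization_finite mQ sep (cmeas_cmod mF) F0.
- move: iF; rewrite /cLnorm Lnorm1; congr (_ < _)%E.
  by apply: eq_integral => z _; rewrite gee0_abs // lee_fin cmod_ge0.
- have itv_e (s : R) : lebesgue_measure (`[s, (s + e)[%classic : set (measurableTypeR R)) = e%:E.
    by rewrite lebesgue_measure_itv /= lte_fin ltrDl e0 -EFinB addrC addKr.
  have -> : ((leb \x leb) (X `*` Y) = leb X * leb Y)%E.
    by apply: product_measure1E; exact: measurable_itv.
  by rewrite (itv_e x : leb X = _) (itv_e y : leb Y = _) -EFinM lte_fin mulr_gt0.
move=> z [Xz Yz] [K hK]; exists z; move: Xz Yz; rewrite /X /Y /= !in_itv /=.
move=> /andP[x1 x2] /andP[y1 y2]; split.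
- by rewrite x1 (lt_le_trans x2) // lerD2l.
- by rewrite y1 (lt_le_trans y2) // lerD2l.
split; first exact: nice_tfshift.
(* compares the weight at a lattice point with the weight at its translate *)
pose C := (1 + `|z.1| / a + a * `|z.2|) + a^-1 + a.
have ia0 : 0 < a^-1 by rewrite invr_gt0.
have C0 : 0 <= C.
  by rewrite !addr_ge0 ?divr_ge0 ?mulr_ge0 // ltW.
exists (C * K) => A.
apply: le_trans (sum_scale_le C0 hK A); apply: ler_sum => k _.
rewrite -[X in _ <= C * X]/(F (z.1 + (u k).1, z.2 + (u k).2)) FE cmod_inner_gabor_tfshift // mulrCA ler_wpM2l ?cmod_ge0 //=.
have k1 : `|k.1%:~R| <= (`|z.1 + a * k.1%:~R| + `|z.1|) / a.
  rewrite ler_pdivlMr // -[X in _ * X <= _](gtr0_norm a_gt0) -normrM.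
  have -> : k.1%:~R * a = z.1 + a * k.1%:~R - z.1 by ring.
  exact: ler_normB.
have k2 : `|k.2%:~R| <= a * (`|z.2 + a^-1 * k.2%:~R| + `|z.2|).
  rewrite -ler_pdivrMl // -[X in X * _ <= _](gtr0_norm ia0) -normrM.
  apply: le_trans (ler_normB _ _); rewrite [z.2 + _]addrC addrK; exact: lexx.
move: k1 k2; set p := `|_ + _|; set q := `|_ + a^-1 * _| => k1 k2.
have p0 : 0 <= p by exact: normr_ge0.
have q0 : 0 <= q by exact: normr_ge0.
have P1 : 0 <= `|z.1| / a by rewrite divr_ge0 // ltW.
have P2 : 0 <= a * `|z.2| by rewrite mulr_ge0 // ltW.
apply: (@le_trans _ _ (1 + (p + `|z.1|) / a + a * (q + `|z.2|))).
  by rewrite !lerD.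
rewrite /C mulrDl -subr_ge0.
rewrite [leRHS](_ : _ = (`|z.1| / a + a * `|z.2|) * (p + q) + (p + q) + a^-1 * (1 + q) +
  a * (1 + p)); last by ring.
by rewrite !addr_ge0 ?mulr_ge0 ?addr_ge0 // ltW.
Qed.

(** Shifting the window translates its Zak transform, so a point where the Zak
    transform of [h] is nonzero can be moved to any other point, with enough
    room to choose the shift in a small box. *)
Lemma good_window_exists h t1 t th : nice h -> modulation_space h 1%E 1 g -> h t1 != 0 ->
  exists v, good_window v /\ zak a v t th != 0.
Proof.
move=> nh mh ht1; have pi0 := @pi_gt0 R.
have [th1 z1] := zak_nonzero a_gt0 nh ht1.
have [C [C0 hC]] := zak_lipschitz a_gt0 `|t1| nh.
set e := cmod (zak a h t1 th1); have e0 : 0 < e by rewrite cmod_gt0.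
have pa : 0 < 2 * pi * a by rewrite !mulr_gt0.
pose D := (C + 1) * (1 + 2 * pi * a).
have D0 : 0 < D by rewrite mulr_gt0 ?(addr_gt0 ltr01) // (le_lt_trans C0) // ltrDl.
pose d := Num.min 1 (e / (2 * D)).
have d0 : 0 < d by rewrite lt_min ltr01 divr_gt0 // mulr_gt0.
have d1 : d <= 1 by rewrite ge_min lexx.
have d2 : d <= e / (2 * D) by rewrite ge_min lexx orbT.
have [z [/andP[x1 x2] /andP[y1 y2] gz]] :=
  good_window_dense (t - t1) ((th1 - th) / (2 * pi * a)) nh mh d0.
exists (tfshift z h); split=> //.
rewrite (surjective_pairing z) zak_tfshift // mulf_neq0 ?expi_neq0 //.
have n1 : `|t1 - (t - z.1)| <= d by rewrite ler_norml; apply/andP; split; lra.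
have n2 : `|th1 - (th + 2 * pi * z.2 * a)| <= 2 * pi * a * d.
  move: y1 y2; set Y := (th1 - th) / _ => y1 y2.
  have -> : th1 - (th + 2 * pi * z.2 * a) = 2 * pi * a * (Y - z.2).
    by rewrite mulrBr [_ * Y]mulrC /Y divfK ?(lt0r_neq0 pa) //; ring.
  rewrite normrM (gtr0_norm pa) ler_pM2l // ler_norml; apply/andP; split; lra.
have := hC t1 (t - z.1) th1 (th + 2 * pi * z.2 * a) (lexx _) (le_trans n1 d1).
apply: contraTneq => ->; rewrite subr0 -/e -ltNge.
apply: (@le_lt_trans _ _ (C * (d * (1 + 2 * pi * a)))).
  apply: ler_wpM2l => //; rewrite [leRHS]mulrDr mulr1 [d * _]mulrC; exact: lerD.
apply: (@le_lt_trans _ _ (D * d)).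
  rewrite /D -[leRHS]mulrA [d * _]mulrC ler_wpM2r ?lerDl //.
  by rewrite mulr_ge0 ?(ltW d0) // addr_ge0 // ltW.
rewrite mulrC -ltr_pdivlMr //; apply: le_lt_trans d2 _.
have -> : e / (2 * D) = e / D / 2 by rewrite invfM mulrA [e / 2 / D]mulrAC.
have : 0 < e / D by rewrite divr_gt0.
lra.
Qed.

End GoodWindows.

(** * The symbol and the obstruction *)

Section Symbol.
Context {R : realType} (a : R) (g : R -> R[i]).
Hypothesis a_gt0 : 0 < a.
Hypothesis Lg : L2 g.
Local Notation good := (good_window a g).
Implicit Types (v w : R -> R[i]) (t th : R).

Let a_neq0 : a != 0. Proof. exact: lt0r_neq0. Qed.

Definition symbol_term v t th (k : int * int) : R[i] :=
  inner g (gabor v a a^-1 k) * character th (t / a) k.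

(** Formally the product of the Zak transform of [g] and the conjugate of the
    Zak transform of [v]. *)
Definition symbol v t th : R[i] := xget 0 [set z | has_usum (symbol_term v t th) z].

Lemma symbol_term_twist v t th k : L2 v ->
  symbol_term v t th k = inner g (twist a th (t / a) k v).
Proof. by move=> Lv; rewrite inner_gabor_twist. Qed.

Lemma symbol_term_sum v t th : good v -> exists K, 0 <= K /\ forall A : {fset int * int},
  \sum_(k <- A) cmod (symbol_term v t th k) * (1 + `|k.1%:~R| + `|k.2%:~R|) <= K.
Proof.
move=> [_ [K hK]]; exists K; split=> [|A]; first by have := hK fset0; rewrite big_seq_fset0.
apply: le_trans (hK A); apply: ler_sum => k _.
by rewrite cmodM cmod_character mulr1.
Qed.

Lemma symbolP v t th : good v -> has_usum (symbol_term v t th) (symbol v t th).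
Proof.
move=> /(symbol_term_sum t th)[K [_ hK]].
have [z hz] : exists z, has_usum (symbol_term v t th) z.
  apply: has_usum_ex hK => k; rewrite ler_peMr ?cmod_ge0 //.
  by rewrite -addrA lerDl addr_ge0.
by rewrite /symbol; case: xgetP => [y _ //|/(_ z)].
Qed.

Lemma symbol_unique v t th z : good v -> has_usum (symbol_term v t th) z ->
  symbol v t th = z.
Proof. by move=> gv; apply: has_usum_unique; exact: symbolP. Qed.

Lemma symbol_shift v t th : good v -> symbol v (t + a) th = symbol v t th.
Proof.
move=> gv; apply: symbol_unique => //; apply: eq_has_usum (symbolP t th gv) => k.
rewrite /symbol_term /character; have -> : (t + a) / a = t / a + 1 by rewrite mulrDl divff.
rewrite [_ * (t / a + 1)]mulrDr mulr1 addrA [in RHS]expiD.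
by rewrite expi2pi_int mulr1.
Qed.

Lemma symbol_period v t th : good v -> symbol v t (th + 2 * pi) = symbol v t th.
Proof.
move=> gv; apply: symbol_unique => //; apply: eq_has_usum (symbolP t th gv) => k.
rewrite /symbol_term /character [(th + 2 * pi) * _]mulrDl addrAC [in RHS]expiD.
by rewrite expi2pi_int mulr1.
Qed.

Lemma symbol_lipschitz v : good v -> exists C : R, 0 <= C /\ forall t t' th th',
  cmod (symbol v t th - symbol v t' th') <= C * (`|t - t'| + `|th - th'|).
Proof.
move=> gv; have [K [K0 hK]] := symbol_term_sum 0 0 gv.
have pi0 := @pi_gt0 R.
have [c [cE c0]] : exists c : R, c = 2 * pi / a /\ 0 <= c.
  by eexists; split; [reflexivity|rewrite divr_ge0 ?mulr_ge0 // ltW].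
pose D : R := 2 * (1 + c).
have D0 : 0 <= D by rewrite mulr_ge0 // addr_ge0.
exists (D * K); split=> [|t t' th th']; first exact: mulr_ge0.
set s := `|t - t'| + `|th - th'|; have s0 : 0 <= s by rewrite addr_ge0.
rewrite mulrAC; apply: has_usum_le (sum_scale_le (mulr_ge0 D0 s0) hK)
  (has_usumB (symbolP t th gv) (symbolP t' th' gv)) => k.
rewrite /symbol_term -mulrBr !cmodM cmod_character mulr1 mulrCA ler_wpM2l ?cmod_ge0 //.
apply: le_trans (expi_lipschitz _ _) _.
set w := 1 + _ + _.
have -> : D * s * w = 2 * (s * w + c * (s * w)) by rewrite /D; ring.
rewrite ler_pM2l //.
have -> : th * k.1%:~R + 2 * pi * k.2%:~R * (t / a) -
    (th' * k.1%:~R + 2 * pi * k.2%:~R * (t' / a)) =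
    (th - th') * k.1%:~R + c * ((t - t') * k.2%:~R) by rewrite cE; ring.
apply: le_trans (ler_normD _ _) _; rewrite !normrM (ger0_norm c0).
have h1 : `|th - th'| * `|k.1%:~R| <= s * (1 + `|k.1%:~R| + `|k.2%:~R|).
  by rewrite ler_pM // ?lerDr // -addrA addrCA lerDl addr_ge0.
have h2 : `|t - t'| * `|k.2%:~R| <= s * (1 + `|k.1%:~R| + `|k.2%:~R|).
  by rewrite ler_pM // ?lerDl // lerDr addr_ge0.
by apply: lerD => //; rewrite ler_wpM2l.
Qed.

Lemma good_window_lin (c d : R[i]) v w : good v -> good w ->
  good (fun t => c * v t + d * w t) /\ forall t th,
  symbol (fun t => c * v t + d * w t) t th = cj c * symbol v t th + cj d * symbol w t th.
Proof.
move=> gv gw; have [nv [K hK]] := gv; have [nw [M hM]] := gw.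
have gE k : gabor (fun t => c * v t + d * w t) a a^-1 k =
    (fun t => c * gabor v a a^-1 k t + d * gabor w a a^-1 k t).
  by apply/funext => t; rewrite !gaborE //; ring.
have Lgab x k : nice x -> L2 (gabor x a a^-1 k).
  by move=> nx; exact/nice_L2/nice_tfshift.
have iE k : inner g (gabor (fun t => c * v t + d * w t) a a^-1 k) =
    cj c * inner g (gabor v a a^-1 k) + cj d * inner g (gabor w a a^-1 k).
  rewrite gE innerDr //; [|exact/L2Z/Lgab|exact/L2Z/Lgab].
  by rewrite !innerZr //; exact: Lgab.
have glin : good (fun t => c * v t + d * w t).
  split; first exact: nice_lin.
  exists (cmod c * K + cmod d * M) => A.
  apply: le_trans (lerD (sum_scale_le (cmod_ge0 c) hK A) (sum_scale_le (cmod_ge0 d) hM A)).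
  have sumD (x y : int * int -> R) :
    \sum_(k <- A) x k + \sum_(k <- A) y k = \sum_(k <- A) (x k + y k).
    by rewrite big_split.
  rewrite sumD; apply: ler_sum => k _.
  rewrite iE !mulrA -mulrDl ler_wpM2r ?addr_ge0 //.
  by apply: le_trans (cmodD _ _) _; rewrite !cmodM !cmod_conj.
split=> // t th; apply: symbol_unique => //.
apply: eq_has_usum (has_usumD (has_usumZ (cj c) (symbolP t th gv))
                              (has_usumZ (cj d) (symbolP t th gw))) => k.
by rewrite /symbol_term iE; ring.
Qed.

Lemma symbol_zero v t th : good v -> zak a v t th = 0 -> symbol v t th = 0.
Proof.
move=> gv z0; have [nv _] := gv; have [K [_ hK]] := symbol_term_sum t th gv.
apply: (zak_zero_transfer a_gt0 nv z0 Lg _ hK (symbolP t th gv)) => k.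
by apply: symbol_term_twist; exact: nice_L2.
Qed.

(** The combination of two windows whose Zak transform vanishes at the given
    point has vanishing symbol there. *)
Lemma symbol_cross v w t th : good v -> good w ->
  cj (zak a w t th) * symbol v t th = cj (zak a v t th) * symbol w t th.
Proof.
move=> gv gw; have [nv _] := gv; have [nw _] := gw.
have [gx sx] := good_window_lin (zak a w t th) (- zak a v t th) gv gw.
have z0 : zak a (fun s => zak a w t th * v s + - zak a v t th * w s) t th = 0.
  by rewrite zak_lin // mulNr mulrC subrr.
have := symbol_zero gx z0; rewrite sx cjN mulNr => /eqP.
by rewrite subr_eq0 => /eqP.
Qed.

End Symbol.

Section Obstruction.
Context {R : realType} (a : R) (g gamma : R -> R[i]).
Hypothesis a_gt0 : 0 < a.
Hypotheses (Lg : L2 g) (Lgam : L2 gamma).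
Local Notation good := (good_window a g).

Let a_neq0 : a != 0. Proof. exact: lt0r_neq0. Qed.

(** For each [f] some [q] keeps the reproducing form away from 0.  Unlike
    invertibility of the reproducing operator, this holds in the same form when
    the two systems are exchanged. *)
Definition form_bounded_below : Prop := exists c : R, 0 < c /\ forall f, L2 f ->
  exists q L, [/\ L2 q,
    has_usum (fun k => inner f (gabor g a a^-1 k) * inner (gabor gamma a a^-1 k) q) L,
    c * n2 f * n2 q <= cmod L & 0 < n2 f -> 0 < n2 q].

Hypothesis form_below : form_bounded_below.

(** If the symbol vanished where the Zak transform does not, the box sums of [v]
    would grow linearly in norm although the form sees them only through
    orbit sums of [gamma], which are of smaller order. *)
Lemma symbol_neq0 v t th : good v -> zak a v t th != 0 -> symbol a g v t th != 0.
Proof.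
move=> gv z0; apply/eqP => s0; have [nv _] := gv; have Lv := nice_L2 nv.
have [c [c0 hc]] := form_below.
have [d [d0 [N1 hN1]]] := box_sum_lower a_gt0 nv z0.
have [K [K0 hK]] := symbol_term_sum t th gv.
have K1 : 0 < 4 * (K + 1) by rewrite mulr_gt0 // ltr_wpDl.
(* makes the upper bound [4 K e N] smaller than the lower bound [c d N] *)
pose e := c * d / (4 * (K + 1)); have e0 : 0 < e by rewrite divr_gt0 // mulr_gt0.
have [N2 hN2] := orbit_sum_freq_small th (t / a) a_gt0 Lgam e0.
have [N3 hN3] := orbit_sum_time_small th (t / a) a_gt0 Lgam e0.
pose N := (maxn (maxn N1 N2) (maxn N3 1))%N.
have {}hN1 : d * N%:R <= n2 (box_sum a th (t / a) N v).
  by apply: hN1; rewrite !leq_max leqnn.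
have {}hN2 : n2 (orbit_sum a th (t / a) dir_freq N gamma) <= e * N%:R.
  by apply: hN2; rewrite !leq_max leqnn orbT.
have {}hN3 : n2 (orbit_sum a th (t / a) dir_time N gamma) <= e * N%:R.
  by apply: hN3; rewrite !leq_max leqnn !orbT.
have N0 : 0 < N%:R :> R by rewrite ltr0n !leq_max !orbT.
have Lbox : L2 (box_sum a th (t / a) N v) by exact: L2_box_sum.
have [q [L [Lq hL cL qpos]]] := hc _ Lbox.
have dN : 0 < d * N%:R by rewrite mulr_gt0.
have {}qpos : 0 < n2 q by apply: qpos; exact: lt_le_trans dN hN1.
have hL' : has_usum (fun k => inner (box_sum a th (t / a) N v) (twist a th (t / a) k g) *
    inner (twist a th (t / a) k gamma) q) L.
  apply: eq_has_usum hL => k; rewrite inner_gabor_twist //.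
  have -> : gabor gamma a a^-1 k =
      (fun s => character th (t / a) k * twist a th (t / a) k gamma s).
    by apply/funext => s; exact: gabor_twist.
  rewrite innerZl //; last exact: L2_twist.
  by rewrite mulrA.
have b0 : has_usum (symbol_term a g v t th) 0 by rewrite -s0; exact: symbolP.
have := reproducing_form_bound a_neq0 Lg Lgam Lv Lq
  (fun k => symbol_term_twist a_gt0 Lg t th k Lv) hK b0 hL'.
apply/negP; rewrite -ltNge; apply: lt_le_trans cL.
rewrite mulrA ltr_pM2r //.
apply: (@lt_le_trans _ _ (c * (d * N%:R))); last by rewrite ler_wpM2l // ltW.
apply: (@le_lt_trans _ _ (K * (2 * (e * N%:R + e * N%:R)))).
  exact: (ler_wpM2l K0 (ler_wpM2l (ler0n R 2) (lerD hN2 hN3))).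
have -> : K * (2 * (e * N%:R + e * N%:R)) = (4 * K) * e * N%:R by ring.
rewrite mulrA ltr_pM2r // /e mulrA ltr_pdivrMr // mulrC.
by rewrite ltr_pM2l ?mulr_gt0 // ltr_pM2l // ltrDl.
Qed.

Hypothesis windows : forall t th, exists v, good v /\ zak a v t th != 0.

Let window t th : R -> R[i] := sval (cid (windows t th)).

Let window_good t th : good (window t th).
Proof. by rewrite /window; case: cid => v []. Qed.

Let window_neq0 t th : zak a (window t th) t th != 0.
Proof. by rewrite /window; case: cid => v []. Qed.

(** The Zak transform of [g], recovered from the symbol of any good window that
    is nonzero at the point. *)
Definition kappa t th : R[i] :=
  symbol a g (window t th) t th / cj (zak a (window t th) t th).

Lemma eq_div_conj (B B' z z' : R[i]) : z != 0 -> z' != 0 ->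
  cj z * B' = cj z' * B -> B / cj z = B' / cj z'.
Proof.
move=> z0 z0' e; apply/eqP; rewrite eqr_div ?conjc_eq0 //.
by rewrite mulrC -e mulrC.
Qed.

(** Independence of the window is [symbol_cross]. *)
Lemma kappaE v t th : good v -> zak a v t th != 0 ->
  kappa t th = symbol a g v t th / cj (zak a v t th).
Proof.
move=> gv z0; have := symbol_cross a_gt0 Lg t th gv (window_good t th).
exact: eq_div_conj (window_neq0 t th) z0.
Qed.

Lemma kappa_neq0 t th : kappa t th != 0.
Proof.
rewrite mulf_neq0 ?invr_neq0 ?conjc_eq0 ?window_neq0 //.
by apply: symbol_neq0; [exact: window_good|exact: window_neq0].
Qed.

Lemma kappa_quasi t th : kappa (t + a) th = expi (- th) * kappa t th.
Proof.
have gv := window_good t th; have z0 := window_neq0 t th; have [nv _] := gv.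
have zE := zak_shift a_gt0 t th nv.
rewrite (kappaE gv) ?zE ?mulf_neq0 ?expi_neq0 // (kappaE gv z0).
rewrite symbol_shift // cjM conj_expi opprK expiN; field.
by rewrite expi_neq0 conjc_eq0 z0.
Qed.

Lemma kappa_period t th : kappa t (th + 2 * pi) = kappa t th.
Proof.
have gv := window_good t th; have z0 := window_neq0 t th; have [nv _] := gv.
have zE := zak_period a_gt0 t th nv.
by rewrite (kappaE gv) ?zE // (kappaE gv z0) symbol_period.
Qed.

Lemma kappa_cont t th (e : R) : 0 < e -> exists d : R, 0 < d /\
  forall t' th', `|t - t'| < d -> `|th - th'| < d -> cmod (kappa t th - kappa t' th') < e.
Proof.
move=> e0; have gv := window_good t th; have z0 := window_neq0 t th; have [nv _] := gv.
set v := window t th in gv z0 nv.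
have [C [C0 hC]] := symbol_lipschitz a_gt0 gv.
have [D [D0 hD]] := zak_lipschitz a_gt0 `|t| nv.
set z := zak a v t th in z0; set B := symbol a g v t th.
have zp : 0 < cmod z by rewrite cmod_gt0.
pose M := C + cmod (B / cj z) * D; have M0 : 0 <= M by rewrite addr_ge0 ?mulr_ge0 ?cmod_ge0.
pose d := Num.min 1 (Num.min (cmod z / (4 * (D + 1))) (e * cmod z / (4 * (M + 1)))).
have D1 : 0 < 4 * (D + 1) by rewrite mulr_gt0 // ltr_wpDl.
have M1 : 0 < 4 * (M + 1) by rewrite mulr_gt0 // ltr_wpDl.
have d0 : 0 < d by rewrite !lt_min ltr01 !divr_gt0 // mulr_gt0.
have [d1 dD dM] : [/\ d <= 1, d * (4 * (D + 1)) <= cmod z & d * (4 * (M + 1)) <= e * cmod z].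
  by rewrite -!ler_pdivlMr // !ge_min !lexx !orbT.
exists d; split=> // t' th' tt hh.
set z' := zak a v t' th'; set B' := symbol a g v t' th'.
pose s := `|t - t'| + `|th - th'|; have sd : s < 2 * d by rewrite /s; lra.
have s0 : 0 <= s by rewrite addr_ge0.
have Bs : cmod (B - B') <= C * s := hC t t' th th'.
have zs : cmod (z - z') <= D * s.
  by apply: hD => //; apply: le_trans (ltW tt) d1.
have z'big : cmod z / 2 <= cmod z'.
  have := cmodD (z - z') z'; rewrite subrK => h.
  have : D * s <= cmod z / 2.
    apply: (@le_trans _ _ (D * (2 * d))); first by rewrite ler_wpM2l // ltW.
    by nra.
  lra.
have zp' : 0 < cmod z' by apply: lt_le_trans z'big; rewrite divr_gt0.
have z'0 : z' != 0 by rewrite -cmod_gt0.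
rewrite (kappaE gv z0) (kappaE gv z'0) -/B -/B' -/z -/z'.
have -> : B / cj z - B' / cj z' = ((B - B') - (B / cj z) * cj (z - z')) / cj z'.
  by rewrite cjB; field; rewrite !conjc_eq0 z0 z'0.
rewrite cmodM cmodV cmod_conj ltr_pdivrMr //.
apply: (@le_lt_trans _ _ (M * s)).
  apply: le_trans (cmodD _ _) _; rewrite cmodN cmodM cmod_conj /M mulrDl lerD //.
  by rewrite -mulrA ler_wpM2l ?cmod_ge0.
apply: (@lt_le_trans _ _ (e * (cmod z / 2))); last by rewrite ler_wpM2l // ltW.
apply: (@le_lt_trans _ _ (M * (2 * d))); first by rewrite ler_wpM2l // ltW.
nra.
Qed.

Lemma no_form_bounded_below : False.
Proof.
exact: (no_quasi_periodic a_gt0 kappa_neq0 kappa_cont kappa_quasi kappa_period).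
Qed.

End Obstruction.

(** * Reproducing pairs *)

Section ReproducingPairs.
Context {R : realType}.
Implicit Types (f q : R -> R[i]).

Lemma n2_L2eq f q : L2 f -> L2 q -> L2eq f q -> n2 f = n2 q.
Proof.
move=> Lf Lq fq; rewrite /n2 /nsq /rint; congr (Num.sqrt (fine _)).
apply: ae_eq_integral => //.
- exact/measurable_EFinP/cmeas_sqr/L2_meas.
- exact/measurable_EFinP/cmeas_sqr/L2_meas.
have FF := ae_filter_ringOfSetsType (@lebesgue_measure R).
by apply: filterS fq => t h _; rewrite h.
Qed.

Lemma inner_L2eq f f' q : L2 f -> L2 f' -> L2 q -> L2eq f f' -> inner f q = inner f' q.
Proof.
move=> Lf Lf' Lq ff'; apply/eqP; rewrite -subr_eq0 -innerBl // -cmod_eq0.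
have L0 : L2 (fun=> 0 : R[i]) by exact: L20.
have n0 : n2 (fun t => f t - f' t) = 0.
  rewrite -(n20 (R := R)); apply: n2_L2eq => //; first exact: L2B.
  have FF := ae_filter_ringOfSetsType (@lebesgue_measure R).
  by apply: filterS ff' => t h /h ->; rewrite subrr.
rewrite eq_le cmod_ge0 andbT -(mul0r (n2 q)) -n0.
by apply: cauchy_schwarz => //; exact: L2B.
Qed.

Lemma bounded_operator_n2 S : bounded_operator S ->
  exists C : R, 0 < C /\ forall f, L2 f -> n2 (S f) <= C * n2 f.
Proof.
move=> [LS _ _ [C hC]]; exists (`|C| + 1); split=> [|f Lf]; first by rewrite ltr_wpDl.
have := hC f Lf; rewrite !L2norm_n2 //; last exact: LS.
rewrite -EFinM lee_fin => /le_trans; apply.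
by rewrite ler_wpM2r ?n2_ge0 // (le_trans (ler_norm C)) // lerDl.
Qed.

Variables (a : R) (g gamma : R -> R[i]).
Hypotheses (Lg : L2 g) (Lgam : L2 gamma).
Hypothesis pair : reproducing_pair (gabor g a a^-1) (gabor gamma a a^-1).

(** Pair [f] with its image under the reproducing operator [S]. *)
Lemma reproducing_pair_below : form_bounded_below a g gamma.
Proof.
have [_ _ [S [wS bS [S' [bS' _ S'S]]]]] := pair.
have [C [C0 hC]] := bounded_operator_n2 bS'.
have [LS _ _ _] := bS; have [LS' _ _ _] := bS'.
exists C^-1; split; first by rewrite invr_gt0.
move=> f Lf; have LSf := LS f Lf.
have n2f : n2 f <= C * n2 (S f).
  by rewrite -(n2_L2eq (LS' _ LSf) Lf (S'S f Lf)); exact: hC.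
exists (S f), (inner (S f) (S f)); split=> //.
- exact: wS.
- rewrite inner_self // cmod_real ger0_norm ?nsq_ge0 // -n2_sqr expr2.
  by rewrite ler_wpM2r ?n2_ge0 // ler_pdivrMl.
- by move=> f0; rewrite -(pmulr_rgt0 _ C0); exact: lt_le_trans n2f.
Qed.

(** Pair [f] with its preimage under [S], in the conjugate of the form. *)
Lemma reproducing_pair_above : form_bounded_below a gamma g.
Proof.
have [Lpsi Lphi [S [wS bS [S' [bS' SS' _]]]]] := pair.
have [C [C0 hC]] := bounded_operator_n2 bS'.
have [D [D0 hD]] := bounded_operator_n2 bS.
have [LS _ _ _] := bS; have [LS' _ _ _] := bS'.
exists C^-1; split; first by rewrite invr_gt0.
move=> f Lf; have LSf := LS' f Lf; have LSS := LS _ LSf.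
exists (S' f), (cj (inner (S (S' f)) f)); split=> //.
- have := has_usum_conj (wS _ _ LSf Lf); apply: eq_has_usum => k.
  by rewrite cjM -!inner_conj // mulrC.
- rewrite (inner_L2eq LSS Lf Lf (SS' f Lf)) cmod_conj.
  rewrite inner_self // cmod_real ger0_norm ?nsq_ge0 // -n2_sqr expr2.
  by rewrite mulrAC ler_wpM2r ?n2_ge0 // ler_pdivrMl // hC.
- move=> f0; rewrite -(pmulr_rgt0 _ D0); apply: lt_le_trans f0 _.
  by rewrite -(n2_L2eq LSS Lf (SS' f Lf)); exact: hD.
Qed.

End ReproducingPairs.

Theorem corollary7 (R : realType) (h : R -> R[i]) (a : R) (g gamma : R -> R[i])
    (h_schwartz : schwartz h) (h_neq0 : exists t : R, h t != 0)
    (a_gt0 : 0 < a) (g_L2 : L2 g) (gamma_L2 : L2 gamma)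
    (gp : reproducing_pair (gabor g a a^-1) (gabor gamma a a^-1)) :
  ~ modulation_space h 1%E 1 g /\ ~ modulation_space h 1%E 1 gamma.
Proof.
have nh := schwartz_nice h_schwartz; have [t1 ht1] := h_neq0.
split=> m1.
- apply: (no_form_bounded_below a_gt0 g_L2 gamma_L2 (reproducing_pair_below gp)).
  by move=> t th; exact: good_window_exists m1 ht1.
- apply: (no_form_bounded_below a_gt0 gamma_L2 g_L2 (reproducing_pair_above gp)).
  by move=> t th; exact: good_window_exists m1 ht1.
Qed.
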